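(* There exists a domain $\Omega$ in $\mathbb{C}^2$ whose envelope of holomorphy $(\widetilde{\Omega},\pi)$ has two sheets over $\Omega$ but three sheets over $\mathbb{C}^2$; that is, $\max_{z\in\Omega}\#\pi^{-1}(z)=2$ and $\max_{z\in\mathbb{C}^2}\#\pi^{-1}(z)=3$.
   Context: A Riemann domain over $\mathbb{C}^n$ is a connected complex manifold $X$ of dimension $n$ together with a locally biholomorphic map $\pi:X\to\mathbb{C}^n$ (the projection; Riemann domains are unbranched). The envelope of holomorphy of a domain $\Omega\subset\mathbb{C}^n$ is the smallest Stein Riemann domain $(\widetilde{\Omega},\pi)$ over $\mathbb{C}^n$ to which all functions holomorphic on $\Omega$ extend holomorphically; it comes with a natural embedding $\alpha:\Omega\to\widetilde{\Omega}$ with $\pi\circ\alpha=\mathrm{id}_\Omega$, and $f\in\mathcal{O}(\Omega)$ extends to $\widetilde f\in\mathcal{O}(\widetilde\Omega)$ in the sense that $\widetilde f\circ\alpha=f$. The number of sheets of $\widetilde{\Omega}$ over a set $S\subset\mathbb{C}^n$ is the maximal number of points in a fibre $\pi^{-1}(z)$, $z\in S$. *)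

(* Defs.v *)
From HB Require Import structures.
From mathcomp Require Import all_boot all_order all_algebra.
From mathcomp Require Import complex.
From mathcomp Require Import all_classical all_reals all_analysis.

Set Implicit Arguments.
Unset Strict Implicit.
Unset Printing Implicit Defensive.

Import Order.TTheory GRing.Theory Num.Theory.
Import numFieldNormedType.Exports.

Local Open Scope classical_set_scope.
Local Open Scope card_scope.
Local Open Scope ring_scope.

(* The complex numbers R[i], packed as a numClosedFieldType so that the
   topological and normed structures attached to such fields are inferred. *)
Definition Cx (R : realType) : numClosedFieldType := R[i].
Arguments Cx : simpl never.

(* A chart is a homeomorphism from the open set [chart_dom] onto the open set
   [chart_map @` chart_dom]; the values of the total functions [chart_map] and
   [chart_inv] outside these two sets are irrelevant. *)
Record chart (R : realType) (V : normedModType (Cx R)) (X : topologicalType) :=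
  Chart {
    chart_dom : set X ;
    chart_map :> X -> V ;
    chart_inv : V -> X }.

Definition is_chart (R : realType) (V : normedModType (Cx R))
    (X : topologicalType) (c : chart V X) : Prop :=
  [/\ open (chart_dom c),
      open (c @` chart_dom c),
      forall x, chart_dom c x -> {for x, continuous c},
      forall v, (c @` chart_dom c) v -> {for v, continuous (chart_inv c)} &
      forall x, chart_dom c x -> chart_inv c (c x) = x].

(* [differentiable] is Frechet differentiability over the scalar field Cx R,
   i.e. complex differentiability; on open sets it is holomorphy. *)
Definition holo_compatible (R : realType) (V : normedModType (Cx R))
    (X : topologicalType) (c d : chart V X) : Prop :=
  forall x, chart_dom c x -> chart_dom d x ->
    differentiable (d \o chart_inv c) (c x).

Record charted (R : realType) (V : normedModType (Cx R)) := Charted {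
  carrier :> topologicalType ;
  atlas : set (chart V carrier) }.
Arguments atlas {R V} X : rename.

Definition complex_manifold (R : realType) (V : normedModType (Cx R))
    (X : charted V) : Prop :=
  [/\ hausdorff_space X,
      @second_countable X,
      forall c, atlas X c -> is_chart c,
      forall x : X, exists2 c, atlas X c & chart_dom c x &
      forall c d, atlas X c -> atlas X d -> holo_compatible c d].

Definition model_space (R : realType) (V : normedModType (Cx R)) : charted V :=
  Charted [set Chart [set: V] id id].

Definition Cspace (R : realType) (n : nat) : charted 'rV[Cx R]_n :=
  model_space 'rV[Cx R]_n.

Definition Cline (R : realType) : charted (Cx R) := model_space (Cx R).

(* Holomorphy on A of a map between manifolds; meant for open A. *)
Definition holo_on (R : realType) (V W : normedModType (Cx R))
    (X : charted V) (Y : charted W) (A : set X) (f : X -> Y) : Prop :=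
  forall x, A x ->
    {for x, continuous f} /\
    forall c d, atlas X c -> atlas Y d -> chart_dom c x -> chart_dom d (f x) ->
      differentiable (d \o f \o chart_inv c) (c x).

Definition locally_biholomorphic (R : realType) (V W : normedModType (Cx R))
    (X : charted V) (Y : charted W) (p : X -> Y) : Prop :=
  forall x, exists (U : set X) (g : Y -> X),
    [/\ open U /\ U x, open (p @` U),
        forall u, U u -> g (p u) = u,
        holo_on U p & holo_on (p @` U) g].

Record riemann_domain (R : realType) (n : nat) := RiemannDomain {
  rd_space :> charted 'rV[Cx R]_n ;
  rd_proj : rd_space -> Cspace R n ;
  rd_manifold : complex_manifold rd_space ;
  rd_nonempty : [set: rd_space] !=set0 ;
  rd_connected : connected [set: rd_space] ;
  rd_projP : locally_biholomorphic rd_proj }.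

Definition holo_fun (R : realType) (V : normedModType (Cx R)) (X : charted V)
    (f : X -> Cline R) : Prop := holo_on [set: X] f.

(* [|f x| <= sup_K |f|] is phrased through the upper bounds M of |f| on K; in
   the order of Cx R such an M is necessarily real. *)
Definition holo_hull (R : realType) (V : normedModType (Cx R)) (X : charted V)
    (K : set X) : set X :=
  [set x | forall f : X -> Cline R, holo_fun f ->
     forall M : Cx R, (forall y, K y -> `|f y : Cx R| <= M) ->
       `|f x : Cx R| <= M].

Definition stein (R : realType) (V : normedModType (Cx R)) (X : charted V)
    : Prop :=
  (forall K : set X, compact K -> compact (holo_hull K)) /\
  (forall x y : X, x <> y ->
     exists2 f : X -> Cline R, holo_fun f & f x <> f y).

Definition is_domain (R : realType) (n : nat) (Omega : set (Cspace R n))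
    : Prop :=
  [/\ open Omega, connected Omega & Omega !=set0].

(* Only the restriction of [a] to Omega matters. There [a] is a holomorphic
   section of the projection, hence automatically an open embedding. *)
Definition extends_all (R : realType) (n : nat) (Omega : set (Cspace R n))
    (X : riemann_domain R n) (a : Cspace R n -> X) : Prop :=
  [/\ holo_on Omega a,
      forall z, Omega z -> rd_proj (a z) = z &
      forall f : Cspace R n -> Cline R, holo_on Omega f ->
        exists2 F : X -> Cline R, holo_fun F &
          forall z, Omega z -> F (a z) = f z].

(* "Smallest" is with respect to holomorphic injections over C^n that are
   compatible with the embeddings of Omega. *)
Definition is_envelope (R : realType) (n : nat) (Omega : set (Cspace R n))
    (X : riemann_domain R n) (a : Cspace R n -> X) : Prop :=
  [/\ stein X, extends_all Omega a &
      forall (Y : riemann_domain R n) (b : Cspace R n -> Y),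
        stein Y -> extends_all Omega b ->
        exists phi : X -> Y,
          [/\ holo_on [set: X] phi, injective phi,
              forall x, rd_proj (phi x) = rd_proj x &
              forall z, Omega z -> phi (a z) = b z]].

Definition fibre (R : realType) (n : nat) (X : riemann_domain R n)
    (z : Cspace R n) : set X := [set x | rd_proj x = z].
Arguments fibre {R n} X z.

(* The maximum over z in S of the number of points of the fibre is m. *)
Definition sheets_over (R : realType) (n : nat) (X : riemann_domain R n)
    (S : set (Cspace R n)) (m : nat) : Prop :=
  (exists2 z, S z & fibre X z #= `I_m) /\
  (forall z, S z -> fibre X z #<= `I_m).

(* Main.v *)
Require Import Defs.
From HB Require Import structures.
From mathcomp Require Import all_boot all_order all_algebra.
From mathcomp Require Import complex zify ring lra.
From mathcomp Require Import all_classical all_reals all_analysis.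

(** Both the domain and its envelope come from tubes in the plane of logarithms.
    The tube over a set E of the real plane consists of the points v of C^2 whose
    pair of imaginary parts lies in E, and [proj] is the exponential in each
    variable, normalized so that two points have the same image exactly when they
    differ by i times a vector of the lattice of multiples of 15.  Take a convex
    [hexagon] and, inside it, the [pinwheel] formed by six thin triangles that
    join the origin to the six vertices.  The domain is the image under [proj] of
    the tube over the pinwheel; the envelope is the tube over the hexagon, spread
    over C^2 by [proj].

    Counting sheets is plane geometry: the fibre over [proj v] consists of the
    lattice translates of the imaginary part of v that lie in the hexagon.  The
    points (-10, 5), (5, -10) and (5, 5) are congruent and lie in the hexagon.
    There are never more than three, since the difference of two congruent points
    of the hexagon is one of six short lattice vectors ([hexagon_translate]), on
    which the colour i - j modulo 3 does not vanish.  A point of one of the six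
    triangles has only one possible further translate in the hexagon, and none in
    the pinwheel ([pinwheel_translate]).  Hence there are at most two sheets over
    the domain, and [proj] is injective on the tube over the pinwheel, which
    makes the domain a domain of C^2 rather than one spread over it.

    Every holomorphic function on the tube over the pinwheel extends to the tube
    over the hexagon, because each point of the hexagon lies in a triangle with
    vertices 0, a, b, where a and b are points of the pinwheel.  This is Bochner's
    tube theorem for a star-shaped base ([star_tube]).  Its core
    ([step_extends]) pushes the domain of definition across a line
    y1 + y2 = s: the extension is a Cauchy integral over a rectangle in a bent
    complex line whose boundary stays in the domain.  The estimate of the integral
    also shows that near each point the extension is bounded by a multiple of the
    supremum of the function over a compact set of the smaller tube.

    The tube over the convex hexagon is Stein ([tube_stein]): the coordinates
    bound the hull, and the exponentials of the linear forms that define the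
    sides keep it away from the boundary.

    For minimality ([minimal]), let Y be a Stein Riemann domain to which all
    functions extend.  A point of Y lies over a point v of the tube when the two
    extensions of every function agree there; it is then unique, as functions on Y
    separate points.  The points near which such a lift exists form an open set
    containing the tube over the pinwheel.  This set is closed: by the estimate
    above, applied to powers of functions so that the constant becomes 1, the lifts
    near a limit point stay in the hull of a compact set, and a cluster point
    provides a local section of the projection of Y that continues the lift.

    The one-variable theory rests on contour integrals over rectangles, taken as
    limits of midpoint sums along an ultrafilter.  Such an integral is linear,
    bounded by the supremum, and zero for holomorphic integrands, by bisection
    ([goursat]); the winding integral is only bounded from below ([cw_im]).  This
    is enough for a Cauchy formula, for second order estimates, for the
    differentiability of integrals in a parameter, and for the identity theorem. *)


Set Implicit Arguments.
Unset Strict Implicit.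
Unset Printing Implicit Defensive.

Import Order.TTheory GRing.Theory Num.Theory.
Import numFieldNormedType.Exports.

Local Open Scope classical_set_scope.
Local Open Scope ring_scope.

(** * Complex numbers and their real modulus *)

Section ComplexModulus.
Context {R : realType}.
Implicit Types (z w : Cx R) (x y r : R).

Definition cx x y : Cx R := Complex x y.
Definition rc x : Cx R := cx x 0.
Definition ii : Cx R := cx 0 1.
Definition re z : R := complex.Re z.
Definition im z : R := complex.Im z.
(** The absolute value with values in the real field, so that real arithmetic applies
    to estimates; the norm of a complex number is its image under [rc]. *)
Definition md z : R := Num.sqrt (re z ^+ 2 + im z ^+ 2).

Lemma cxP z w : re z = re w -> im z = im w -> z = w.
Proof. by case: z w => [a b] [c d]; rewrite /re /im /= => -> ->. Qed.

Lemma re_cx x y : re (cx x y) = x. Proof. by []. Qed.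
Lemma im_cx x y : im (cx x y) = y. Proof. by []. Qed.
Lemma re_rc x : re (rc x) = x. Proof. by []. Qed.
Lemma im_rc x : im (rc x) = 0. Proof. by []. Qed.
Lemma re_ii : re ii = 0. Proof. by []. Qed.
Lemma im_ii : im ii = 1. Proof. by []. Qed.
Lemma re0 : re 0 = 0. Proof. by []. Qed.
Lemma im0 : im 0 = 0. Proof. by []. Qed.
Lemma re1 : re 1 = 1. Proof. by []. Qed.
Lemma im1 : im 1 = 0. Proof. by []. Qed.
Lemma reD z w : re (z + w) = re z + re w. Proof. by case: z w => [? ?] []. Qed.
Lemma imD z w : im (z + w) = im z + im w. Proof. by case: z w => [? ?] []. Qed.
Lemma reN z : re (- z) = - re z. Proof. by case: z. Qed.
Lemma imN z : im (- z) = - im z. Proof. by case: z. Qed.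
Lemma reM z w : re (z * w) = re z * re w - im z * im w.
Proof. by case: z w => [? ?] []. Qed.
Lemma imM z w : im (z * w) = re z * im w + im z * re w.
Proof. by case: z w => [? ?] [? ?]. Qed.

Definition reimE := (reD, imD, reN, imN, reM, imM, re_cx, im_cx, re_rc, im_rc,
  re_ii, im_ii, re0, im0, re1, im1).

Lemma rcD x y : rc (x + y) = rc x + rc y.
Proof. by apply: cxP; rewrite !reimE // addr0. Qed.
Lemma rcN x : rc (- x) = - rc x.
Proof. by apply: cxP; rewrite !reimE // oppr0. Qed.
Lemma rcB x y : rc (x - y) = rc x - rc y.
Proof. by rewrite rcD rcN. Qed.
Lemma rcM x y : rc (x * y) = rc x * rc y.
Proof. by apply: cxP; rewrite !reimE; ring. Qed.
Lemma rc0 : rc 0 = 0. Proof. by []. Qed.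
Lemma rc1 : rc 1 = 1. Proof. by []. Qed.
Lemma rc_inj x y : rc x = rc y -> x = y. Proof. by case. Qed.
Lemma rc_eq0 x : (rc x == 0) = (x == 0).
Proof. by apply/eqP/eqP => [|->//]; rewrite -rc0 => /rc_inj. Qed.
Lemma rcV x : rc x^-1 = (rc x)^-1.
Proof.
have [->|x0] := eqVneq x 0; first by rewrite invr0 rc0 invr0.
apply: (@mulfI _ (rc x)); first by rewrite rc_eq0.
by rewrite -rcM divff // divff // rc_eq0.
Qed.
Lemma cxE x y : cx x y = rc x + ii * rc y.
Proof. by apply: cxP; rewrite !reimE; ring. Qed.
Lemma normE z : `|z| = rc (md z).
Proof. by rewrite /md; exact: (normc_def z). Qed.

Lemma rc_le x y : (rc x <= rc y) = (x <= y). Proof. exact: (lecR x y). Qed.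
Lemma rc_lt x y : (rc x < rc y) = (x < y). Proof. exact: (ltcR x y). Qed.

Lemma md_ge0 z : 0 <= md z. Proof. exact: sqrtr_ge0. Qed.
Lemma md_rc x : md (rc x) = `|x|.
Proof. by rewrite /md !reimE expr0n addr0 sqrtr_sqr. Qed.
Lemma md0 : md 0 = 0. Proof. by rewrite -rc0 md_rc normr0. Qed.
Lemma md1 : md 1 = 1. Proof. by rewrite -rc1 md_rc normr1. Qed.
Lemma md_eq0 z : (md z == 0) = (z == 0).
Proof. by rewrite -[RHS]normr_eq0 normE rc_eq0. Qed.
Lemma md_gt0 z : (0 < md z) = (z != 0).
Proof. by rewrite lt_neqAle md_ge0 andbT eq_sym md_eq0. Qed.
Lemma mdM z w : md (z * w) = md z * md w.
Proof. by apply: rc_inj; rewrite rcM -!normE normrM. Qed.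
Lemma mdN z : md (- z) = md z.
Proof. by apply: rc_inj; rewrite -!normE normrN. Qed.
Lemma mdB z w : md (z - w) = md (w - z).
Proof. by rewrite -mdN opprB. Qed.
Lemma mdD z w : md (z + w) <= md z + md w.
Proof. by rewrite -rc_le rcD -!normE ler_normD. Qed.
Lemma mdDB z w : md (z - w) <= md z + md w.
Proof. by rewrite -(mdN w) mdD. Qed.
Lemma mdV z : md z^-1 = (md z)^-1.
Proof. by apply: rc_inj; rewrite rcV -!normE normfV. Qed.
Lemma mdX z n : md (z ^+ n) = md z ^+ n.
Proof. by elim: n => [|n IH]; rewrite ?expr0 ?md1 // !exprS mdM IH. Qed.
Lemma md_ii : md ii = 1.
Proof. by rewrite /md !reimE expr0n expr1n add0r sqrtr1. Qed.
Lemma le_re_md z : `|re z| <= md z.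
Proof. by rewrite /md -sqrtr_sqr ler_wsqrtr // lerDl sqr_ge0. Qed.
Lemma le_im_md z : `|im z| <= md z.
Proof. by rewrite /md -sqrtr_sqr ler_wsqrtr // lerDr sqr_ge0. Qed.
Lemma md_le z : md z <= `|re z| + `|im z|.
Proof.
have {1}-> : z = rc (re z) + ii * rc (im z) by apply: cxP; rewrite !reimE; ring.
by rewrite (le_trans (mdD _ _)) // mdM md_ii mul1r !md_rc.
Qed.

End ComplexModulus.

(** * The plane C^2: coordinates, norm, differentiability *)

Section Plane.
Context {R : realType}.
Implicit Types (z w : Cx R) (x y r : R).

Local Notation V := 'rV[Cx R]_2.
Implicit Types (u v : V).

Definition c0 v : Cx R := v ord0 ord0.
Definition c1 v : Cx R := v ord0 ord_max.
Definition mk z w : V := \row_j (if j == ord0 then z else w).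

Lemma c0_mk z w : c0 (mk z w) = z. Proof. by rewrite /c0 mxE. Qed.
Lemma c1_mk z w : c1 (mk z w) = w. Proof. by rewrite /c1 mxE. Qed.

Lemma ord2P (P : 'I_2 -> Prop) : P ord0 -> P ord_max -> forall i, P i.
Proof.
move=> P0 P1 [[|[|//]] p].
- by rewrite (_ : Ordinal p = ord0) //; exact: val_inj.
- by rewrite (_ : Ordinal p = ord_max) //; exact: val_inj.
Qed.

Lemma vP u v : c0 u = c0 v -> c1 u = c1 v -> u = v.
Proof. by move=> e0 e1; apply/rowP; apply: ord2P. Qed.

Lemma c0D u v : c0 (u + v) = c0 u + c0 v. Proof. by rewrite /c0 mxE. Qed.
Lemma c1D u v : c1 (u + v) = c1 u + c1 v. Proof. by rewrite /c1 mxE. Qed.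
Lemma c0N u : c0 (- u) = - c0 u. Proof. by rewrite /c0 mxE. Qed.
Lemma c1N u : c1 (- u) = - c1 u. Proof. by rewrite /c1 mxE. Qed.
Lemma c0Z z u : c0 (z *: u) = z * c0 u. Proof. by rewrite /c0 mxE. Qed.
Lemma c1Z z u : c1 (z *: u) = z * c1 u. Proof. by rewrite /c1 mxE. Qed.
Lemma c00 : c0 0 = 0. Proof. by rewrite /c0 mxE. Qed.
Lemma c10 : c1 0 = 0. Proof. by rewrite /c1 mxE. Qed.
Definition cE := (c0D, c1D, c0N, c1N, c0Z, c1Z, c00, c10, c0_mk, c1_mk).

(** The maximum norm of C^2 with values in the real field. *)
Definition vmd v : R := Num.max (md (c0 v)) (md (c1 v)).

Lemma vnormE v : `|v| = rc (vmd v).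
Proof.
have le1 : rc (vmd v) <= `|v|.
  have hi i : `|v ord0 i| <= `|v|.
    rewrite [leRHS]/Num.norm /= mx_normE.
    have -> : `|v ord0 i| = (`|v ord0 i|%:nng)%:num by [].
    rewrite num_le.
    by apply: (le_bigmax _ (fun i => `|v i.1 i.2|%:nng) (ord0, i)).
  rewrite /vmd /Num.max; case: ifP => _.
  - by have := hi ord_max; rewrite normE.
  - by have := hi ord0; rewrite normE.
apply/eqP; rewrite eq_le le1 andbT.
have [->|v0] := eqVneq v 0; first by rewrite normr0 -rc0 rc_le /vmd le_max md_ge0.
have [[i j] ->] : exists i, `|v| = `|v i.1 i.2| by apply: mx_norm_neq0; rewrite (normr_eq0 v).
rewrite /= ord1 normE rc_le /vmd le_max.
by move: j; apply: ord2P; rewrite lexx ?orbT.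
Qed.

Lemma vmd_ge0 v : 0 <= vmd v. Proof. by rewrite le_max md_ge0. Qed.
Lemma vmd_lt v r : (vmd v < r) = (md (c0 v) < r) && (md (c1 v) < r).
Proof. exact: gt_max. Qed.
Lemma vmd_c0 v : md (c0 v) <= vmd v. Proof. by rewrite le_max lexx. Qed.
Lemma vmd_c1 v : md (c1 v) <= vmd v. Proof. by rewrite le_max lexx orbT. Qed.

(** Neighbourhoods in the normed spaces over the field of complex numbers,
    with radii taken in the real field. *)
Lemma pos_rc (e : Cx R) : 0 < e -> e = rc (re e) /\ 0 < re e.
Proof.
move=> e0; have : 0 < e := e0; rewrite ltcE => /andP[/eqP i r]; split => //.
by apply: cxP; rewrite ?re_rc ?im_rc //; apply: esym; rewrite i.
Qed.

Lemma nbhs_cP z (P : set (Cx R)) :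
  nbhs z P <-> exists2 d : R, 0 < d & forall w, md (w - z) < d -> P w.
Proof.
split.
- move=> /nbhs_ballP[e /= e0 he]; have [-> r0] := pos_rc e0; exists (re e) => // w hw.
  by apply: he; rewrite /ball /= distrC normE; have [-> _] := pos_rc e0; rewrite rc_lt.
- move=> [d d0 hd]; apply/nbhs_ballP; exists (rc d); first by rewrite /= -rc0 rc_lt.
  by move=> w; rewrite /ball /= distrC normE rc_lt; exact: hd.
Qed.

Lemma nbhs_vP v (P : set V) :
  nbhs v P <-> exists2 d : R, 0 < d & forall w : V, vmd (w - v) < d -> P w.
Proof.
split.
- move=> /nbhs_ballP[e /= e0 he]; have [-> r0] := pos_rc e0; exists (re e) => // w hw.
  apply: he; rewrite -ball_normE /ball_ /= distrC vnormE.
  by have [-> _] := pos_rc e0; rewrite rc_lt.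
- move=> [d d0 hd]; apply/nbhs_ballP; exists (rc d); first by rewrite /= -rc0 rc_lt.
  by move=> w; rewrite -ball_normE /ball_ /= distrC vnormE rc_lt; exact: hd.
Qed.

End Plane.

Section DifferentiableIntro.
Context {K : numFieldType} {V W : normedModType K}.

Lemma differentiable_intro (f : V -> W) x (df : {linear V -> W}) :
  continuous df ->
  (forall e, 0 < e -> \forall h \near (0 : V), `|f (h + x) - f x - df h| <= e * `|h|) ->
  differentiable f x.
Proof.
move=> dfc H.
have E : f \o shift x = cst (f x) + df +o_ 0 id.
  apply/eqaddoP => e e0; near=> h.
  rewrite -[_ h]/(f (h + x) - (f x + df h)) opprD addrA.
  by near: h; exact: H.
by apply/diff_locallyP; rewrite (diff_unique dfc E).
Unshelve. all: by end_near. Qed.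

End DifferentiableIntro.

Section Differentials.
Context {R : realType}.
Local Notation V := 'rV[Cx R]_2.

Lemma nbhs0_cP (P : set (Cx R)) :
  nbhs (0 : Cx R) P <-> exists2 d : R, 0 < d & forall w, md w < d -> P w.
Proof.
by split=> [/nbhs_cP|] [d d0 h]; [|apply/nbhs_cP]; exists d => // w; have := h w; rewrite subr0.
Qed.

Lemma nbhs0_vP (P : set V) :
  nbhs (0 : V) P <-> exists2 d : R, 0 < d & forall w, vmd w < d -> P w.
Proof.
by split=> [/nbhs_vP|] [d d0 h]; [|apply/nbhs_vP]; exists d => // w; have := h w; rewrite subr0.
Qed.

(** Differentiability in one variable, with the derivative as a number and all
    errors measured by [md]. *)
Lemma diff_c_elim (g : Cx R -> Cx R) z : differentiable g z ->
  exists D, forall e : R, 0 < e -> exists2 d, 0 < d &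
    forall h, md h < d -> md (g (z + h) - g z - D * h) <= e * md h.
Proof.
move=> dg; exists ('d g z 1) => e e0.
have /diff_locally /eqaddoP /(_ (rc e)) := dg.
rewrite -rc0 rc_lt => /(_ e0) /nbhs0_cP[d d0 hd]; exists d => // h /hd.
rewrite -[(_ - _) h]/(g (h + z) - (g z + 'd g z h)) !normE -rcM rc_le.
rewrite opprD addrA [h + z]addrC.
suff -> : 'd g z h = 'd g z 1 * h by [].
by rewrite -{1}[h]mulr1 -[h * 1]/(h *: (1 : Cx R)) linearZ /= mulrC.
Qed.

Lemma diff_c_intro (g : Cx R -> Cx R) z D :
  (forall e : R, 0 < e -> exists2 d, 0 < d &
    forall h, md h < d -> md (g (z + h) - g z - D * h) <= e * md h) ->
  differentiable g z.
Proof.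
move=> H; pose L (h : Cx R) : Cx R := D * h.
have Llin : linear L by move=> k x y; rewrite /L -[k *: _]/(k * _) -[k *: _ in RHS]/(k * _); ring.
pose LM := GRing.isLinear.Build _ _ _ _ _ Llin.
pose LL : {linear Cx R -> Cx R} := HB.pack L LM.
apply: (@differentiable_intro _ _ _ _ _ LL).
  move=> x; rewrite -[_ LL]/L /L; exact: mulrl_continuous.
move=> e e0; have [ee r0] := pos_rc e0; apply/nbhs0_cP.
have [d d0 hd] := H _ r0; exists d => // w /hd.
by rewrite [z + w]addrC ee !normE -rcM rc_le.
Qed.

(** The same in two variables; [a] and [b] are the partial derivatives. *)
Lemma diff_v_elim (f : V -> Cx R) v : differentiable f v ->
  exists a b, forall e : R, 0 < e -> exists2 d, 0 < d &
    forall h, vmd h < d -> md (f (v + h) - f v - (a * c0 h + b * c1 h)) <= e * vmd h.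
Proof.
move=> dg; exists ('d f v (mk 1 0)), ('d f v (mk 0 1)) => e e0.
have /diff_locally /eqaddoP /(_ (rc e)) := dg.
rewrite -rc0 rc_lt => /(_ e0) /nbhs0_vP[d d0 hd]; exists d => // h /hd.
rewrite -[(_ - _) h]/(f (h + v) - (f v + 'd f v h)) normE vnormE -rcM rc_le.
rewrite opprD addrA [h + v]addrC.
suff -> : 'd f v h = 'd f v (mk 1 0) * c0 h + 'd f v (mk 0 1) * c1 h by [].
have {1}-> : h = c0 h *: mk 1 0 + c1 h *: mk 0 1.
  by apply: vP; rewrite !cE ?mulr1 ?mulr0 ?addr0 ?add0r.
by rewrite linearD !linearZ /= ![_ *: _]mulrC.
Qed.

Lemma diff_v_intro (f : V -> Cx R) v a b :
  (forall e : R, 0 < e -> exists2 d, 0 < d &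
    forall h, vmd h < d -> md (f (v + h) - f v - (a * c0 h + b * c1 h)) <= e * vmd h) ->
  differentiable f v.
Proof.
move=> H.
pose L (h : V) : Cx R := a * c0 h + b * c1 h.
have Llin : linear L by move=> k x y; rewrite /L !cE -[k *: _]/(k * _); ring.
pose LM := GRing.isLinear.Build _ _ _ _ _ Llin.
pose LL : {linear V -> Cx R} := HB.pack L LM.
apply: (@differentiable_intro _ _ _ _ _ LL).
  move=> x; have : differentiable ((a *: c0 + b *: c1) : V -> Cx R) x.
    by apply: differentiableD; apply: differentiableZ; apply: differentiable_coord.
  by move=> /differentiable_continuous.
move=> e e0; have [ee r0] := pos_rc e0; apply/nbhs0_vP.
have [d d0 hd] := H _ r0; exists d => // w /hd.
by rewrite [v + w]addrC ee normE vnormE -rcM rc_le.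
Qed.

Lemma diff_mk (T : normedModType (Cx R)) (f g : T -> Cx R) x :
  differentiable f x -> differentiable g x ->
  differentiable (fun t => mk (f t) (g t) : V) x.
Proof.
move=> df dg.
have -> : (fun t => mk (f t) (g t)) = (fun t => f t *: mk 1 0) + (fun t => g t *: mk 0 1).
  by apply/funext => t; apply: vP; rewrite !cE ?mulr1 ?mulr0 ?addr0 ?add0r.
by apply: differentiableD; apply: differentiableZl.
Qed.

Lemma diff_c0 v : differentiable (c0 : V -> Cx R) v.
Proof. exact: differentiable_coord. Qed.
Lemma diff_c1 v : differentiable (c1 : V -> Cx R) v.
Proof. exact: differentiable_coord. Qed.

End Differentials.

Section DifferentialRules.
Context {R : realType} {T : normedModType (Cx R)}.
Implicit Types (f g : T -> Cx R) (x : T).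

Lemma dCst (a : Cx R) x : differentiable (fun _ : T => a) x.
Proof. exact: (differentiable_cst a x). Qed.

Lemma dAdd f g x : differentiable f x -> differentiable g x ->
  differentiable (fun t => f t + g t) x.
Proof. exact: (@differentiableD _ _ _ f g x). Qed.

Lemma dOpp f x : differentiable f x -> differentiable (fun t => - f t) x.
Proof. exact: (@differentiableN _ _ _ f x). Qed.

Lemma dSub f g x : differentiable f x -> differentiable g x ->
  differentiable (fun t => f t - g t) x.
Proof. by move=> df dg; exact: (dAdd df (dOpp dg)). Qed.

Lemma dMul f g x : differentiable f x -> differentiable g x ->
  differentiable (fun t => f t * g t) x.
Proof. exact: (@differentiableM _ _ f g x). Qed.

Lemma dInv f x : differentiable f x -> f x != 0 -> differentiable (fun t => (f t)^-1) x.
Proof. exact: (@differentiableV _ _ f x). Qed.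

Lemma dExp f n x : differentiable f x -> differentiable (fun t => f t ^+ n) x.
Proof.
move=> df; elim: n => [|n IH]; first exact: dCst.
by under eq_fun do rewrite exprS; exact: dMul.
Qed.

End DifferentialRules.

(** * Midpoint sums over rectangles and the theorem of Goursat *)

Section BoundarySums.
Context {R : realType}.
Implicit Types (x y w h t : R) (f g : R -> Cx R) (phi : Cx R -> Cx R).

(** Midpoint sums over [x, x + w] with 2 ^ n equal steps, defined by halving so that
    bisection is compatible with the recursion. *)
Fixpoint seg n g x w : Cx R :=
  if n is k.+1 then seg k g x (w / 2) + seg k g (x + w / 2) (w / 2)
  else rc w * g (x + w / 2).

(** Positively oriented boundary of the rectangle [x, x + w] x [y, y + h]. *)
Definition bsum n phi x y w h : Cx R :=
  seg n (fun t => phi (cx t y)) x w - seg n (fun t => phi (cx t (y + h))) x w +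
  ii * (seg n (fun t => phi (cx (x + w) t)) y h - seg n (fun t => phi (cx x t)) y h).

Definition rect x y w h (z : Cx R) : Prop :=
  (x <= re z <= x + w) /\ (y <= im z <= y + h).

Definition rect_bd x y w h (z : Cx R) : Prop :=
  rect x y w h z /\ [\/ re z = x, re z = x + w, im z = y | im z = y + h].

Lemma add_half x w : x + w / 2 + w / 2 = x + w. Proof. by lra. Qed.

Lemma seg_lin n f g (a b : Cx R) x w :
  seg n (fun t => a * f t + b * g t) x w = a * seg n f x w + b * seg n g x w.
Proof.
elim: n x w => [|n IH] x w /=; first by ring.
by rewrite !IH; ring.
Qed.

Lemma seg_bound n f x w M : 0 <= w -> (forall t, x <= t <= x + w -> md (f t) <= M) ->
  md (seg n f x w) <= w * M.
Proof.
elim: n x w => [|n IH] x w w0 fM /=.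
  by rewrite mdM md_rc ger0_norm // ler_wpM2l // fM //; lra.
apply: le_trans (mdD _ _) _.
have h1 : md (seg n f x (w / 2)) <= w / 2 * M by apply: IH => [|t ht]; [lra|apply: fM; lra].
have h2 : md (seg n f (x + w / 2) (w / 2)) <= w / 2 * M.
  by apply: IH => [|t ht]; [lra|apply: fM; lra].
by lra.
Qed.

Lemma seg_im_ge n f x w m : 0 <= w -> (forall t, x <= t <= x + w -> m <= im (f t)) ->
  w * m <= im (seg n f x w).
Proof.
elim: n x w => [|n IH] x w w0 fM /=.
  by rewrite !reimE mul0r addr0 ler_wpM2l // fM //; lra.
have h1 : w / 2 * m <= im (seg n f x (w / 2)) by apply: IH => [|t ht]; [lra|apply: fM; lra].
have h2 : w / 2 * m <= im (seg n f (x + w / 2) (w / 2)).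
  by apply: IH => [|t ht]; [lra|apply: fM; lra].
by rewrite imD; lra.
Qed.

(** The reason for taking midpoints: the closed sums of affine functions are exactly 0
    ([bsum_affine]). *)
Lemma seg_affine n (a b : Cx R) x w :
  seg n (fun t => a + b * rc t) x w = rc w * (a + b * rc (x + w / 2)).
Proof.
have two : (2 : Cx R) != 0 by rewrite pnatr_eq0.
have h2 y : rc (y / 2) = rc y / 2.
  by rewrite rcM rcV (_ : rc 2 = 2) // (rcD 1 1).
elim: n x w => [|n IH] x w //=.
by rewrite !IH !rcD !h2; field.
Qed.

Lemma bsum_lin n phi psi (a b : Cx R) x y w h :
  bsum n (fun z => a * phi z + b * psi z) x y w h =
  a * bsum n phi x y w h + b * bsum n psi x y w h.
Proof. by rewrite /bsum !seg_lin; ring. Qed.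

Lemma bsum_affine n (a b : Cx R) x y w h : bsum n (fun z => a + b * z) x y w h = 0.
Proof.
rewrite /bsum.
have E t s : a + b * cx t s = (a + b * ii * rc s) + b * rc t by rewrite cxE; ring.
have E' t s : a + b * cx t s = (a + b * rc t) + (b * ii) * rc s by rewrite cxE; ring.
rewrite (_ : (fun t => a + b * cx t y) = fun t => (a + b * ii * rc y) + b * rc t); last exact/funext.
rewrite (_ : (fun t => a + b * cx t (y + h)) = fun t => (a + b * ii * rc (y + h)) + b * rc t); last exact/funext.
rewrite (_ : (fun t => a + b * cx (x + w) t) = fun t => (a + b * rc (x + w)) + (b * ii) * rc t); last exact/funext.
rewrite (_ : (fun t => a + b * cx x t) = fun t => (a + b * rc x) + (b * ii) * rc t); last exact/funext.
by rewrite !seg_affine !rcD; ring.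
Qed.

Lemma bsum_bound n phi x y w h M : 0 <= w -> 0 <= h ->
  (forall z, rect_bd x y w h z -> md (phi z) <= M) ->
  md (bsum n phi x y w h) <= 2 * (w + h) * M.
Proof.
move=> w0 h0 hM.
have B1 : md (seg n (fun t => phi (cx t y)) x w) <= w * M.
  apply: seg_bound => // t ht; apply: hM; split; last by constructor 3.
  by split; rewrite !reimE //; lra.
have B2 : md (seg n (fun t => phi (cx t (y + h))) x w) <= w * M.
  apply: seg_bound => // t ht; apply: hM; split; last by constructor 4.
  by split; rewrite !reimE //; lra.
have B3 : md (seg n (fun t => phi (cx (x + w) t)) y h) <= h * M.
  apply: seg_bound => // t ht; apply: hM; split; last by constructor 2.
  by split; rewrite !reimE //; lra.
have B4 : md (seg n (fun t => phi (cx x t)) y h) <= h * M.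
  apply: seg_bound => // t ht; apply: hM; split; last by constructor 1.
  by split; rewrite !reimE //; lra.
rewrite /bsum; apply: le_trans (mdD _ _) _; rewrite mdM md_ii mul1r.
have := mdDB (seg n (fun t => phi (cx t y)) x w) (seg n (fun t => phi (cx t (y + h))) x w).
have := mdDB (seg n (fun t => phi (cx (x + w) t)) y h) (seg n (fun t => phi (cx x t)) y h).
by lra.
Qed.

(** The midpoint sums are compatible with bisection: the contributions of the
    inner edges cancel exactly, at every finite level. *)
Lemma bsum_split n phi x y w h :
  bsum n.+1 phi x y w h =
  bsum n phi x y (w / 2) (h / 2) + bsum n phi (x + w / 2) y (w / 2) (h / 2) +
  bsum n phi x (y + h / 2) (w / 2) (h / 2) +
  bsum n phi (x + w / 2) (y + h / 2) (w / 2) (h / 2).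
Proof. by rewrite /bsum /= !add_half; ring. Qed.

Lemma nested_intervals (a : nat -> R) w :
  (forall k, a k <= a k.+1 <= a k + w / 2 ^+ k.+1) ->
  exists c, forall k, a k <= c <= a k + w / 2 ^+ k.
Proof.
move=> ha.
have half k : w / 2 ^+ k = w / 2 ^+ k.+1 + w / 2 ^+ k.+1.
  rewrite exprS; have : (2 : R) ^+ k != 0 by rewrite expf_neq0 // pnatr_eq0.
  by move=> ?; field.
have H k j : a k <= a (k + j)%N /\ a (k + j)%N + w / 2 ^+ (k + j) <= a k + w / 2 ^+ k.
  elim: j => [|j [IH1 IH2]]; first by rewrite addn0.
  rewrite addnS; have := ha (k + j)%N; have := half (k + j)%N; lra.
have W k : 0 <= w / 2 ^+ k.
  by rewrite half; have := ha k; lra.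
have H2 k j : a j <= a k + w / 2 ^+ k.
  case: (leqP k j) => kj.
  - by have := H k (j - k)%N; rewrite subnKC // => -[]; have := W j; lra.
  - by have := H j (k - j)%N; rewrite subnKC ?(ltnW kj) // => -[]; have := W k; lra.
have S : has_sup (range a).
  by split; [exists (a 0%N), 0%N|exists (a 0%N + w / 2 ^+ 0) => _ [j _ <-]; exact: H2].
exists (sup (range a)) => k; apply/andP; split.
- by apply: sup_upper_bound => //; exists k.
- by apply: ge_sup; [exists (a 0%N), 0%N|move=> _ [j _ <-]; exact: H2].
Qed.

Lemma pow2_small (c d : R) : 0 < d -> exists k, c / 2 ^+ k < d.
Proof.
move=> d0; have [k hk] : exists k : nat, c / d < k%:R.
  exists (Num.bound `|c / d|); apply: le_lt_trans (ler_norm _) _.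
  exact: archi_boundP.
exists k; rewrite ltr_pdivrMr ?exprn_gt0 // mulrC -ltr_pdivrMr //.
by apply: lt_trans hk _; rewrite -natrX ltr_nat ltn_expl.
Qed.

(** Otherwise every bad rectangle has a bad quarter, and nested bad rectangles shrink to a
    point, where the local hypothesis is violated. *)
Lemma bisection (P : R -> R -> R -> R -> Prop) x y w h : 0 < w -> 0 < h ->
  (forall x y w h, 0 < w -> 0 < h ->
    P x y (w / 2) (h / 2) -> P (x + w / 2) y (w / 2) (h / 2) ->
    P x (y + h / 2) (w / 2) (h / 2) -> P (x + w / 2) (y + h / 2) (w / 2) (h / 2) ->
    P x y w h) ->
  (forall z, rect x y w h z -> exists2 d, 0 < d &
    forall x' y' w' h', 0 < w' -> 0 < h' -> x <= x' -> x' + w' <= x + w ->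
      y <= y' -> y' + h' <= y + h -> rect x' y' w' h' z -> w' + h' < d ->
      P x' y' w' h') ->
  P x y w h.
Proof.
move=> w0 h0 glue loc; apply: contrapT => nP.
have p2 k : 0 < (2 : R) ^+ k by rewrite exprn_gt0.
pose bad k (p : R * R) := ~ P p.1 p.2 (w / 2 ^+ k) (h / 2 ^+ k).
have half (c : R) k : c / 2 ^+ k / 2 = c / 2 ^+ k.+1.
  by rewrite exprS; have := lt0r_neq0 (p2 k) => ?; field.
have child k p : bad k p -> exists q : R * R, [/\ bad k.+1 q,
    p.1 <= q.1 <= p.1 + w / 2 ^+ k.+1 & p.2 <= q.2 <= p.2 + h / 2 ^+ k.+1].
  move=> bp; apply: contrapT => nq; apply: bp.
  have wk : 0 < w / 2 ^+ k.+1 by rewrite divr_gt0.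
  have hk : 0 < h / 2 ^+ k.+1 by rewrite divr_gt0.
  apply: glue; rewrite ?divr_gt0 // !half; apply: contrapT => b; apply: nq.
  - by exists (p.1, p.2); split => //=; lra.
  - by exists (p.1 + w / 2 ^+ k.+1, p.2); split => //=; lra.
  - by exists (p.1, p.2 + h / 2 ^+ k.+1); split => //=; lra.
  - by exists (p.1 + w / 2 ^+ k.+1, p.2 + h / 2 ^+ k.+1); split => //=; lra.
pose nxt k p := if pselect (bad k p) is left b then projT1 (cid (child k p b)) else p.
pose fix F k := if k is j.+1 then nxt j (F j) else (x, y).
have Fbad k : bad k (F k).
  elim: k => [|k IH]; first by rewrite /bad /= !divr1.
  rewrite /= /nxt; case: pselect => // b.
  by case: cid => /= q [].
have F1 k : (F k).1 <= (F k.+1).1 <= (F k).1 + w / 2 ^+ k.+1.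
  by rewrite /= /nxt; case: pselect => [b|/(_ (Fbad k))//]; case: cid => /= q [].
have F2 k : (F k).2 <= (F k.+1).2 <= (F k).2 + h / 2 ^+ k.+1.
  by rewrite /= /nxt; case: pselect => [b|/(_ (Fbad k))//]; case: cid => /= q [].
have [a ha] := nested_intervals F1; have [b hb] := nested_intervals F2.
have inz : rect x y w h (cx a b).
  by have := ha 0%N; have := hb 0%N; rewrite /= !divr1 /rect !reimE.
have [d d0 hd] := loc _ inz.
have [k hk] := pow2_small (w + h) d0.
have mon c (G : nat -> R) : 0 < c -> (forall k, G k <= G k.+1 <= G k + c / 2 ^+ k.+1) ->
    G 0%N <= G k /\ G k + c / 2 ^+ k <= G 0%N + c.
  move=> cp HG; elim: k {hk} => [|k [IH1 IH2]]; first by rewrite divr1.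
  have := HG k; have := half c k; lra.
have [m1 m2] := mon w _ w0 F1; have [m3 m4] := mon h _ h0 F2.
apply: (Fbad k); apply: hd; rewrite ?divr_gt0 //.
by rewrite -mulrDl.
Qed.

(** An exceptional point is counted once for each of the two half-open intervals that
    contain it: the count is at least 1 on the closed interval and is additive under
    bisection, even when the point is the midpoint. *)
Definition nu x w t : R := (x <= t < x + w)%R%:R + (x < t <= x + w)%R%:R.

Lemma nu_split x w t : 0 < w -> nu x w t = nu x (w / 2) t + nu (x + w / 2) (w / 2) t.
Proof.
move=> w0; rewrite /nu add_half.
case: (lerP x t) => h1; case: (ltrP t (x + w)) => h2; case: (ltrP x t) => h3;
case: (lerP t (x + w)) => h4; case: (ltrP t (x + w / 2)) => h5;
case: (lerP t (x + w / 2)) => h6; rewrite /= ?add0r ?addr0 //; try lra.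
Qed.

Lemma nu_ge0 x w t : 0 <= nu x w t.
Proof. by rewrite /nu; case: (_ && _); case: (_ && _); rewrite /=; lra. Qed.

Lemma nu_ge1 x w t : 0 < w -> x <= t <= x + w -> 1 <= nu x w t.
Proof.
move=> w0 /andP[h1 h2]; rewrite /nu h1 h2 /= andbT.
by case: (ltrP t (x + w)) => h3; case: (ltrP x t) => h4 /=; try lra.
Qed.

Definition npts (s : seq (Cx R)) x y w h : R :=
  \sum_(z <- s) nu x w (re z) * nu y h (im z).

Lemma npts_split s x y w h : 0 < w -> 0 < h ->
  npts s x y w h = npts s x y (w / 2) (h / 2) + npts s (x + w / 2) y (w / 2) (h / 2) +
  npts s x (y + h / 2) (w / 2) (h / 2) + npts s (x + w / 2) (y + h / 2) (w / 2) (h / 2).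
Proof.
move=> w0 h0; rewrite /npts -!big_split /=; apply: eq_bigr => z _.
by rewrite (nu_split x _ w0) (nu_split y _ h0); ring.
Qed.

Lemma npts_ge0 s x y w h : 0 <= npts s x y w h.
Proof. by apply: sumr_ge0 => z _; rewrite mulr_ge0 ?nu_ge0. Qed.

Lemma npts_ge1 s x y w h z : 0 < w -> 0 < h -> z \in s -> rect x y w h z ->
  1 <= npts s x y w h.
Proof.
move=> w0 h0 zs [h1 h2]; rewrite /npts (big_rem z) //=.
rewrite -[1]addr0 lerD ?sumr_ge0 // => [|i _]; last by rewrite mulr_ge0 ?nu_ge0.
by rewrite -[1]mulr1 ler_pM // nu_ge1.
Qed.

(** Bisection with an additive error budget: a rectangle may spend [eta] times the
    square of its half-perimeter plus the number of exceptional points in it.  Near a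
    point of differentiability the affine part has sum 0; near an exceptional point
    the function is only bounded, and its sum is small since the rectangle is. *)
Lemma goursat phi (s : seq (Cx R)) M x y w h : 0 < w -> 0 < h ->
  (forall z, rect x y w h z -> md (phi z) <= M) ->
  (forall z, rect x y w h z -> z \in s \/ differentiable phi z) ->
  forall e, 0 < e -> exists n0, forall n, (n0 <= n)%N -> md (bsum n phi x y w h) <= e.
Proof.
move=> w0 h0 bM dphi e e0.
(* [K - 1] is the budget of the whole rectangle. *)
pose K := (w + h) ^+ 2 + npts s x y w h + 1.
have K1 : 1 <= K by rewrite /K; have := npts_ge0 s x y w h; have := sqr_ge0 (w + h); lra.
pose eta := e / K.
have eta0 : 0 < eta by rewrite divr_gt0 //; lra.
suff [n0 H] : exists n0, forall n, (n0 <= n)%N ->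
    md (bsum n phi x y w h) <= eta * ((w + h) ^+ 2 + npts s x y w h).
  exists n0 => n /H hn; apply: le_trans hn _.
  have -> : (w + h) ^+ 2 + npts s x y w h = K - 1 by rewrite /K; lra.
  by rewrite /eta mulrAC ler_pdivrMr ?ler_pM2l //; lra.
apply: (bisection (P := fun x y w h => exists n0, forall n, (n0 <= n)%N ->
    md (bsum n phi x y w h) <= eta * ((w + h) ^+ 2 + npts s x y w h))) => //.
- move=> a b c d a0 b0 [n1 H1] [n2 H2] [n3 H3] [n4 H4].
  exists (maxn (maxn n1 n2) (maxn n3 n4)).+1 => -[//|n]; rewrite ltnS !geq_max.
  move=> /andP[/andP[/H1 {}H1 /H2 {}H2] /andP[/H3 {}H3 /H4 {}H4]].
  rewrite bsum_split npts_split //.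
  apply: le_trans (mdD _ _) _; apply: le_trans (lerD (mdD _ _) (lexx _)) _.
  apply: le_trans (lerD (lerD (mdD _ _) (lexx _)) (lexx _)) _.
  apply: le_trans (lerD (lerD (lerD H1 H2) H3) H4) _.
  by rewrite -!mulrDr; apply: ler_wpM2l; [exact: ltW|lra].
- move=> z hz; have [zs|dz] := dphi z hz.
    (* An exceptional point: rectangles so small that the trivial bound is at most [eta]. *)
    exists (eta / (2 * `|M| + 1)).
      by rewrite divr_gt0 //; have := normr_ge0 M; lra.
    move=> x' y' w' h' w0' h0' x1 x2 y1 y2 hz' hd; exists 0%N => n _.
    have b := bsum_bound n (ltW w0') (ltW h0') (phi := phi) (x := x') (y := y') (M := M).
    apply: le_trans (b _) _.
      by move=> u [[u1 u2] _]; apply: bM; split; lra.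
    have := npts_ge1 w0' h0' zs hz' => np.
    have : 2 * (w' + h') * M <= eta.
      move: hd; rewrite ltr_pdivlMr; last by have := normr_ge0 M; lra.
      have : (w' + h') * M <= (w' + h') * `|M| by rewrite ler_wpM2l ?ler_norm //; lra.
      by nra.
    have := mulr_ge0 (ltW eta0) (sqr_ge0 (w' + h')).
    have : eta <= eta * npts s x' y' w' h' by rewrite ler_peMr // ltW.
    by rewrite mulrDr; lra.
  have [D hD] := diff_c_elim dz.
  have [d d0 hd] := hD (eta / 2) ltac:(lra).
  exists d => // x' y' w' h' w0' h0' x1 x2 y1 y2 hz' hdw; exists 0%N => n _.
  (* Subtract the affine part, whose sum is 0. *)
  have -> : bsum n phi x' y' w' h' =
      bsum n (fun u => phi u - phi z - D * (u - z)) x' y' w' h'.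
    have := bsum_lin n phi (fun u => (phi z - D * z) + D * u) 1 (-1) x' y' w' h'.
    rewrite bsum_affine mulr0 addr0 mul1r => <-.
    by congr bsum; apply/funext => u; ring.
  have b := bsum_bound n (ltW w0') (ltW h0') (phi := fun u => phi u - phi z - D * (u - z))
    (x := x') (y := y') (M := eta / 2 * (w' + h')).
  apply: le_trans (b _) _.
    move=> u [[u1 u2] _]; case: hz' => z1 z2.
    have uz : md (u - z) <= w' + h'.
      apply: le_trans (md_le _) _; rewrite !reimE.
      by apply: lerD; rewrite ler_norml; lra.
    have := hd (u - z); rewrite (_ : z + (u - z) = u); last by ring.
    move=> H; apply: le_trans (H _) _; first lra.
    by rewrite ler_wpM2l //; lra.
  rewrite mulrDr; have := mulr_ge0 (ltW eta0) (npts_ge0 s x' y' w' h').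
  by rewrite expr2; lra.
Qed.

End BoundarySums.

(** * Limits along an ultrafilter *)

Section Ultralimit.
Context {R : realType}.
Implicit Types (u v : nat -> Cx R) (l m a b : Cx R).

Lemma closed_md (M : R) : closed [set z : Cx R | md z <= M].
Proof.
suff : open (~` [set z : Cx R | md z <= M]) by rewrite openC.
rewrite openE => z /= /negP; rewrite -ltNge => hz; apply/nbhs_cP.
exists (md z - M); first lra.
move=> w hw /=; apply/negP; rewrite -ltNge.
by have := mdDB w (w - z); rewrite opprB addrC subrK; lra.
Qed.

Lemma compact_md (M : R) : compact [set z : Cx R | md z <= M].
Proof.
have K : compact ((fun p : R * R => cx p.1 p.2) @` (`[- M, M] `*` `[- M, M])).
  apply: continuous_compact; last by apply: compact_setX; exact: segment_compact.
  apply: continuous_subspaceT => p B /nbhs_cP[d d0 hd].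
  exists (ball p.1 (d / 2), ball p.2 (d / 2)) => /=.
    by split; apply: nbhsx_ballx; rewrite divr_gt0.
  move=> [q1 q2] [] /=; rewrite /ball /= => h1 h2; apply: hd.
  apply: le_lt_trans (md_le _) _; rewrite !reimE.
  by move: h1 h2; rewrite distrC => h1; rewrite distrC => h2; lra.
apply: subclosed_compact K _; first exact: closed_md.
move=> z /= zM; exists (re z, im z); last exact: cxP.
have := le_re_md z; have := le_im_md z; rewrite !ler_norml /= !in_itv /=.
by split; lra.
Qed.

(** Limits along a fixed ultrafilter exist for all bounded sequences and are linear. *)
Definition ultra : set_system nat :=
  projT1 (cid (ultraFilterLemma (@eventually_filter))).

Lemma ultraP : UltraFilter ultra.
Proof. by rewrite /ultra; case: cid => F []. Qed.

Lemma ultra_oo (A : set nat) : (\oo) A -> ultra A.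
Proof.
by have [_ h] := projT2 (cid (ultraFilterLemma (@eventually_filter))); exact: h.
Qed.

#[local] Existing Instance ultraP.

Definition ucv u l := forall e : R, 0 < e -> ultra [set n | md (u n - l) < e].

Lemma ucv_exists u (M : R) : (forall n, md (u n) <= M) -> exists l, ucv u l.
Proof.
move=> uM; have [|l [_ cl]] := @compact_md M (u @ ultra).
  by apply: (@filterE _ ultra) => n; exact: uM.
exists l => e e0; case: (in_ultra_setVsetC [set n | md (u n - l) < e] ultraP) => // H.
have [z [/= nz zl]] := cl (~` [set z | md (z - l) < e]) [set z | md (z - l) < e] H
  (proj2 (nbhs_cP _ _) (ex_intro2 _ _ e e0 (fun w h => h))).
by case: (nz zl).
Qed.

Lemma eq_ucv u v l m : (forall n, u n = v n) -> l = m -> ucv u l -> ucv v m.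
Proof. by move=> /funext -> ->. Qed.

Lemma ucv_near u l (e : R) (P : Prop) : ucv u l -> 0 < e ->
  (forall n, md (u n - l) < e -> P) -> P.
Proof. by move=> ul e0 h; have [n] := filter_ex (ul _ e0); exact: h. Qed.

Lemma ucv_lin u v l m a b : ucv u l -> ucv v m ->
  ucv (fun n => a * u n + b * v n) (a * l + b * m).
Proof.
move=> ul vm e e0.
have d0 : 0 < e / (md a + md b + 1).
  by rewrite divr_gt0 //; have := md_ge0 a; have := md_ge0 b; lra.
apply: filterS (filterI (ul _ d0) (vm _ d0)) => n /= [h1 h2].
rewrite (_ : _ - _ = a * (u n - l) + b * (v n - m)); last by ring.
apply: le_lt_trans (mdD _ _) _; rewrite !mdM.
have := ler_wpM2l (md_ge0 a) (ltW h1); have := ler_wpM2l (md_ge0 b) (ltW h2).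
set d := e / _ in d0 h1 h2 *.
have : d * (md a + md b + 1) = e.
  by rewrite /d divfK // lt0r_neq0 //; have := md_ge0 a; have := md_ge0 b; lra.
by lra.
Qed.

Lemma ucv_bound u l (M : R) : (forall n, md (u n) <= M) -> ucv u l -> md l <= M.
Proof.
move=> uM ul; rewrite leNgt; apply/negP => Ml.
apply: (ucv_near (e := md l - M) ul); first lra.
move=> n; have := mdDB (u n) (u n - l); rewrite opprB addrC subrK.
by have := uM n; lra.
Qed.

Lemma ucv_im u l (c : R) : (forall n, c <= im (u n)) -> ucv u l -> c <= im l.
Proof.
move=> uM ul; rewrite leNgt; apply/negP => Ml.
apply: (ucv_near (e := c - im l) ul); first lra.
move=> n; have := le_im_md (u n - l); rewrite ler_norml !reimE.
by have := uM n; lra.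
Qed.

Lemma ucv0 u : (forall e : R, 0 < e -> exists n0, forall n, (n0 <= n)%N -> md (u n) <= e) ->
  ucv u 0.
Proof.
move=> h e e0; have [n0 hn] := h (e / 2) ltac:(lra).
apply: ultra_oo; exists n0 => // n /= /hn; rewrite subr0; lra.
Qed.

Lemma ucv_uniq u l m : ucv u l -> ucv u m -> l = m.
Proof.
move=> ul um; apply/eqP; rewrite -subr_eq0 -md_eq0 eq_le md_ge0 andbT.
apply: (@ucv_bound (fun=> 0)); first by move=> n; rewrite md0.
by apply: eq_ucv (ucv_lin 1 (-1) ul um) => [n|]; ring.
Qed.

Definition ulim u : Cx R := xget 0 [set l | ucv u l].

Lemma ulim_ucv u (M : R) : (forall n, md (u n) <= M) -> ucv u (ulim u).
Proof.
move=> /ucv_exists[l ul]; rewrite /ulim; case: xgetP => // /(_ l).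
by move=> /(_ ul).
Qed.

Lemma ulimE u l : ucv u l -> ulim u = l.
Proof.
move=> ul; apply: ucv_uniq (ul); rewrite /ulim; case: xgetP => // /(_ l).
by move=> /(_ ul).
Qed.

End Ultralimit.

(** * The Cauchy formula for rectangles *)

Section CauchyFormula.
Context {R : realType}.
Implicit Types (phi psi : Cx R -> Cx R) (x y w h M r : R) (z : Cx R).

Lemma re_inv z : re z^-1 = re z / (re z ^+ 2 + im z ^+ 2).
Proof. by case: z. Qed.

Lemma im_inv z : im z^-1 = - im z / (re z ^+ 2 + im z ^+ 2).
Proof. by case: z => a b; rewrite mulNr. Qed.

(** Contour integral over the boundary of a rectangle, as a limit of midpoint
    sums along an ultrafilter: a linear functional on bounded functions. *)
Definition Lam phi x y w h : Cx R := ulim (fun n => bsum n phi x y w h).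

Definition bddon (A : Cx R -> Prop) phi := exists M, forall z, A z -> md (phi z) <= M.

Lemma Lam_ucv phi x y w h : 0 <= w -> 0 <= h -> bddon (rect_bd x y w h) phi ->
  ucv (fun n => bsum n phi x y w h) (Lam phi x y w h).
Proof.
move=> w0 h0 [M hM]; apply: (@ulim_ucv _ _ (2 * (w + h) * M)) => n.
exact: bsum_bound.
Qed.

Lemma Lam_lin phi psi a b x y w h : 0 <= w -> 0 <= h ->
  bddon (rect_bd x y w h) phi -> bddon (rect_bd x y w h) psi ->
  Lam (fun z => a * phi z + b * psi z) x y w h = a * Lam phi x y w h + b * Lam psi x y w h.
Proof.
move=> w0 h0 b1 b2; apply: ulimE.
apply: eq_ucv (ucv_lin a b (Lam_ucv w0 h0 b1) (Lam_ucv w0 h0 b2)) => // n.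
by rewrite bsum_lin.
Qed.

Lemma Lam_bound phi x y w h M : 0 <= w -> 0 <= h ->
  (forall z, rect_bd x y w h z -> md (phi z) <= M) -> md (Lam phi x y w h) <= 2 * (w + h) * M.
Proof.
move=> w0 h0 hM; apply: (@ucv_bound _ (fun n => bsum n phi x y w h)).
  by move=> n; exact: bsum_bound.
by apply: Lam_ucv => //; exists M.
Qed.

Definition inside r x y w h z :=
  [/\ x + r <= re z, re z <= x + w - r, y + r <= im z & im z <= y + h - r].

Lemma bd_dist r x y w h z u : inside r x y w h z -> rect_bd x y w h u -> r <= md (u - z).
Proof.
move=> [h1 h2 h3 h4] [_ hu].
have := le_re_md (u - z); have := le_im_md (u - z); rewrite !ler_norml !reimE.
by case: hu => ->; lra.
Qed.

Definition cw x y w h z : Cx R := Lam (fun u => (u - z)^-1) x y w h.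

Lemma bdd_inv r x y w h z : 0 < r -> inside r x y w h z ->
  forall u, rect_bd x y w h u -> md (u - z)^-1 <= r^-1.
Proof.
move=> r0 hz u /(bd_dist hz) rz; rewrite mdV lef_pV2 ?posrE //.
exact: lt_le_trans rz.
Qed.

Lemma segZ n (a : Cx R) (f : R -> Cx R) x w : seg n (fun t => a * f t) x w = a * seg n f x w.
Proof.
elim: n x w => [|n IH] x w /=; first by ring.
by rewrite !IH mulrDr.
Qed.

(** All four sides contribute with the same sign to the imaginary part, and the lower
    side alone gives the bound. *)
Lemma cw_im r x y w h z : 0 < r -> 0 <= w -> 0 <= h -> inside r x y w h z ->
  w * (r / (w ^+ 2 + h ^+ 2)) <= im (cw x y w h z).
Proof.
move=> r0 w0 h0 hz; apply: (ucv_im _ (Lam_ucv w0 h0 _)); last first.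
  by exists r^-1; exact: bdd_inv hz.
move=> n; rewrite /bsum; case: hz => z1 z2 z3 z4.
have sq (a b : R) : 0 < b ^+ 2 -> 0 < a ^+ 2 + b ^+ 2 by move=> ?; have := sqr_ge0 a; lra.
set S1 := seg _ _ x w; set S2 := seg _ _ x w; set S3 := seg _ _ y h; set S4 := seg _ _ y h.
have H1 : w * (r / (w ^+ 2 + h ^+ 2)) <= im S1.
  apply: seg_im_ge => // t ht; rewrite im_inv !reimE.
  have d0 : 0 < (t - re z) ^+ 2 + (y - im z) ^+ 2 by apply: sq; rewrite exprn_even_gt0 //=; lra.
  rewrite opprB; apply: ler_pM; [lra|by rewrite invr_ge0 addr_ge0 ?sqr_ge0|lra|].
  rewrite lef_pV2 ?posrE //; last by apply: lt_le_trans d0 _; rewrite lerD //; nra.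
  by rewrite lerD //; nra.
have H2 : w * 0 <= im ((-1) * S2).
  rewrite -segZ; apply: seg_im_ge => // t ht; rewrite mulN1r imN im_inv !reimE.
  by rewrite mulNr opprK; apply: divr_ge0; [lra|rewrite addr_ge0 ?sqr_ge0].
have H3 : h * 0 <= im (ii * S3).
  rewrite -segZ; apply: seg_im_ge => // t ht; rewrite !reimE mul0r add0r mul1r re_inv !reimE.
  by apply: divr_ge0; [lra|rewrite addr_ge0 ?sqr_ge0].
have H4 : h * 0 <= im (- ii * S4).
  rewrite -segZ; apply: seg_im_ge => // t ht; rewrite !reimE oppr0 mul0r add0r mulN1r re_inv !reimE.
  by rewrite -mulNr; apply: divr_ge0; [lra|rewrite addr_ge0 ?sqr_ge0].
have -> : S1 - S2 + ii * (S3 - S4) = S1 + (-1) * S2 + ii * S3 + (- ii) * S4 by ring.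
by rewrite 3!imD; lra.
Qed.

Lemma diff_inv_sub z u : u != z -> differentiable (fun u => (u - z)^-1) u.
Proof.
move=> uz; apply: dInv; last by rewrite subr_eq0.
exact: dSub (dCst _ _).
Qed.

(** The difference quotient of [phi] at [z] is bounded, and differentiable except at [z]
    and at the exceptional points, so that its integral vanishes. *)
Lemma cauchy_formula phi (s : seq (Cx R)) M r x y w h z :
  0 < w -> 0 < h -> 0 < r ->
  (forall u, rect x y w h u -> md (phi u) <= M) ->
  (forall u, rect x y w h u -> u \in s \/ differentiable phi u) ->
  inside r x y w h z -> differentiable phi z ->
  phi z * cw x y w h z = Lam (fun u => phi u * (u - z)^-1) x y w h.
Proof.
move=> w0 h0 r0 bM dphi hz dz.
have inz : rect x y w h z by case: hz => *; split; lra.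
pose g u := (phi u - phi z) * (u - z)^-1.
have M0 : 0 <= M by apply: le_trans (bM _ inz); exact: md_ge0.
have [D hD] := diff_c_elim dz.
have [d d0 hd] := hD 1 ltr01.
have bg u : rect x y w h u -> md (g u) <= md D + 1 + 2 * M / d.
  move=> hu; have q : 0 <= 2 * M / d by rewrite divr_ge0 ?mulr_ge0 // ltW.
  have [->|uz] := eqVneq u z; first by rewrite /g !subrr mul0r md0; have := md_ge0 D; lra.
  have uz0 : 0 < md (u - z) by rewrite md_gt0 subr_eq0.
  rewrite /g mdM mdV ler_pdivrMr //.
  have [l|l] := ltP (md (u - z)) d.
    have := hd _ l; rewrite (_ : z + (u - z) = u); last by ring.
    move=> H; have := mdD (phi u - phi z - D * (u - z)) (D * (u - z)); rewrite subrK mdM.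
    have := mulr_ge0 q (ltW uz0); lra.
  have := mdDB (phi u) (phi z); have := bM _ inz; have := bM _ hu.
  have : 2 * M <= 2 * M / d * md (u - z) by rewrite mulrAC ler_pdivlMr // ler_wpM2l //; lra.
  have := mulr_ge0 (md_ge0 D) (ltW uz0); lra.
have dg u : rect x y w h u -> u \in z :: s \/ differentiable g u.
  move=> hu; have [->|uz] := eqVneq u z; first by left; rewrite inE eqxx.
  have [us|du] := dphi _ hu; first by left; rewrite inE us orbT.
  right; exact: (dMul (dSub du (dCst _ _)) (diff_inv_sub uz)).
have bphi : bddon (rect_bd x y w h) (fun u => phi u * (u - z)^-1).
  exists (M * r^-1) => u hu; rewrite mdM; apply: ler_pM; rewrite ?md_ge0 //.
    by apply: bM; case: hu.
  exact: bdd_inv hu.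
have binv : bddon (rect_bd x y w h) (fun u => (u - z)^-1) by exists r^-1; exact: bdd_inv hz.
have g0 : Lam g x y w h = 0.
  by apply: ulimE; apply: ucv0 => e e0; exact: goursat w0 h0 bg dg _ e0.
have := Lam_lin 1 (- phi z) (ltW w0) (ltW h0) bphi binv.
rewrite (_ : (fun _ => _) = g); last by apply/funext => u; rewrite /g; ring.
by rewrite g0 mul1r mulNr => /esym/eqP; rewrite subr_eq0 => /eqP <-.
Qed.

End CauchyFormula.

(** * Identity theorem and derivative estimates in one variable *)

Section CauchyEstimates.
Context {R : realType}.
Implicit Types (g : Cx R -> Cx R) (x y w h M r rho d e t : R) (a z u D : Cx R).

(** Local boundedness is inherited from the quarters of a rectangle. *)
Lemma bounded_on_rectangle g x y w h : 0 < w -> 0 < h ->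
  (forall z, rect x y w h z -> differentiable g z) ->
  exists M, forall z, rect x y w h z -> md (g z) <= M.
Proof.
move=> w0 h0 dg.
apply: (bisection (P := fun x y w h => exists M, forall z, rect x y w h z -> md (g z) <= M)) => //.
- move=> a b c d c0 d0 [M1 H1] [M2 H2] [M3 H3] [M4 H4].
  exists (Num.max (Num.max M1 M2) (Num.max M3 M4)) => z [z1 z2].
  rewrite !le_max.
  case: (lerP (re z) (a + c / 2)) => hr; case: (lerP (im z) (b + d / 2)) => hi.
  + by rewrite H1 //; split; lra.
  + by rewrite H3 ?orbT //; split; lra.
  + by rewrite H2 ?orbT //; split; lra.
  + by rewrite H4 ?orbT //; split; lra.
- move=> z hz; have [D hD] := diff_c_elim (dg _ hz).
  have [d d0 hd] := hD 1 ltr01; exists d => // x' y' w' h' w0' h0' _ _ _ _ [z1 z2] hwh.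
  exists (md (g z) + (md D + 1) * d) => u [u1 u2].
  have uz : md (u - z) < d.
    apply: le_lt_trans (md_le _) _; apply: le_lt_trans hwh; rewrite !reimE.
    by apply: lerD; rewrite ler_norml; lra.
  have := hd _ uz; rewrite (_ : z + (u - z) = u); last by ring.
  have := mdD (g u - g z - D * (u - z)) (g z + D * (u - z)).
  rewrite (_ : g u - g z - D * (u - z) + (g z + D * (u - z)) = g u); last by ring.
  have := mdD (g z) (D * (u - z)); rewrite mdM.
  have := ler_wpM2l (md_ge0 D) (ltW uz).
  by lra.
Qed.

Definition square a rho := rect (re a - rho) (im a - rho) (2 * rho) (2 * rho).
Definition bsquare a rho := rect_bd (re a - rho) (im a - rho) (2 * rho) (2 * rho).
Definition Lsq g a rho := Lam g (re a - rho) (im a - rho) (2 * rho) (2 * rho).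
Definition csq a rho z := cw (re a - rho) (im a - rho) (2 * rho) (2 * rho) z.

Lemma inside_sq a rho r z : md (z - a) <= rho - r ->
  inside r (re a - rho) (im a - rho) (2 * rho) (2 * rho) z.
Proof.
move=> h; have := le_re_md (z - a); have := le_im_md (z - a).
by rewrite !ler_norml !reimE; split; lra.
Qed.

Lemma square_md a rho z : square a rho z -> md (z - a) <= 2 * rho.
Proof.
move=> [h1 h2]; apply: le_trans (md_le _) _; rewrite !reimE.
rewrite (_ : 2 * rho = rho + rho); last by lra.
by apply: lerD; rewrite ler_norml; lra.
Qed.

Lemma md_square a rho z : md (z - a) <= rho -> square a rho z.
Proof.
move=> h; have := le_re_md (z - a); have := le_im_md (z - a).
by rewrite !ler_norml !reimE; split; lra.
Qed.

Lemma bsquare_md a rho z : bsquare a rho z -> rho <= md (z - a).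
Proof. by apply: bd_dist; apply: inside_sq; rewrite subrr md0; lra. Qed.

Lemma csq_gt0 a rho r z : 0 < r -> r <= rho -> md (z - a) <= rho - r -> 0 < md (csq a rho z).
Proof.
move=> r0 rr hz; have rho0 : 0 < rho by lra.
have := cw_im r0 (w := 2 * rho) (h := 2 * rho) ltac:(lra) ltac:(lra) (inside_sq hz).
have := le_im_md (csq a rho z); rewrite ler_norml => /andP[_ h1] h2.
apply: lt_le_trans h1; apply: lt_le_trans h2.
by rewrite mulr_gt0 ?divr_gt0 ?addr_gt0 ?exprn_gt0 //; lra.
Qed.

Lemma csq_half a rho z : 0 < rho -> md (z - a) <= rho / 2 -> 8^-1 <= md (csq a rho z).
Proof.
move=> r0 hz.
have hz' : md (z - a) <= rho - rho / 2 by lra.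
have r2 : 0 < rho / 2 by lra.
have w0 : 0 <= 2 * rho by lra.
have := cw_im r2 w0 w0 (inside_sq hz').
have -> : 2 * rho * (rho / 2 / ((2 * rho) ^+ 2 + (2 * rho) ^+ 2)) = 8^-1.
  rewrite (_ : (2 * rho) ^+ 2 + (2 * rho) ^+ 2 = 8 * (rho * rho)); last by ring.
  by field; rewrite lt0r_neq0.
have := le_im_md (csq a rho z); rewrite ler_norml /csq; lra.
Qed.

Lemma geometric_small (c K q : R) : 0 < c -> 0 <= q < 1 -> exists n, K * q ^+ n < c.
Proof.
move=> c0 /andP[q0 q1].
have : (fun n => K * q ^+ n) @ \oo --> K * 0.
  by apply: cvgM; [exact: cvg_cst|apply: cvg_expr; rewrite ger0_norm].
rewrite mulr0 => /cvgrPdist_lt /(_ c c0) [n _ hn]; exists n.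
have := hn n (leqnn n); rewrite sub0r normrN; exact: le_lt_trans (ler_norm _).
Qed.

(** Division by high powers of the distance: a function that vanishes near the
    centre of a square vanishes on the inscribed disc. *)
Lemma zero_propagates g a rho d : 0 < rho -> 0 < d ->
  (forall z, square a rho z -> differentiable g z) ->
  (forall z, md (z - a) < d -> g z = 0) ->
  forall z, md (z - a) < rho -> g z = 0.
Proof.
move=> rho0 d0 dg g0 z hz.
have [->|za] := eqVneq z a; first by apply: g0; rewrite subrr md0.
have za0 : 0 < md (z - a) by rewrite md_gt0 subr_eq0.
have W : 0 < 2 * rho by lra.
have [M hM] := bounded_on_rectangle W W dg.
have M0 : 0 <= M.
  by apply: le_trans (md_ge0 _) (hM a _); apply: md_square; rewrite subrr md0 ltW.
pose r := rho - md (z - a); have r0 : 0 < r by rewrite /r; lra.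
have hin : md (z - a) <= rho - r by rewrite /r; lra.
(* The Cauchy formula for [g u / (u - a) ^+ n], which is holomorphic since [g] vanishes near [a]. *)
have sq n : md (g z) * md (csq a rho z) <= (2 * (2 * rho + 2 * rho) * (M * r^-1)) * (md (z - a) / rho) ^+ n.
  pose k u := g u * ((u - a) ^+ n)^-1.
  have k0 u : md (u - a) < d -> k u = 0 by move=> /g0; rewrite /k => ->; rewrite mul0r.
  have dk u : square a rho u -> u \in [::] \/ differentiable k u.
    move=> hu; right; have [->|ua] := eqVneq u a.
      apply: (@diff_c_intro _ _ _ 0) => e e0; exists d => // h hh.
      rewrite !k0 ?subrr ?md0 //; last by rewrite addrC addKr.
      by rewrite mul0r subr0 md0 mulr_ge0 ?md_ge0 // ltW.
    apply: dMul; first exact: dg.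
    apply: dInv; last by rewrite expf_neq0 // subr_eq0.
    by apply: dExp; apply: dSub; [|exact: dCst].
  have bk u : square a rho u -> md (k u) <= M * (d ^+ n)^-1.
    move=> hu; have [l|l] := ltP (md (u - a)) d.
      by rewrite k0 // md0 mulr_ge0 // invr_ge0 exprn_ge0 // ltW.
    rewrite /k mdM mdV mdX; apply: ler_pM; rewrite ?md_ge0 ?invr_ge0 ?exprn_ge0 ?md_ge0 ?hM //.
    rewrite lef_pV2 ?posrE ?exprn_gt0 ?(lt_le_trans d0 l) //.
    by rewrite lerXn2r ?nnegrE ?md_ge0 // ltW.
  have dkz : differentiable k z.
    by case: (dk z (md_square (ltW hz))).
  have := cauchy_formula W W r0 bk dk (inside_sq hin) dkz.
  move=> /(congr1 md); rewrite mdM => E.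
  have := @Lam_bound R (fun u => k u * (u - z)^-1) (re a - rho) (im a - rho) (2 * rho) (2 * rho)
    (M * (rho ^+ n)^-1 * r^-1) (ltW W) (ltW W).
  rewrite -E => B.
  have {B E} B : md (k z) * md (csq a rho z) <= 2 * (2 * rho + 2 * rho) * (M * (rho ^+ n)^-1 * r^-1).
    apply: B => u hu; rewrite mdM; apply: ler_pM; rewrite ?md_ge0 //.
      rewrite /k mdM mdV mdX; apply: ler_pM; rewrite ?md_ge0 ?invr_ge0 ?exprn_ge0 ?md_ge0 ?hM //.
        by case: hu.
      have := bsquare_md hu => l.
      rewrite lef_pV2 ?posrE ?exprn_gt0 ?(lt_le_trans rho0 l) //.
      by rewrite lerXn2r ?nnegrE ?md_ge0 // ltW.
    exact: bdd_inv r0 (inside_sq hin) _ hu.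
  rewrite /k mdM mdV mdX in B.
  have p0 : 0 < md (z - a) ^+ n by rewrite exprn_gt0.
  rewrite expr_div_n; move: B; rewrite mulrAC ler_pdivrMr //.
  by rewrite (_ : 2 * (2 * rho + 2 * rho) * (M / rho ^+ n / r) * md (z - a) ^+ n = 2 * (2 * rho + 2 * rho) * (M / r) * (md (z - a) ^+ n / rho ^+ n)) //; ring.
apply/eqP; rewrite -md_eq0; apply/negPn/negP => nz.
have g1 : 0 < md (g z) by rewrite lt0r nz md_ge0.
have c1 := csq_gt0 r0 (_ : r <= rho) hin; rewrite {1}/r in c1.
have {}c1 : 0 < md (csq a rho z) by apply: c1; have := md_ge0 (z - a); lra.
have [n] := geometric_small (2 * (2 * rho + 2 * rho) * (M * r^-1)) (mulr_gt0 g1 c1)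
  (q := md (z - a) / rho) ltac:(by rewrite divr_ge0 ?md_ge0 ?(ltW rho0) //= ltr_pdivrMr // mul1r).
by have := sq n; lra.
Qed.

(** The supremum of the t such that [g] vanishes near [0, t] is 1, as [zero_propagates]
    applies to a square centred a little before it. *)
Lemma identity_segment g :
  (forall t, 0 <= t <= 1 -> exists2 d, 0 < d &
     forall z, md (z - rc t) < d -> differentiable g z) ->
  (exists2 d, 0 < d & forall z, md z < d -> g z = 0) ->
  g 1 = 0.
Proof.
move=> dg [d0 d00 g0].
pose Z t := exists2 d, 0 < d & forall z, md (z - rc t) < d -> g z = 0.
pose S := [set t | 0 <= t <= 1 /\ forall s, 0 <= s <= t -> Z s].
have S0 : S 0.
  split; first lra.
  move=> s hs; have -> : s = 0 by lra.
  by exists d0 => // z; rewrite rc0 subr0; exact: g0.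
have hS : has_sup S by split; [exists 0|exists 1 => t [] /andP[]].
pose T := sup S.
have T01 : 0 <= T <= 1.
  by rewrite sup_upper_bound //= ge_sup //; [exists 0|move=> t [] /andP[]].
have [d dd hd] := dg T T01.
have [t St tT] : exists2 t, S t & T - d / 8 < t by apply: sup_adherent => //; lra.
have tT' : t <= T by apply: sup_upper_bound.
have [[t0 t1] hZ] : (0 <= t /\ t <= 1) /\ forall s, 0 <= s <= t -> Z s by case: St => /andP[].
have [d1 d10 hd1] := hZ t ltac:(lra).
have rcd (a b : R) : md (rc a - rc b : Cx R) = `|a - b| by rewrite -rcB md_rc.
have big z : md (z - rc t) < d / 4 -> g z = 0.
  apply: (@zero_propagates _ _ (d / 4) d1) => //; first lra.
  move=> u /square_md hu; apply: hd.
  have := mdD (u - rc t) (rc t - rc T); rewrite rcd.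
  have -> : u - rc t + (rc t - rc T) = u - rc T by ring.
  have : `|t - T| <= d / 8 by rewrite ler_norml; lra.
  by lra.
have Zn s : t <= s -> s <= T + d / 16 -> Z s.
  move=> ts sT; exists (d / 16); first lra.
  move=> z hz; apply: big; have := mdD (z - rc s) (rc s - rc t); rewrite rcd.
  have -> : z - rc s + (rc s - rc t) = z - rc t by ring.
  have : `|s - t| <= 3 * d / 16 by rewrite ler_norml; lra.
  by lra.
have [T1|T1] := leP 1 (T + d / 16).
  have [d2 d20 h2] := Zn 1 t1 T1; apply: h2.
  by rewrite rc1 subrr md0.
suff ST : S (T + d / 16).
  have TT : T + d / 16 <= T by apply: sup_upper_bound.
  by exfalso; lra.
split; first lra.

move=> s hs; have [l|l] := leP s t; first by apply: hZ; lra.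
by apply: Zn; lra.
Qed.

Definition Kq : R := 8 * (64 + 256 * 32).

(** Apply the Cauchy formula to the difference quotient [q] of [g] at the centre, which
    is bounded and differentiable off the centre.  It yields a bound and a Lipschitz
    constant for [q] near the centre, where [q] tends to [D]. *)
Lemma derivative_estimate g a rho M D : 0 < rho ->
  (forall z, square a rho z -> differentiable g z) ->
  (forall z, square a rho z -> md (g z) <= M) ->
  (forall e : R, 0 < e -> exists2 d, 0 < d &
    forall h : Cx R, md h < d -> md (g (a + h) - g a - D * h) <= e * md h) ->
  md D <= 256 * M / rho /\
  (forall k, md k <= rho / 2 -> md (g (a + k) - g a - D * k) <= Kq * M / rho ^+ 2 * md k ^+ 2).
Proof.
move=> rho0 dg gM hD.
have W : 0 < 2 * rho by lra.
have sa : square a rho a by apply: md_square; rewrite subrr md0 ltW.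
have M0 : 0 <= M by apply: le_trans (md_ge0 _) (gM a sa).
pose q z := (g z - g a) * (z - a)^-1.
have gq z : z != a -> g z - g a = q z * (z - a).
  by move=> za; rewrite /q mulfVK // subr_eq0.
have [d1 d10 h1] := hD 1 ltr01.
have bq z : square a rho z -> md (q z) <= md D + 1 + 2 * M / d1.
  move=> hz; have p : 0 <= 2 * M / d1 by rewrite divr_ge0 ?mulr_ge0 // ltW.
  have [->|za] := eqVneq z a; first by rewrite /q !subrr mul0r md0; have := md_ge0 D; lra.
  have za0 : 0 < md (z - a) by rewrite md_gt0 subr_eq0.
  rewrite /q mdM mdV ler_pdivrMr //.
  have [l|l] := ltP (md (z - a)) d1.
    have := h1 _ l; rewrite (_ : a + (z - a) = z); last by ring.
    move=> H; have := mdD (g z - g a - D * (z - a)) (D * (z - a)); rewrite subrK mdM.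
    have := mulr_ge0 p (ltW za0); lra.
  have := mdDB (g z) (g a); have := gM _ sa; have := gM _ hz.
  have : 2 * M <= 2 * M / d1 * md (z - a) by rewrite mulrAC ler_pdivlMr // ler_wpM2l //; lra.
  have := mulr_ge0 (md_ge0 D) (ltW za0); lra.
have dq z : z != a -> square a rho z -> differentiable q z.
  by move=> za hz; apply: dMul; [apply: dSub; [exact: dg|exact: dCst]|exact: diff_inv_sub].
have dq' z : square a rho z -> z \in [:: a] \/ differentiable q z.
  by move=> hz; rewrite inE; case: (eqVneq z a) => [|za]; [left|right; exact: dq].
have bqb z : bsquare a rho z -> md (q z) <= 2 * M / rho.
  move=> hz; have l := bsquare_md hz; rewrite /q mdM mdV.
  apply: ler_pM; rewrite ?md_ge0 ?invr_ge0 ?md_ge0 //.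
    have := mdDB (g z) (g a); have := gM _ sa; have := gM _ (proj1 hz); lra.
  by rewrite lef_pV2 ?posrE // (lt_le_trans rho0).
clearbody q.
have r20 : 0 < rho / 2 by lra.
have ins z : md (z - a) <= rho / 2 -> inside (rho / 2) (re a - rho) (im a - rho) (2 * rho) (2 * rho) z.
  by move=> hz; apply: inside_sq; lra.
have CF z : z != a -> md (z - a) <= rho / 2 ->
    q z * csq a rho z = Lsq (fun u => q u * (u - z)^-1) a rho.
  move=> za hz; apply: (cauchy_formula W W r20 bq dq' (ins _ hz)).
  by apply: dq => //; apply: md_square; lra.
have binv z u : md (z - a) <= rho / 2 -> bsquare a rho u -> md (u - z)^-1 <= 2 / rho.
  move=> /ins hz hu; have := bdd_inv r20 hz hu.
  by rewrite invf_div.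
have bq1 z : z != a -> md (z - a) <= rho / 2 -> md (q z) <= 256 * M / rho.
  move=> za hz; have c8 := csq_half rho0 hz.
  have : md (q z) * md (csq a rho z) <= 2 * (2 * rho + 2 * rho) * (2 * M / rho * (2 / rho)).
    rewrite -mdM CF //; apply: Lam_bound; rewrite ?(ltW W) // => u hu.
    by rewrite mdM; apply: ler_pM; rewrite ?md_ge0 ?bqb ?binv.
  have -> : 2 * (2 * rho + 2 * rho) * (2 * M / rho * (2 / rho)) = 8^-1 * (256 * M / rho).
    by field; rewrite lt0r_neq0.
  have := ler_wpM2l (md_ge0 (q z)) c8; lra.
have bddL (k : Cx R -> Cx R) B : (forall u, bsquare a rho u -> md (k u) <= B) ->
    bddon (rect_bd (re a - rho) (im a - rho) (2 * rho) (2 * rho)) k by exists B.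
have bql z : md (z - a) <= rho / 2 -> forall u, bsquare a rho u ->
    md (q u * (u - z)^-1) <= 2 * M / rho * (2 / rho).
  by move=> hz u hu; rewrite mdM; apply: ler_pM; rewrite ?md_ge0 ?bqb ?binv.
(* Compare both the products [q z * csq z] and the factors [csq z] at the two points. *)
have lip z z' : z != a -> z' != a -> md (z - a) <= rho / 2 -> md (z' - a) <= rho / 2 ->
    md (q z - q z') <= Kq * M / rho ^+ 2 * md (z - z').
  move=> za za' hz hz'.
  have E u : bsquare a rho u -> (u - z)^-1 - (u - z')^-1 = (z - z') * ((u - z)^-1 * (u - z')^-1).
    move=> hu; have n1 : u - z != 0 by rewrite -md_gt0 (lt_le_trans r20) // (bd_dist (ins _ hz)).
    have n2 : u - z' != 0 by rewrite -md_gt0 (lt_le_trans r20) // (bd_dist (ins _ hz')).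
    by field; rewrite n1 n2.
  have L1 : md (q z * csq a rho z - q z' * csq a rho z') <= 64 * M / rho ^+ 2 * md (z - z').
    rewrite !CF // -[X in X - _]mul1r -[X in _ - X]mul1r -mulNr.
    rewrite -(Lam_lin 1 (-1) (ltW W) (ltW W) (bddL _ _ (bql _ hz)) (bddL _ _ (bql _ hz'))).
    have -> : 64 * M / rho ^+ 2 * md (z - z') = 2 * (2 * rho + 2 * rho) *
        (2 * M / rho * (md (z - z') * (2 / rho * (2 / rho)))).
      by field; rewrite lt0r_neq0.
    apply: Lam_bound; rewrite ?(ltW W) // => u hu.
    rewrite mul1r mulN1r -mulrBr E // !mdM; apply: ler_pM; rewrite ?mulr_ge0 ?md_ge0 ?bqb //.
    by apply: ler_pM; rewrite ?mulr_ge0 ?md_ge0 //; apply: ler_pM; rewrite ?md_ge0 ?binv.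
  have L2 : md (csq a rho z - csq a rho z') <= 32 / rho * md (z - z').
    rewrite /csq /cw -[X in X - _]mul1r -[X in _ - X]mul1r -mulNr.
    rewrite -(Lam_lin 1 (-1) (ltW W) (ltW W) (bddL _ _ (binv _ ^~ hz)) (bddL _ _ (binv _ ^~ hz'))).
    have -> : 32 / rho * md (z - z') = 2 * (2 * rho + 2 * rho) * (md (z - z') * (2 / rho * (2 / rho))).
      by field; rewrite lt0r_neq0.
    apply: Lam_bound; rewrite ?(ltW W) // => u hu.
    rewrite mul1r mulN1r E // !mdM.
    by apply: ler_pM; rewrite ?mulr_ge0 ?md_ge0 //; apply: ler_pM; rewrite ?md_ge0 ?binv.
  have c8 := csq_half rho0 hz.
  have : md (q z - q z') * md (csq a rho z) <=
      64 * M / rho ^+ 2 * md (z - z') + 256 * M / rho * (32 / rho * md (z - z')).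
    rewrite -mdM (_ : (q z - q z') * csq a rho z = (q z * csq a rho z - q z' * csq a rho z') -
      q z' * (csq a rho z - csq a rho z')); last by ring.
    apply: le_trans (mdDB _ _) _; apply: lerD => //; rewrite mdM.
    by apply: ler_pM; rewrite ?md_ge0 ?bq1.
  have -> : 64 * M / rho ^+ 2 * md (z - z') + 256 * M / rho * (32 / rho * md (z - z')) =
      8^-1 * (Kq * M / rho ^+ 2 * md (z - z')).
    by rewrite /Kq; field; rewrite lt0r_neq0.
  have := ler_wpM2l (md_ge0 (q z - q z')) c8; lra.
have approx e (r : R) : 0 < e -> 0 < r ->
    exists z, [/\ z != a, md (z - a) <= rho / 2, md (z - a) <= r & md (q z - D) <= e].
  move=> e0 r0; have [d dd hd] := hD e e0.
  pose s := Num.min (Num.min (d / 2) (rho / 2)) r.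
  have s0 : 0 < s by rewrite !lt_min r0 r20 divr_gt0.
  have [s1 s2 s3] : [/\ s <= d / 2, s <= rho / 2 & s <= r].
    by rewrite /s !ge_min !lexx ?orbT; split.
  have E : a + rc s - a = rc s by rewrite addrC addKr.
  have Em : md (rc s) = s by rewrite md_rc gtr0_norm.
  have sn : rc s != 0 by rewrite rc_eq0 lt0r_neq0.
  exists (a + rc s); split; rewrite ?E ?Em //; first by rewrite -subr_eq0 E.
  have := hd (rc s) ltac:(rewrite Em; lra).
  rewrite gq ?E; last by rewrite -subr_eq0 E.
  by rewrite -mulrBl mdM Em ler_pM2r.
have K0 : 0 <= Kq * M / rho ^+ 2 by rewrite divr_ge0 ?mulr_ge0 ?exprn_ge0 ?(ltW rho0) // /Kq; lra.
split.
  rewrite leNgt; apply/negP => h.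
  have [z [za hz _ hq]] := approx ((md D - 256 * M / rho) / 2) 1 ltac:(lra) ltr01.
  have := bq1 _ za hz; have := mdDB (q z) (q z - D); rewrite (_ : q z - (q z - D) = D); last by ring.
  by lra.
move=> k hk; have [->|k0] := eqVneq k 0.
  by rewrite addr0 subrr mulr0 subr0 md0 expr0n mulr0.
have kE : a + k - a = k by rewrite addrC addKr.
have ka : a + k != a by rewrite -subr_eq0 kE.
rewrite gq // kE -mulrBl mdM expr2 mulrA ler_pM2r ?md_gt0 //.
rewrite leNgt; apply/negP => h.
set B := Kq * M / rho ^+ 2 in K0 lip h.
pose e := md (q (a + k) - D) - B * md k.
have e0 : 0 < e by rewrite /e; lra.
have [z [za hz zr hq]] := approx (e / 4) (e / (4 * (B + 1))) ltac:(lra) ltac:(by rewrite divr_gt0 //; lra).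
have := lip _ _ ka za ltac:(by rewrite kE) hz.
have := mdD (q (a + k) - q z) (q z - D).
rewrite (_ : q (a + k) - q z + (q z - D) = q (a + k) - D); last by ring.
have : B * md (a + k - z) <= B * md k + e / 4.
  have := mdDB k (z - a); rewrite (_ : k - (z - a) = a + k - z); last by ring.
  have : B * md (z - a) <= e / 4.
    apply: le_trans (ler_wpM2l K0 zr) _.
    rewrite mulrA ler_pdivrMr; last lra.
    rewrite (_ : e / 4 * (4 * (B + 1)) = B * e + e); last by field.
    lra.
  move=> h1' h2'; have := ler_wpM2l K0 h2'; rewrite mulrDr; lra.
have eE : e = md (q (a + k) - D) - B * md k by [].
clearbody e; lra.
Qed.

End CauchyEstimates.

(** * Functions of two variables *)

Section TwoVariables.
Context {R : realType}.
Local Notation V := 'rV[Cx R]_2.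
Implicit Types (f : V -> Cx R) (v h : V) (M rho : R).

Lemma diff_line f v h (l : Cx R) : differentiable f (v + l *: h) ->
  differentiable (fun t : Cx R => f (v + t *: h)) l.
Proof.
by move=> df; apply: (@differentiable_comp _ _ _ _ (fun t : Cx R => v + t *: h) f).
Qed.

Lemma vmdZ (z : Cx R) v : vmd (z *: v) = md z * vmd v.
Proof. by rewrite /vmd !cE !mdM maxr_pMr ?md_ge0. Qed.

Lemma vmdD u v : vmd (u + v : V) <= vmd u + vmd v.
Proof. by rewrite -rc_le rcD -!vnormE ler_normD. Qed.

Lemma vmdN v : vmd (- v) = vmd v.
Proof. by rewrite /vmd !cE !mdN. Qed.

Lemma vmdB u v : vmd (u - v : V) = vmd (v - u).
Proof. by rewrite -vmdN opprB. Qed.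

Lemma vmd0 : vmd (0 : V) = 0. Proof. by rewrite /vmd !cE md0 maxxx. Qed.

Lemma vmd_eq0 v : vmd v = 0 -> v = 0.
Proof.
move=> v0; apply/eqP; rewrite -normr_eq0 vnormE rc_eq0; exact/eqP.
Qed.

(** Second order expansion with constants that depend only on a bound of the
    function: restrict to the complex line in the direction of the increment. *)
Lemma taylor2 f v M rho : 0 < rho ->
  (forall u, vmd (u - v) <= 2 * rho -> differentiable f u) ->
  (forall u, vmd (u - v) <= 2 * rho -> md (f u) <= M) ->
  exists a b, [/\ md a <= 256 * M / rho, md b <= 256 * M / rho &
    forall h, vmd h <= rho / 2 ->
      md (f (v + h) - f v - (a * c0 h + b * c1 h)) <= Kq * M / rho ^+ 2 * vmd h ^+ 2].
Proof.
move=> rho0 df fM.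
have vv : vmd (v - v) <= 2 * rho by rewrite subrr vmd0; lra.
have [a [b hab]] := diff_v_elim (df v vv).
have line h : vmd h = 1 -> md (a * c0 h + b * c1 h) <= 256 * M / rho /\
    (forall k, md k <= rho / 2 ->
      md (f (v + k *: h) - f v - (a * c0 h + b * c1 h) * k) <= Kq * M / rho ^+ 2 * md k ^+ 2).
  move=> h1.
  have near t : square 0 rho t -> vmd (v + t *: h - v) <= 2 * rho.
    by move=> /square_md; rewrite subr0 addrC addKr vmdZ h1 mulr1.
  have [||e e0|H1 H2] := @derivative_estimate _ (fun t => f (v + t *: h)) 0 rho M
      (a * c0 h + b * c1 h) rho0.
  - by move=> t /near; move=> /df; exact: diff_line.
  - by move=> t /near; exact: fM.
  - have [d d0 hd] := hab e e0; exists d => // k hk.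
    have := hd (k *: h); rewrite vmdZ h1 mulr1 => /(_ hk).
    by rewrite add0r scale0r addr0 !cE mulrDl ![k * _]mulrC !mulrA.
  - split => // k hk; have := H2 k hk.
    by rewrite add0r scale0r addr0.
exists a, b; split.
- have [|+ _] := line (mk 1 0); first by rewrite /vmd !cE md1 md0 max_l.
  by rewrite !cE mulr1 mulr0 addr0.
- have [|+ _] := line (mk 0 1); first by rewrite /vmd !cE md1 md0 max_r.
  by rewrite !cE mulr1 mulr0 add0r.
move=> h hh; have [h0|hn] := eqVneq (vmd h) 0.
  by rewrite (vmd_eq0 h0) !cE addr0 subrr !mulr0 addr0 subr0 md0 vmd0 expr0n mulr0.
have hp : 0 < vmd h by rewrite lt0r hn vmd_ge0.
have rn : rc (vmd h) != 0 by rewrite rc_eq0.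
have [|_ H] := line ((rc (vmd h))^-1 *: h).
  by rewrite vmdZ mdV md_rc gtr0_norm // mulVf.
have := H (rc (vmd h)); rewrite md_rc gtr0_norm // scalerA mulfV // scale1r => /(_ hh).
rewrite !cE (_ : (a * ((rc (vmd h))^-1 * c0 h) + b * ((rc (vmd h))^-1 * c1 h)) * rc (vmd h) =
  a * c0 h + b * c1 h) //.
by field.
Qed.

(** The second order expansions of the integrand have error constants independent of
    the point of the contour, so they can be integrated term by term. *)
Lemma Lam_diff (psi : Cx R -> V -> Cx R) (x y w h : R) v M rho : 0 <= w -> 0 <= h -> 0 < rho ->
  (forall z, rect_bd x y w h z -> forall u, vmd (u - v) <= 2 * rho -> differentiable (psi z) u) ->
  (forall z, rect_bd x y w h z -> forall u, vmd (u - v) <= 2 * rho -> md (psi z u) <= M) ->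
  differentiable (fun u => Lam (fun z => psi z u) x y w h) v.
Proof.
move=> w0 h0 rho0 dpsi bpsi.
have ex z : exists p : Cx R * Cx R, rect_bd x y w h z ->
    [/\ md p.1 <= 256 * M / rho, md p.2 <= 256 * M / rho &
    forall k, vmd k <= rho / 2 ->
      md (psi z (v + k) - psi z v - (p.1 * c0 k + p.2 * c1 k)) <= Kq * M / rho ^+ 2 * vmd k ^+ 2].
  case: (pselect (rect_bd x y w h z)) => [hz|]; last by exists (0, 0).
  by have [a [b H]] := taylor2 rho0 (dpsi z hz) (bpsi z hz); exists (a, b).
have [p hp] := choice ex.
pose La := Lam (fun z => (p z).1) x y w h; pose Lb := Lam (fun z => (p z).2) x y w h.
have ba : bddon (rect_bd x y w h) (fun z => (p z).1) by exists (256 * M / rho) => z /hp[].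
have bb : bddon (rect_bd x y w h) (fun z => (p z).2) by exists (256 * M / rho) => z /hp[].
have bp k : vmd k <= 2 * rho -> bddon (rect_bd x y w h) (fun z => psi z (v + k)).
  by move=> hk; exists M => z hz; apply: bpsi => //; rewrite addrC addKr.
have bp0 : bddon (rect_bd x y w h) (fun z => psi z v).
  by exists M => z hz; apply: bpsi => //; rewrite subrr vmd0; lra.
have bdlin (f g : Cx R -> Cx R) a b : bddon (rect_bd x y w h) f -> bddon (rect_bd x y w h) g ->
    bddon (rect_bd x y w h) (fun z => a * f z + b * g z).
  move=> [M1 H1] [M2 H2]; exists (md a * M1 + md b * M2) => z hz.
  apply: le_trans (mdD _ _) _; rewrite !mdM.
  by apply: lerD; apply: ler_wpM2l; rewrite ?md_ge0 ?H1 ?H2.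
pose C := 2 * (w + h) * (Kq * M / rho ^+ 2).
have key k : vmd k <= rho / 2 ->
    md (Lam (fun z => psi z (v + k)) x y w h - Lam (fun z => psi z v) x y w h -
      (La * c0 k + Lb * c1 k)) <= C * vmd k ^+ 2.
  move=> hk.
  have b1 := bp k ltac:(lra).
  have b12 := bdlin _ _ 1 (-1) b1 bp0.
  have b34 := bdlin _ _ (c0 k) (c1 k) ba bb.
  rewrite (_ : _ - _ = Lam (fun z => 1 * (1 * psi z (v + k) + (-1) * psi z v) +
     (-1) * (c0 k * (p z).1 + c1 k * (p z).2)) x y w h); last first.
    by rewrite (Lam_lin 1 (-1) w0 h0 b12 b34) (Lam_lin 1 (-1) w0 h0 b1 bp0)
      (Lam_lin _ _ w0 h0 ba bb) /La /Lb; ring.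
  rewrite /C -mulrA; apply: Lam_bound => // z hz.
  have [_ _ H] := hp z hz; have := H k hk.
  by rewrite (_ : psi z (v + k) - _ - _ = 1 * (1 * psi z (v + k) + (-1) * psi z v) +
     (-1) * (c0 k * (p z).1 + c1 k * (p z).2)) //; ring.
apply: (diff_v_intro (a := La) (b := Lb)) => e e0.
have Cp : 0 < `|C| + 1 by have := normr_ge0 C; lra.
exists (Num.min (rho / 2) (e / (`|C| + 1))).
  by rewrite lt_min !divr_gt0.
move=> k; rewrite lt_min => /andP[k1 k2].
apply: le_trans (key k (ltW k1)) _.
rewrite expr2 mulrA ler_wpM2r ?vmd_ge0 //.
move: k2; rewrite ltr_pdivlMr // => k2.
have := ler_norm C; have := vmd_ge0 k => a1 a2.
have := ler_wpM2r a1 a2; lra.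
Qed.

(** Identity theorem along a real segment of the plane. *)
Lemma identity_line f (u v : V) :
  (forall t : R, 0 <= t <= 1 -> exists2 d, 0 < d &
     forall w, vmd (w - (u + rc t *: (v - u))) < d -> differentiable f w) ->
  (exists2 d, 0 < d & forall w, vmd (w - u) < d -> f w = 0) ->
  f v = 0.
Proof.
move=> df [d0 d00 f0].
pose k := vmd (v - u) + 1; have k0 : 0 < k by rewrite /k; have := vmd_ge0 (v - u); lra.
have kl d (l : Cx R) : 0 < d -> md l < d / k -> vmd (l *: (v - u)) < d.
  move=> d1; rewrite ltr_pdivlMr // => hl; rewrite vmdZ; apply: le_lt_trans hl.
  by rewrite ler_wpM2l ?md_ge0 // /k; lra.
have E : u + 1 *: (v - u) = v by rewrite scale1r addrC subrK.
have := @identity_segment _ (fun t => f (u + t *: (v - u))); rewrite E; apply.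
- move=> t ht; have [d d1 hd] := df t ht; exists (d / k); first exact: divr_gt0.
  move=> z hz; apply: diff_line; apply: hd.
  rewrite (_ : _ - _ = (z - rc t) *: (v - u)); first exact: kl.
  by rewrite scalerBl opprD addrACA subrr add0r.
- exists (d0 / k); first exact: divr_gt0.
  by move=> z hz; apply: f0; rewrite addrC addKr; exact: kl.
Qed.

End TwoVariables.

(** * Cauchy integrals along families of curves *)

Section ParametricContour.
Context {R : realType}.
Local Notation V := 'rV[Cx R]_2.
Implicit Types (f g : V -> Cx R) (v u : V) (M r d e a b : R).

Lemma cont_c (k : Cx R -> Cx R) z : differentiable k z ->
  forall e, 0 < e -> exists2 d, 0 < d & forall w, md (w - z) < d -> md (k w - k z) < e.
Proof.
move=> dk e e0; have [D hD] := diff_c_elim dk.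
have [d d0 hd] := hD 1 ltr01.
have K0 : 0 < md D + 1 by have := md_ge0 D; lra.
exists (Num.min d (e / (md D + 1))); first by rewrite lt_min d0 divr_gt0.
move=> w; rewrite lt_min ltr_pdivlMr // => /andP[w1 w2].
have := hd _ w1; rewrite (_ : z + (w - z) = w); last by ring.
move=> H; have := mdD (k w - k z - D * (w - z)) (D * (w - z)); rewrite subrK mdM.
by lra.
Qed.

Lemma cont_v g v : differentiable g v ->
  forall e, 0 < e -> exists2 d, 0 < d & forall u, vmd (u - v) < d -> md (g u - g v) < e.
Proof.
move=> dg e e0; have [a [b hab]] := diff_v_elim dg.
have [d d0 hd] := hab 1 ltr01.
have K0 : 0 < md a + md b + 1 by have := md_ge0 a; have := md_ge0 b; lra.
exists (Num.min d (e / (md a + md b + 1))); first by rewrite lt_min d0 divr_gt0.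
move=> w; rewrite lt_min ltr_pdivlMr // => /andP[w1 w2].
have := hd _ w1; rewrite (_ : v + (w - v) = w); last by rewrite addrC subrK.
pose L := a * c0 (w - v) + b * c1 (w - v); rewrite -/L.
move=> H; have := mdD (g w - g v - L) L; rewrite subrK.
have : md L <= (md a + md b) * vmd (w - v).
  rewrite /L; apply: le_trans (mdD _ _) _; rewrite !mdM mulrDl.
  by apply: lerD; apply: ler_wpM2l; rewrite ?md_ge0 ?vmd_c0 ?vmd_c1.
by lra.
Qed.

Lemma near_im g v a b : differentiable g v -> a < im (g v) < b ->
  exists2 d, 0 < d & forall u, vmd (u - v) < d -> a < im (g u) < b.
Proof.
move=> dg /andP[h1 h2].
have [d d0 hd] := cont_v dg (e := Num.min (im (g v) - a) (b - im (g v))) ltac:(by rewrite lt_min; lra).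
exists d => // u /hd; rewrite lt_min => /andP[k1 k2].
have := le_im_md (g u - g v); rewrite ler_norml !reimE; lra.
Qed.

Lemma near_re g v a b : differentiable g v -> a < re (g v) < b ->
  exists2 d, 0 < d & forall u, vmd (u - v) < d -> a < re (g u) < b.
Proof.
move=> dg /andP[h1 h2].
have [d d0 hd] := cont_v dg (e := Num.min (re (g v) - a) (b - re (g v))) ltac:(by rewrite lt_min; lra).
exists d => // u /hd; rewrite lt_min => /andP[k1 k2].
have := le_re_md (g u - g v); rewrite ler_norml !reimE; lra.
Qed.

Lemma near_and v (P Q : V -> Prop) :
  (exists2 d, 0 < d & forall u, vmd (u - v) < d -> P u) ->
  (exists2 d, 0 < d & forall u, vmd (u - v) < d -> Q u) ->
  exists2 d, 0 < d & forall u, vmd (u - v) < d -> P u /\ Q u.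
Proof.
move=> [d1 d10 h1] [d2 d20 h2]; exists (Num.min d1 d2); first by rewrite lt_min d10.
by move=> u; rewrite lt_min => /andP[u1 u2]; split; [exact: h1|exact: h2].
Qed.

Lemma eq_differentiable f g v :
  (exists2 d, 0 < d & forall u, vmd (u - v) < d -> f u = g u) ->
  differentiable g v -> differentiable f v.
Proof.
move=> [d d0 e] dg; have [a [b hab]] := diff_v_elim dg.
apply: (diff_v_intro (a := a) (b := b)) => t t0.
have [d1 d10 h1] := hab t t0; exists (Num.min d d1); first by rewrite lt_min d0.
move=> h; rewrite lt_min => /andP[k1 k2]; rewrite !e ?h1 //.
- by rewrite subrr vmd0.
- by rewrite addrC addKr.
Qed.

(** The point above [z] of the curve through [v] along which [kap u1 + u2] is constant. *)
Definition cpt (kap : Cx R -> Cx R) (z : Cx R) v : V :=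
  mk z (kap (c0 v) + c1 v - kap z).

Lemma cpt_self kap v : cpt kap (c0 v) v = v.
Proof. by apply: vP; rewrite /cpt !cE // addrC addKr. Qed.

(** The Cauchy integral of [f] along the curve through [v], normalized by the winding
    integral. *)
Definition Cint f kap x y w h v : Cx R :=
  Lam (fun z => f (cpt kap z v) * (z - c0 v)^-1) x y w h / cw x y w h (c0 v).

Lemma diff_cpt kap z u : (forall z, differentiable kap z) ->
  differentiable (cpt kap z) u.
Proof.
move=> dk; apply: diff_mk; first exact: dCst.
apply: dSub; last exact: dCst.
apply: dAdd; last exact: diff_c1.
exact: (differentiable_comp (diff_c0 u) (dk _)).
Qed.

(** Compactness of the boundary of the rectangle, obtained by bisection. *)
Lemma cint_uniform f kap x y w h v : 0 < w -> 0 < h ->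
  (forall z, differentiable kap z) ->
  (forall z, rect_bd x y w h z -> exists2 d, 0 < d &
     forall u, vmd (u - cpt kap z v) < d -> differentiable f u) ->
  exists M rho, 0 < rho /\ forall z, rect_bd x y w h z -> forall u, vmd (u - v) < rho ->
    differentiable f (cpt kap z u) /\ md (f (cpt kap z u)) <= M.
Proof.
move=> w0 h0 dk df.
have [M [rho [rho0 H]]] : exists M rho, 0 < rho /\ forall z, rect x y w h z ->
    rect_bd x y w h z -> forall u, vmd (u - v) < rho ->
    differentiable f (cpt kap z u) /\ md (f (cpt kap z u)) <= M; last first.
  by exists M, rho; split => // z hz; apply: H => //; case: hz.
apply: (bisection (P := fun x' y' w' h' => exists M rho, 0 < rho /\ forall z,
  rect x' y' w' h' z -> rect_bd x y w h z -> forall u, vmd (u - v) < rho ->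
    differentiable f (cpt kap z u) /\ md (f (cpt kap z u)) <= M)) => //.
- move=> x' y' w' h' w'0 h'0 [M1 [r1 [r10 H1]]] [M2 [r2 [r20 H2]]] [M3 [r3 [r30 H3]]] [M4 [r4 [r40 H4]]].
  exists (Num.max (Num.max M1 M2) (Num.max M3 M4)), (Num.min (Num.min r1 r2) (Num.min r3 r4)).
  split; first by rewrite !lt_min r10 r20 r30.
  move=> z [z1 z2] hz u; rewrite !lt_min => /andP[/andP[u1 u2] /andP[u3 u4]].
  rewrite !le_max.
  case: (lerP (re z) (x' + w' / 2)) => hr; case: (lerP (im z) (y' + h' / 2)) => hi.
  + by have [|a ->] := H1 z _ hz u u1; [split; lra|split].
  + by have [|a ->] := H3 z _ hz u u3; [split; lra|split; rewrite ?orbT].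
  + by have [|a ->] := H2 z _ hz u u2; [split; lra|split; rewrite ?orbT].
  + by have [|a ->] := H4 z _ hz u u4; [split; lra|split; rewrite ?orbT].
(* Small rectangles around an interior point do not meet the boundary. *)
move=> z inz; case: (pselect (rect_bd x y w h z)) => [bz|nbz]; last first.
  have [i1 i2] := inz.
  have [n1 n2 n3 n4] : [/\ re z != x, re z != x + w, im z != y & im z != y + h].
    by split; apply/eqP => E; apply: nbz; split => //;
      [constructor 1|constructor 2|constructor 3|constructor 4].
  have [l1 l2 l3 l4] : [/\ x < re z, re z < x + w, y < im z & im z < y + h].
    by split; rewrite lt_neqAle; [rewrite eq_sym n1|rewrite n2|rewrite eq_sym n3|rewrite n4]; lra.
  exists (Num.min (Num.min (re z - x) (x + w - re z)) (Num.min (im z - y) (y + h - im z))).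
    by rewrite !lt_min; lra.
  move=> x' y' w' h' w0' h0' a1 a2 a3 a4 [z1 z2]; rewrite !lt_min => hd.
  exists 0, 1; split => // t [t1 t2] [_ bt]; exfalso; case: bt; lra.
have [d d0 hd] := df z bz.
have [a ha1 ha2] := cont_v (hd (cpt kap z v) ltac:(by rewrite subrr vmd0)) ltr01.
pose e := Num.min d a; have e0 : 0 < e by rewrite lt_min d0.
have [d1 d10 H1] := cont_c (dk z) (e := e / 3) ltac:(lra).
have [d2 d20 H2] := cont_v (differentiable_comp (diff_c0 v) (dk _)) (e := e / 3) ltac:(lra).
exists (Num.min d1 e); first by rewrite lt_min d10.
move=> x' y' w' h' w0' h0' _ _ _ _ [z1 z2]; rewrite lt_min => /andP[hd1 hde].
exists (md (f (cpt kap z v)) + 1), (Num.min d2 (e / 3)).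
split; first by rewrite lt_min d20 divr_gt0.
move=> t [t1 t2] bt u; rewrite lt_min => /andP[u1 u2].
have tz : md (t - z) <= w' + h'.
  apply: le_trans (md_le _) _; rewrite !reimE.
  by apply: lerD; rewrite ler_norml; lra.
have close : vmd (cpt kap t u - cpt kap z v) < e.
  rewrite vmd_lt !cE; apply/andP; split; first lra.
  rewrite (_ : _ - _ = (kap (c0 u) - kap (c0 v)) + (c1 u - c1 v) - (kap t - kap z)); last by ring.
  have := H1 t ltac:(lra); have := H2 u u1; rewrite /= => k1 k2.
  have := mdDB (kap (c0 u) - kap (c0 v) + (c1 u - c1 v)) (kap t - kap z).
  have := mdD (kap (c0 u) - kap (c0 v)) (c1 u - c1 v).
  have := vmd_c1 (u - v); rewrite !cE; lra.
move: close; rewrite lt_min => /andP[cl1 cl2]; split; first exact: hd.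
have := ha2 _ cl2; have := mdD (f (cpt kap t u) - f (cpt kap z v)) (f (cpt kap z v)).
by rewrite subrK; lra.
Qed.

Lemma diff_Cint f kap r x y w h v : 0 < w -> 0 < h -> 0 < r ->
  (forall z, differentiable kap z) -> inside r x y w h (c0 v) ->
  (forall z, rect_bd x y w h z -> exists2 d, 0 < d &
     forall u, vmd (u - cpt kap z v) < d -> differentiable f u) ->
  differentiable (Cint f kap x y w h) v.
Proof.
move=> w0 h0 r0 dk hin df.
have [M [rho [rho0 H]]] := cint_uniform w0 h0 dk df.
pose s := Num.min (rho / 4) (r / 4).
have s0 : 0 < s by rewrite lt_min !divr_gt0.
have [s1 s2] : s <= rho / 4 /\ s <= r / 4 by rewrite /s !ge_min !lexx orbT.
have ins u : vmd (u - v) <= 2 * s -> inside (r / 2) x y w h (c0 u).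
  move=> hu; have := vmd_c0 (u - v); rewrite !cE => k.
  have := le_re_md (c0 u - c0 v); have := le_im_md (c0 u - c0 v).
  by rewrite !ler_norml !reimE; case: hin => *; split; lra.
have r2 : 0 < r / 2 by lra.
have nz u z : vmd (u - v) <= 2 * s -> rect_bd x y w h z -> z - c0 u != 0.
  by move=> hu hz; rewrite -md_gt0 (lt_le_trans r2) // (bd_dist (ins u hu) hz).
have dinv u z : vmd (u - v) <= 2 * s -> rect_bd x y w h z ->
    differentiable (fun u => (z - c0 u)^-1) u.
  move=> hu hz; apply: dInv; last exact: nz hu hz.
  by apply: dSub; [exact: dCst|exact: diff_c0].
rewrite /Cint; apply: dMul; [|apply: dInv].
- apply: (@Lam_diff _ (fun z u => f (cpt kap z u) * (z - c0 u)^-1) _ _ _ _ _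
    (M * (r / 2)^-1) s) => //; [exact: ltW|exact: ltW| |].
  + move=> z hz u hu; apply: dMul; last exact: dinv.
    have [|d _] := H z hz u _; first lra.
    exact: (differentiable_comp (diff_cpt z u dk) d).
  + move=> z hz u hu; rewrite mdM; apply: ler_pM; rewrite ?md_ge0 //.
      by have [|_ ->] := H z hz u _; first lra.
    exact: bdd_inv (ins u hu) _ hz.
- apply: (@Lam_diff _ (fun z u => (z - c0 u)^-1) _ _ _ _ _ ((r / 2)^-1) s) => //;
    [exact: ltW|exact: ltW| |].
  + by move=> z hz u hu; exact: dinv.
  + by move=> z hz u hu; exact: bdd_inv (ins u hu) _ hz.
- rewrite -md_gt0; have := cw_im r0 (ltW w0) (ltW h0) hin.
  have := le_im_md (cw x y w h (c0 v)); rewrite ler_norml => /andP[_ k1] k2.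
  apply: lt_le_trans k1; apply: lt_le_trans k2.
  by rewrite mulr_gt0 // divr_gt0 // addr_gt0 // exprn_gt0.
Qed.

Lemma Cint_cauchy f kap r x y w h v : 0 < w -> 0 < h -> 0 < r ->
  (forall z, differentiable kap z) -> inside r x y w h (c0 v) ->
  (forall z, rect x y w h z -> differentiable f (cpt kap z v)) ->
  Cint f kap x y w h v = f v.
Proof.
move=> w0 h0 r0 dk hin df.
have dphi z : rect x y w h z -> differentiable (fun z => f (cpt kap z v)) z.
  move=> hz; apply: (differentiable_comp (f := fun z => cpt kap z v) (g := f)); last exact: df.
  apply: diff_mk; first exact: (@ex_diff _ _ _ _ _ id).
  by apply: dSub; [exact: dCst|exact: dk].
have inz : rect x y w h (c0 v) by case: hin => *; split; lra.
have [M hM] := bounded_on_rectangle w0 h0 dphi.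
rewrite /Cint -(cauchy_formula w0 h0 r0 (s := [::]) hM _ hin (dphi _ inz)); last first.
  by move=> u hu; right; exact: dphi.
rewrite cpt_self mulfK // -md_gt0; have := cw_im r0 (ltW w0) (ltW h0) hin.
have := le_im_md (cw x y w h (c0 v)); rewrite ler_norml => /andP[_ k1] k2.
apply: lt_le_trans k1; apply: lt_le_trans k2.
by rewrite mulr_gt0 // divr_gt0 // addr_gt0 // exprn_gt0.
Qed.

Lemma Cint_bound f kap r x y w h v m : 0 < w -> 0 < h -> 0 < r ->
  inside r x y w h (c0 v) ->
  (forall z, rect_bd x y w h z -> md (f (cpt kap z v)) <= m) ->
  md (Cint f kap x y w h v) <= 2 * (w + h) * r^-1 * (w * (r / (w ^+ 2 + h ^+ 2)))^-1 * m.
Proof.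
move=> w0 h0 r0 hin fm.
have k0 : 0 < w * (r / (w ^+ 2 + h ^+ 2)).
  by rewrite mulr_gt0 // divr_gt0 // addr_gt0 // exprn_gt0.
have k1 : w * (r / (w ^+ 2 + h ^+ 2)) <= md (cw x y w h (c0 v)).
  apply: le_trans (cw_im r0 (ltW w0) (ltW h0) hin) _.
  by have := le_im_md (cw x y w h (c0 v)); rewrite ler_norml; lra.
rewrite /Cint mdM mdV.
rewrite (_ : 2 * (w + h) * r^-1 * (w * (r / (w ^+ 2 + h ^+ 2)))^-1 * m =
  (2 * (w + h) * (m * r^-1)) * (w * (r / (w ^+ 2 + h ^+ 2)))^-1); last by ring.
apply: ler_pM; rewrite ?md_ge0 ?invr_ge0 ?md_ge0 //; last first.
  by rewrite lef_pV2 ?posrE // (lt_le_trans k0).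
apply: Lam_bound; [exact: ltW|exact: ltW|move=> z hz].
by rewrite mdM; apply: ler_pM; rewrite ?md_ge0 ?fm //; exact: bdd_inv hz.
Qed.

End ParametricContour.

(** * Extension of holomorphic functions across a line in the base of a tube *)

Section TubeStep.
Context {R : realType}.
Local Notation V := 'rV[Cx R]_2.
Implicit Types (f g F : V -> Cx R) (v u : V) (M r d e : R) (E : R -> R -> Prop).

Definition tube E : set V := [set v | E (im (c0 v)) (im (c1 v))].
Definition holoV (A : set V) f := forall v, A v -> differentiable f v.

Definition bopen E := forall y1 y2, E y1 y2 -> exists2 d, 0 < d &
  forall z1 z2, `|z1 - y1| < d -> `|z2 - y2| < d -> E z1 z2.

Lemma tube_open E v : bopen E -> tube E v ->
  exists2 d, 0 < d & forall u, vmd (u - v) < d -> tube E u.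
Proof.
move=> oE Ev; have [d d0 hd] := oE _ _ Ev; exists d => // u; rewrite vmd_lt !cE => /andP[h1 h2].
apply: hd; rewrite -imN -imD; [exact: le_lt_trans (le_im_md _) h1|exact: le_lt_trans (le_im_md _) h2].
Qed.

(** Compact exhaustion of a tube: bounded points whose imaginary part is at
    distance at least [r] from the complement of the base. *)
Definition core E M r : set V := [set v | md (c0 v) <= M /\ md (c1 v) <= M /\
  forall y1 y2, `|y1 - im (c0 v)| < r -> `|y2 - im (c1 v)| < r -> E y1 y2].

Definition extends E E' := forall f, holoV (tube E) f ->
  exists F, holoV (tube E') F /\ forall v, tube E v -> F v = f v.

(** Bounds on a compact part of the smaller tube give bounds, up to a constant, on each
    compact part of the larger tube. *)
Definition dominated E E' := forall M r, 0 < r -> exists M' r' C, 0 < r' /\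
  forall F, holoV (tube E') F -> forall m, (forall v, core E M' r' v -> md (F v) <= m) ->
  forall v, core E' M r v -> md (F v) <= C * m.

Context (del s sig mu eps : R).
(** The thickness [del] of the arms is large with respect to the height [sig] gained in
    one step; the contour extends by [mu] beyond the segment from 0 to [s].  The bending
    [eps] is chosen so that at the vertical sides, at distance 4 from the centre, the
    quadratic term equals 16 eps = 2 sig, while it is at most sig / 8 at distance 1. *)
Definition step_params := [/\ 0 < del, del <= 1 / 4, 0 <= s, s + 2 * del <= 1 &
  [/\ del = 16 * sig, mu = 4 * sig & sig = 8 * eps]].
Hypothesis P : step_params.

(** Two thin arms along the coordinate axes, and the part of the plane below
    the line [y1 + y2 = t]. *)
Definition arms (t y1 y2 : R) : Prop :=
  [\/ - del < y2 < del /\ - del < y1 < 1,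
      - del < y1 < del /\ - del < y2 < 1 |
      [/\ - del < y1, - del < y2 & y1 + y2 < t]].

Lemma arms_open t : bopen (arms t).
Proof.
move=> y1 y2 [[h1 h2]|[h1 h2]|[h1 h2 h3]].
- exists (Num.min (Num.min (y2 + del) (del - y2)) (Num.min (y1 + del) (1 - y1))).
    by rewrite !lt_min; lra.
  by move=> z1 z2; rewrite !lt_min !ltr_norml => k1 k2; constructor 1; lra.
- exists (Num.min (Num.min (y2 + del) (1 - y2)) (Num.min (y1 + del) (del - y1))).
    by rewrite !lt_min; lra.
  by move=> z1 z2; rewrite !lt_min !ltr_norml => k1 k2; constructor 2; lra.
- exists (Num.min (Num.min (y2 + del) (y1 + del)) ((t - y1 - y2) / 2)).
    by rewrite !lt_min; lra.
  by move=> z1 z2; rewrite !lt_min !ltr_norml => k1 k2; constructor 3; split; lra.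
Qed.

(** The bent lines [u1 + u2 + i eps (u1 - x0)^2 = tau]: the quadratic term
    pushes the vertical sides of the contour below the level [s]. *)
Definition kap (x0 : R) (z : Cx R) : Cx R := z + ii * rc eps * (z - rc x0) ^+ 2.

Lemma im_kap x0 z : im (kap x0 z) = im z + eps * (re z - x0) ^+ 2 - eps * im z ^+ 2.
Proof. by rewrite /kap expr2 !reimE; ring. Qed.

Lemma diff_kap x0 z : differentiable (kap x0) z.
Proof.
rewrite /kap; apply: (@dAdd _ _ id); first exact: (@ex_diff _ _ _ _ _ id).
apply: dMul; first exact: dCst.
by apply: dExp; apply: (@dSub _ _ id); [exact: (@ex_diff _ _ _ _ _ id)|exact: dCst].
Qed.

Definition tau x0 v : Cx R := kap x0 (c0 v) + c1 v.
Definition T x0 v : R := im (tau x0 v).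

Lemma TE x0 v : T x0 v = im (c0 v) + im (c1 v) + eps * (re (c0 v) - x0) ^+ 2 - eps * im (c0 v) ^+ 2.
Proof. by rewrite /T /tau imD im_kap; ring. Qed.

Lemma diff_tau x0 v : differentiable (tau x0) v.
Proof.
apply: dAdd; last exact: diff_c1.
exact: (differentiable_comp (diff_c0 v) (diff_kap _ _)).
Qed.

Local Notation Q x0 PP := (PP (x0 - 4) (- mu) 8 (s + 2 * mu)).

Lemma im_cpt x0 z v :
  im (c1 (cpt (kap x0) z v)) = T x0 v - im z - (eps * (re z - x0) ^+ 2 - eps * im z ^+ 2).
Proof. by rewrite /cpt !cE imD imN im_kap /T /tau; ring. Qed.

Lemma eps_bounds X Y : `|X| <= 4 -> `|Y| <= 1 ->
  [/\ 0 <= eps * X ^+ 2, eps * X ^+ 2 <= 2 * sig, 0 <= eps * Y ^+ 2 & eps * Y ^+ 2 <= sig / 8].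
Proof.
have [del0 del1 s0 s1 [sigE muE epsE]] := P.
move=> hX hY; have e0 : 0 <= eps by lra.
have X2 : X ^+ 2 <= 16.
  rewrite -real_normK ?num_real // (_ : 16 = 4 ^+ 2); last by ring.
  by rewrite lerXn2r ?nnegrE.
have Y2 : Y ^+ 2 <= 1.
  by rewrite -real_normK ?num_real // expr_le1.
have := ler_wpM2l e0 X2; have := ler_wpM2l e0 Y2.
have := mulr_ge0 e0 (sqr_ge0 X); have := mulr_ge0 e0 (sqr_ge0 Y).
by move=> *; split; lra.
Qed.

(** The horizontal sides of the contour lie in the tubes over the two arms.  On the
    vertical sides the quadratic term pushes the second coordinate down by 2 sig, below
    the line [y1 + y2 = s]. *)
Lemma contour_in x0 z v y1 y2 : Q x0 rect_bd z -> s - 2 * sig < T x0 v < s + sig ->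
  `|y1 - im (c0 (cpt (kap x0) z v))| < sig / 8 -> `|y2 - im (c1 (cpt (kap x0) z v))| < sig / 8 ->
  arms s y1 y2.
Proof.
have [del0 del1 s0 s1 [sigE muE epsE]] := P.
move=> [[z1 z2] hz] hT; rewrite im_cpt /cpt c0_mk !ltr_norml.
have hX : `|re z - x0| <= 4 by rewrite ler_norml; lra.
have hY : `|im z| <= 1 by rewrite ler_norml; lra.
have [e1 e2 e3 e4] := eps_bounds hX hY.
have side : re z = x0 - 4 \/ re z = x0 - 4 + 8 -> eps * (re z - x0) ^+ 2 = 2 * sig.
  have e8 : eps = sig / 8 by lra.
  by case=> ->; rewrite e8; field.
set eX := eps * (re z - x0) ^+ 2 in e1 e2 side *; set eY := eps * im z ^+ 2 in e3 e4 *.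
clearbody eX eY.
case: hz => E k1 k2.
- have {}side := side (or_introl E); constructor 3; split; lra.
- have {}side := side (or_intror E); constructor 3; split; lra.
- by constructor 2; rewrite E in k1 k2 *; lra.
- by constructor 1; rewrite E in k1 k2 *; lra.
Qed.

(** For a curve whose level is at most s - sig, the whole rectangle stays below the line. *)
Lemma disc_in x0 z v : Q x0 rect z -> s - 2 * sig < T x0 v < s - sig ->
  tube (arms s) (cpt (kap x0) z v).
Proof.
have [del0 del1 s0 s1 [sigE muE epsE]] := P.
move=> [z1 z2] hT; rewrite /tube /= im_cpt /cpt c0_mk.
have hX : `|re z - x0| <= 4 by rewrite ler_norml; lra.
have hY : `|im z| <= 1 by rewrite ler_norml; lra.
have [e1 e2 e3 e4] := eps_bounds hX hY.
set eX := eps * (re z - x0) ^+ 2 in e1 e2 *; set eY := eps * im z ^+ 2 in e3 e4 *.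
clearbody eX eY.
constructor 3; split; lra.
Qed.

Definition Fc f x0 v : Cx R := Q x0 (Cint f (kap x0)) v.

Lemma width0 : 0 < s + 2 * mu.
Proof.
have [del0 del1 s0 s1 [sigE muE epsE]] := P.
by lra. Qed.

Lemma insideQ x0 v : - mu < im (c0 v) < s + mu -> `|re (c0 v) - x0| < 4 ->
  exists2 r, 0 < r & Q x0 (inside r) (c0 v).
Proof.
have [del0 del1 s0 s1 [sigE muE epsE]] := P.
rewrite ltr_norml => /andP[h1 h2] /andP[h3 h4].
exists (Num.min (Num.min (im (c0 v) + mu) (s + mu - im (c0 v)))
  (Num.min (re (c0 v) - x0 + 4) (4 - (re (c0 v) - x0)))).
  by rewrite !lt_min; lra.
set r := Num.min _ _.
have : r <= r by []. rewrite {2}/r !le_min => /andP[/andP[k1 k2] /andP[k3 k4]].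
by split; lra.
Qed.

Lemma diff_Fc f x0 v : holoV (tube (arms s)) f ->
  - mu < im (c0 v) < s + mu -> `|re (c0 v) - x0| < 4 -> s - 2 * sig < T x0 v < s + sig ->
  differentiable (Fc f x0) v.
Proof.
have [del0 del1 s0 s1 [sigE muE epsE]] := P.
move=> hf h1 h2 hT; have [r r0 hin] := insideQ h1 h2.
apply: (diff_Cint _ width0 r0 (diff_kap x0) hin); first lra.
move=> z hz; have [|d d0 hd] := @tube_open (arms s) (cpt (kap x0) z v) (@arms_open s).
  have sp : 0 < sig / 8 by lra.
  by apply: (contour_in hz hT); rewrite subrr normr0.
by exists d => // u /hd; exact: hf.
Qed.

Lemma Fc_low f x0 v : holoV (tube (arms s)) f ->
  - mu < im (c0 v) < s + mu -> `|re (c0 v) - x0| < 4 -> s - 2 * sig < T x0 v < s - sig ->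
  Fc f x0 v = f v.
Proof.
have [del0 del1 s0 s1 [sigE muE epsE]] := P.
move=> hf h1 h2 hT; have [r r0 hin] := insideQ h1 h2.
apply: (Cint_cauchy _ width0 r0 (diff_kap x0) hin); first lra.
by move=> z hz; apply: hf; exact: disc_in.
Qed.

(** The strip around the line on which the Cauchy integral is used. *)
Definition W v := - mu < im (c0 v) < s + mu /\
  s - 7 / 4 * sig < im (c0 v) + im (c1 v) < s + sig / 2.

Lemma W_T x0 v t : W v -> `|re (c0 v) - x0| <= 1 -> 
  0 <= t -> s - 13 / 8 * sig <= im (c0 v) + im (c1 v) - t ->
  s - 2 * sig < T x0 v - t < s + sig.
Proof.
have [del0 del1 s0 s1 [sigE muE epsE]] := P.
move=> [h1 h2] h3 t0 ht; rewrite TE.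
have hX : `|re (c0 v) - x0| <= 4 by lra.
have hX1 : `|re (c0 v) - x0| <= 1 by [].
have hY : `|im (c0 v)| <= 1 by rewrite ler_norml; lra.
have [e1 _ e3 e4] := eps_bounds hX hY.
have [_ _ e5 e6] := eps_bounds hX hX1.
by lra.
Qed.

Section Vertical.
Context (f : V -> Cx R) (x0 : R) (v : V).
Hypotheses (hf : holoV (tube (arms s)) f) (Wv : W v) (hx : `|re (c0 v) - x0| <= 1).
Hypothesis low : s - 13 / 8 * sig <= im (c0 v) + im (c1 v).

Definition depth : R := im (c0 v) + im (c1 v) - (s - 13 / 8 * sig).
Definition vert (t : R) : V := mk (c0 v) (c1 v - ii * rc t).

Lemma T_vert t : T x0 (vert t) = T x0 v - t.
Proof. by rewrite !TE !cE !reimE; ring. Qed.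

Lemma near_vert t a b : a < T x0 (vert t) < b -> exists2 d, 0 < d & forall u, vmd (u - vert t) < d ->
  (- mu < im (c0 u) < s + mu /\ x0 - 4 < re (c0 u) < x0 + 4) /\ a < T x0 u < b.
Proof.
move=> hT.
have x4 : x0 - 4 < re (c0 v) < x0 + 4 by have := hx; rewrite ler_norml; lra.
have o1 := near_im (diff_c0 (vert t)) (a := - mu) (b := s + mu)
  ltac:(by rewrite /vert !cE; case: Wv).
have o2 := near_re (diff_c0 (vert t)) (a := x0 - 4) (b := x0 + 4) ltac:(by rewrite /vert !cE).
by have o3 := near_im (diff_tau x0 (vert t)) hT; exact: near_and (near_and o1 o2) o3.
Qed.

Lemma diff_Fc_vert t : 0 <= t -> s - 13 / 8 * sig <= im (c0 v) + im (c1 v) - t ->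
  exists2 d, 0 < d & forall u, vmd (u - vert t) < d -> differentiable (Fc f x0) u.
Proof.
move=> t0 ht; have := W_T Wv hx t0 ht; rewrite -T_vert => /near_vert[d d0 hd].
have k4 w : x0 - 4 < re (c0 w) < x0 + 4 -> `|re (c0 w) - x0| < 4 by rewrite ltr_norml; lra.
by exists d; [exact: d0|move=> w /hd [[k1 k2] k3]; exact: (diff_Fc hf k1 (k4 w k2) k3)].
Qed.

Lemma Fc_near_low : exists2 d, 0 < d & forall u, vmd (u - vert depth) < d -> Fc f x0 u = f u.
Proof.
have [del0 del1 s0 s1 [sigE muE epsE]] := P.
have hT : s - 2 * sig < T x0 (vert depth) < s - sig.
  rewrite T_vert TE.
  have hX1 : `|re (c0 v) - x0| <= 1 := hx.
  have hX : `|re (c0 v) - x0| <= 4 by lra.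
  have hY : `|im (c0 v)| <= 1 by case: Wv; rewrite ler_norml; lra.
  have [e1 _ e3 e4] := eps_bounds hX hY; have [_ _ e5 e6] := eps_bounds hX hX1.
  by rewrite /depth; lra.
have [d d0 hd] := near_vert hT.
by exists d => // w /hd [[k1 k2] k3]; apply: Fc_low => //; rewrite ltr_norml; lra.
Qed.

(** Uniqueness of the extension, by moving the second coordinate downwards into
    the region where the bent disc lies in the domain. *)
Lemma Fc_unique g :
  (exists2 d, 0 < d & forall u, vmd (u - vert depth) < d -> g u = f u) ->
  (forall t : R, 0 <= t -> s - 13 / 8 * sig <= im (c0 v) + im (c1 v) - t ->
     exists2 d, 0 < d & forall u, vmd (u - vert t) < d -> differentiable g u) ->
  Fc f x0 v = g v.
Proof.
move=> gf dg.
have t00 : 0 <= depth by rewrite /depth; have := low; lra.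
apply/eqP; rewrite -subr_eq0; apply/eqP.
apply: (@identity_line _ (fun u => Fc f x0 u - g u) (vert depth) v).
- move=> q hq; have tq : 0 <= (1 - q) * depth by rewrite mulr_ge0 //; lra.
  have qt : 0 <= q * depth by rewrite mulr_ge0 //; lra.
  have -> : vert depth + rc q *: (v - vert depth) = vert ((1 - q) * depth).
    by apply: vP; rewrite /vert !cE ?rcM ?rcB ?rc1; ring.
  have ht : s - 13 / 8 * sig <= im (c0 v) + im (c1 v) - (1 - q) * depth.
    have : depth - (1 - q) * depth = q * depth by ring.
    by rewrite {1}/depth; lra.
  have [d d0 hd] := near_and (diff_Fc_vert tq ht) (dg _ tq ht).
  by exists d; [exact: d0|move=> w /hd [k1 k2]; exact: (dSub k1 k2)].
- have [d d0 hd] := near_and Fc_near_low gf.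
  by exists d => // w /hd [-> ->]; rewrite subrr.
Qed.

End Vertical.

End TubeStep.

Section TubeStepTheorem.
Context {R : realType}.
Local Notation V := 'rV[Cx R]_2.
Implicit Types (f g F : V -> Cx R) (v u : V) (M r d e : R).
Context (del s sig mu eps : R).
Hypothesis P : step_params del s sig mu eps.
Local Notation s' := (s + sig / 2).
Local Notation Fx := (Fc s mu eps).

Definition W1 v := - mu < im (c0 v) < s + mu /\
  s - 3 / 2 * sig < im (c0 v) + im (c1 v) < s'.

Lemma W1_W v : W1 v -> W s sig mu v.
Proof. have [del0 del1 s0 s1 [sigE muE epsE]] := P; by move=> [h1 h2]; split; lra. Qed.

Lemma W1_low v : W1 v -> s - 13 / 8 * sig <= im (c0 v) + im (c1 v).
Proof. have [del0 del1 s0 s1 [sigE muE epsE]] := P; by move=> [h1 h2]; lra. Qed.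

Lemma W1_open v : W1 v -> exists2 d, 0 < d & forall u, vmd (u - v) < d -> W1 u.
Proof.
move=> [h1 h2].
have o2 := near_im (dAdd (diff_c0 v) (diff_c1 v)) (a := s - 3 / 2 * sig) (b := s') ltac:(by rewrite imD).
have [d d0 hd] := near_and (near_im (diff_c0 v) h1) o2.
by exists d => // u /hd; rewrite imD.
Qed.

Lemma arms_mono y1 y2 : arms del s y1 y2 -> arms del s' y1 y2.
Proof.
have [del0 del1 s0 s1 [sigE muE epsE]] := P.
by case=> [?|?|[? ? ?]]; [constructor 1|constructor 2|constructor 3; split; lra].
Qed.

Lemma vert_in v t : W1 v -> 0 <= t -> s - 13 / 8 * sig <= im (c0 v) + im (c1 v) - t ->
  tube (arms del s') (vert v t).
Proof.
have [del0 del1 s0 s1 [sigE muE epsE]] := P.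
by move=> [h1 h2] t0 ht; rewrite /tube /= /vert !cE !reimE; constructor 3; split; lra.
Qed.

Lemma vert_in0 v t : W1 v -> tube (arms del s) v -> 0 <= t ->
  s - 13 / 8 * sig <= im (c0 v) + im (c1 v) - t -> tube (arms del s) (vert v t).
Proof.
have [del0 del1 s0 s1 [sigE muE epsE]] := P.
move=> [h1 h2] Ev t0 ht; rewrite /tube /= /vert !cE !reimE.
by case: Ev => [[h3 h4]|[h3 h4]|[h3 h4 h5]];
  [constructor 1|constructor 2|constructor 3]; split; lra.
Qed.

Lemma near_refl v x0 : x0 = re (c0 v) -> `|re (c0 v) - x0| <= 1.
Proof. by move=> ->; rewrite subrr normr0. Qed.

Lemma Fc_extends F x0 v : holoV (tube (arms del s')) F -> W1 v -> `|re (c0 v) - x0| <= 1 ->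
  Fx F x0 v = F v.
Proof.
move=> hF Wv hx.
have hf : holoV (tube (arms del s)) F by move=> u /arms_mono; exact: hF.
apply: (Fc_unique P hf (W1_W Wv) hx (W1_low Wv)); first by exists 1.
move=> t t0 ht; have [d d0 hd] := tube_open (@arms_open _ _ _) (vert_in Wv t0 ht).
by exists d => // u /hd; exact: hF.
Qed.

Lemma Fc_restrict f x0 v : holoV (tube (arms del s)) f -> W1 v -> tube (arms del s) v ->
  `|re (c0 v) - x0| <= 1 -> Fx f x0 v = f v.
Proof.
move=> hf Wv Ev hx.
apply: (Fc_unique P hf (W1_W Wv) hx (W1_low Wv)); first by exists 1.
move=> t t0 ht; have [d d0 hd] := tube_open (@arms_open _ _ _) (vert_in0 Wv Ev t0 ht).
by exists d => // u /hd; exact: hf.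
Qed.

Lemma Fc_compat f x0 x1 v : holoV (tube (arms del s)) f -> W1 v ->
  `|re (c0 v) - x0| <= 1 -> `|re (c0 v) - x1| <= 1 -> Fx f x0 v = Fx f x1 v.
Proof.
move=> hf Wv h0 h1; apply: (Fc_unique P hf (W1_W Wv) h0 (W1_low Wv)).
  exact: (Fc_near_low P hf (W1_W Wv) h1).
by move=> t t0 ht; exact: (diff_Fc_vert P hf (W1_W Wv) h1 t0 ht).
Qed.

Lemma W1_diff f x0 v : holoV (tube (arms del s)) f -> W1 v -> `|re (c0 v) - x0| <= 1 ->
  differentiable (Fx f x0) v.
Proof.
move=> hf Wv hx.
have [d d0] := diff_Fc_vert P hf (W1_W Wv) hx (lexx 0) ltac:(by rewrite subr0; exact: W1_low).
have -> : vert v 0 = v by apply: vP; rewrite /vert !cE ?rc0 ?mulr0 ?subr0.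
by apply; rewrite subrr vmd0.
Qed.

Lemma notW1 v : tube (arms del s') v -> ~ W1 v -> tube (arms del s) v.
Proof.
have [del0 del1 s0 s1 [sigE muE epsE]] := P.
move=> Ev nW; case: (Ev) => [h|h|[h1 h2 h3]]; [by constructor 1|by constructor 2|].
have [h4|h4] := lerP (im (c0 v) + im (c1 v)) (s - 3 / 2 * sig).
  by constructor 3; split; lra.
have [h5|h5] := lerP (im (c0 v)) (- mu); first by constructor 2; lra.
have [h6|h6] := lerP (s + mu) (im (c0 v)); first by constructor 1; lra.
by case: nW; split; lra.
Qed.

(** The extension is the Cauchy integral over the rectangle centred at the real part of
    the first coordinate; the centre may be moved locally by [Fc_compat]. *)
Lemma step_extends : extends (arms del s) (arms del s').
Proof.
move=> f hf.
pose F v := if pselect (W1 v) then Fx f (re (c0 v)) v else f v.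
have FE v : tube (arms del s) v -> F v = f v.
  by move=> Ev; rewrite /F; case: pselect => // Wv; apply: Fc_restrict => //; exact: near_refl.
exists F; split => // v Ev; case: (pselect (W1 v)) => [Wv|nW]; last first.
  have Ev0 := notW1 Ev nW; apply: eq_differentiable (hf _ Ev0).
  by have [d d0 hd] := tube_open (@arms_open _ _ _) Ev0; exists d => // u /hd; exact: FE.
apply: eq_differentiable (W1_diff hf Wv (near_refl (erefl (re (c0 v))))).
have o1 := near_re (diff_c0 v) (a := re (c0 v) - 1) (b := re (c0 v) + 1) ltac:(lra).
have [d d0 hd] := near_and (W1_open Wv) o1; exists d => // u /hd [Wu ru].
rewrite /F; case: pselect => [w0|/(_ Wu)//]; apply: Fc_compat => //; first exact: near_refl.
by rewrite ler_norml; lra.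
Qed.

Lemma core_arms M r v : core (arms del s') M r v ->
  ~ (- (mu / 2) <= im (c0 v) <= s + mu / 2 /\ s - sig <= im (c0 v) + im (c1 v) < s') ->
  forall y1 y2, `|y1 - im (c0 v)| < r / 2 -> `|y2 - im (c1 v)| < r / 2 ->
  `|y1 - im (c0 v)| < sig / 8 -> `|y2 - im (c1 v)| < sig / 8 -> arms del s y1 y2.
Proof.
have [del0 del1 s0 s1 [sigE muE epsE]] := P.
move=> [_ [_ hE]] nW y1 y2; rewrite !ltr_norml => k1 k2 k3 k4.
have Ey : arms del s' y1 y2 by apply: hE; rewrite ltr_norml; lra.
case: (Ey) => [h|h|[h1 h2 h3]]; [by constructor 1|by constructor 2|].
have [h4|h4] := ltrP (im (c0 v) + im (c1 v)) (s - sig).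
  by constructor 3; split; lra.
have [h5|h5] := ltrP (im (c0 v)) (- (mu / 2)); first by constructor 2; lra.
have [h6|h6] := ltrP (s + mu / 2) (im (c0 v)); first by constructor 1; lra.
have [h7|h7] := ltrP (im (c0 v) + im (c1 v)) s'; first by case: nW; split; lra.
have : arms del s' (im (c0 v) + r / 2) (im (c1 v) + r / 2).
  by apply: hE; rewrite ltr_norml; lra.
by case=> [[h8 h9]|[h8 h9]|[h8 h9 h10]]; [constructor 1|constructor 2|exfalso]; lra.
Qed.

(** A point of the core outside the strip already belongs to the smaller tube.  In the
    strip, estimate the Cauchy integral: its contour lies in a core of that tube. *)
Lemma step_dominated : dominated (arms del s) (arms del s').
Proof.
have [del0 del1 s0 s1 [sigE muE epsE]] := P.
move=> M r r0.
pose h := s + 2 * mu.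
have h0 : 0 < h by rewrite /h; lra.
pose C := 2 * (8 + h) * (mu / 2)^-1 * (8 * ((mu / 2) / (8 ^+ 2 + h ^+ 2)))^-1.
have C0 : 0 <= C.
  have : 0 < 8 ^+ 2 + h ^+ 2 by rewrite addr_gt0 // exprn_gt0.
  rewrite /C => q; apply: mulr_ge0.
    by apply: mulr_ge0; [lra|rewrite invr_ge0; lra].
  by rewrite invr_ge0; apply: mulr_ge0; [lra|apply: divr_ge0; [lra|exact: ltW]].
(* The first coordinate is at most |M| + 6 in modulus on the contour, and the bending adds at
   most 25 there and 1 at the centre. *)
exists (3 * `|M| + 40), (Num.min (r / 2) (sig / 8)), (1 + C).
split; first by rewrite lt_min; lra.
move=> F hF m hm v hv.
case: (pselect (- (mu / 2) <= im (c0 v) <= s + mu / 2 /\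
    s - sig <= im (c0 v) + im (c1 v) < s')) => [[a1 a2]|nW]; last first.
  have : md (F v) <= m.
    apply: hm; have [b1 [b2 _]] := hv; have := ler_norm M; have := normr_ge0 M => n1 n2.
    split; first lra; split; first lra.
    by move=> y1 y2; rewrite !lt_min => /andP[? ?] /andP[? ?]; exact: (core_arms hv nW).
  by have := md_ge0 (F v); have := C0; nra.
have Wv : W1 v by split; lra.
set x0 := re (c0 v).
have hx : `|re (c0 v) - x0| <= 1 by exact: near_refl.
rewrite -(Fc_extends hF Wv hx).
have hT := W_T P (W1_W Wv) hx (lexx 0) ltac:(by rewrite subr0; exact: W1_low).
rewrite subr0 in hT.
have bnd z : rect_bd (x0 - 4) (- mu) 8 (s + 2 * mu) z -> md (F (cpt (kap eps x0) z v)) <= m.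
  move=> hz; apply: hm; have [b1 [b2 _]] := hv.
  have M0 : M <= `|M| := ler_norm M.
  have M1 := normr_ge0 M.
  have imz : `|im z| <= 1 by case: hz => -[_ ?] _; rewrite ler_norml; lra.
  have rez : `|re z - x0| <= 4 by case: hz => -[? _] _; rewrite ler_norml; lra.
  have imv : `|im (c0 v)| <= 1 by rewrite ler_norml; lra.
  have z5 : md (z - rc x0) <= 5.
    by apply: le_trans (md_le _) _; rewrite !reimE subr0; lra.
  have v1 : md (c0 v - rc x0) <= 1.
    by apply: le_trans (md_le _) _; rewrite !reimE /x0 subrr normr0 subr0 add0r.
  have zM : md z <= `|M| + 6.
    have := mdD (z - c0 v) (c0 v); rewrite subrK.
    have := mdDB (z - rc x0) (c0 v - rc x0).
    by rewrite (_ : z - rc x0 - (c0 v - rc x0) = z - c0 v); [lra|ring].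
  have e0 : 0 <= eps <= 1 by lra.
  have kb (w : Cx R) c : 0 <= c -> md (w - rc x0) <= c -> md (kap eps x0 w) <= md w + c ^+ 2.
    move=> c_0 hc; rewrite /kap; apply: le_trans (mdD _ _) _; rewrite lerD2l mdM [md (ii * _)]mdM md_ii mul1r mdX md_rc.
    rewrite ger0_norm; last by case/andP: e0.
    have q : md (w - rc x0) ^+ 2 <= c ^+ 2 by rewrite lerXn2r ?nnegrE ?md_ge0.
    apply: le_trans q; rewrite ler_piMl ?exprn_ge0 ?md_ge0 //.
    by case/andP: e0.
  have k1 := kb z 5 ltac:(lra) z5; have k2 := kb (c0 v) 1 ltac:(lra) v1.
  rewrite /core /= /cpt !cE; split; first lra.
  split.
    have := mdDB (kap eps x0 (c0 v) + c1 v) (kap eps x0 z).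
    by have := mdD (kap eps x0 (c0 v)) (c1 v); rewrite expr1n in k2; rewrite expr2 in k1; lra.
  move=> y1 y2; rewrite !lt_min => /andP[_ l1] /andP[_ l2].
  by apply: (contour_in P hz hT); rewrite /cpt !cE.
have m0 : 0 <= m.
  apply: le_trans (md_ge0 _) (bnd (cx x0 (- mu)) _).
  by split; [split; rewrite !reimE; lra|constructor 3; rewrite !reimE].
have r2 : 0 < mu / 2 by lra.
have hin : inside (mu / 2) (x0 - 4) (- mu) 8 (s + 2 * mu) (c0 v).
  by split; rewrite /x0; lra.
have := Cint_bound (ltac:(lra) : (0 : R) < 8) h0 r2 hin bnd.
rewrite -/h -/C -/(Fc s mu eps F x0 v) => H; apply: le_trans H _.
by rewrite mulrDl mul1r lerDr.
Qed.

End TubeStepTheorem.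

(** * Tubes over star-shaped bases *)

Section StarTube.
Context {R : realType}.
Local Notation V := 'rV[Cx R]_2.
Implicit Types (f g F : V -> Cx R) (v u : V) (M r d e t del : R) (E W om K : R -> R -> Prop).

Lemma extends_trans E E' E'' : extends E E' -> extends E' E'' ->
  (forall y1 y2, E y1 y2 -> E' y1 y2) -> extends E E''.
Proof.
move=> h1 h2 sub f /h1[F [hF FE]]; have [G [hG GF]] := h2 F hF.
by exists G; split => // v hv; rewrite GF ?FE //; exact: sub.
Qed.

Lemma dominated_trans E E' E'' : dominated E E' -> dominated E' E'' ->
  (forall y1 y2, E' y1 y2 -> E'' y1 y2) -> dominated E E''.
Proof.
move=> h1 h2 sub M r r0; have [M2 [r2 [C2 [r20 H2]]]] := h2 M r r0.
have [M1 [r1 [C1 [r10 H1]]]] := h1 M2 r2 r20.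
exists M1, r1, (C2 * C1); split => // F hF m hm v hv.
rewrite -mulrA; apply: H2 => // u hu; apply: H1 => // w hw.
by apply: hF; exact: sub.
Qed.

(** Each step gains sig / 2, and finitely many steps reach any level below the ends of
    the arms. *)
Lemma triangle_extension del t : 0 < del -> del <= 1 / 4 -> t + 2 * del <= 1 ->
  exists s, [/\ t <= s, 0 <= s, s + del <= 1, extends (arms del 0) (arms del s) &
    dominated (arms del 0) (arms del s)].
Proof.
move=> del0 del1 ht.
pose sig := del / 16.
have sig0 : 0 < sig by rewrite divr_gt0.
suff H k : exists s, [/\ 0 <= s /\ s + del <= 1, t <= s \/ k%:R * (sig / 2) <= s, extends (arms del 0) (arms del s),
    dominated (arms del 0) (arms del s) & forall y1 y2, arms del 0 y1 y2 -> arms del s y1 y2].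
  pose k := Num.bound (`|t| / (sig / 2)).
  have hk : `|t| / (sig / 2) < k%:R by apply: archi_boundP; rewrite divr_ge0 // divr_ge0 // ltW.
  rewrite ltr_pdivrMr ?divr_gt0 // in hk.
  have [s [[s0 s1] hs e d _]] := H k; exists s; split => //.
  by have := ler_norm t; case: hs; lra.
elim: k => [|k [s [[s0 s1] hs ex dom mono]]].
  exists 0; split => //.
  - by split; lra.
  - by right; rewrite mul0r.
  - by move=> f hf; exists f.
  move=> M r r0; exists M, r, 1; split => // F hF m hm v hv.
  by rewrite mul1r; exact: hm.
have [ts|st] := lerP t s; first by exists s; split => //; left.
have P : step_params del s sig (4 * sig) (sig / 8).
  by split => //; first lra; split; rewrite /sig; field.
exists (s + sig / 2); split.
- by split; [rewrite addr_ge0 // divr_ge0 // ltW|have : del = 16 * sig by rewrite /sig; field]; lra.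
- right; rewrite -natr1 mulrDl mul1r lerD2r; case: hs; lra.
- exact: extends_trans ex (step_extends P) mono.
- exact: (dominated_trans dom (step_dominated P) (arms_mono P)).
- by move=> y1 y2 /mono; exact: (arms_mono P).
Qed.

Definition star E := forall t y1 y2, 0 <= t <= 1 -> E y1 y2 -> E (t * y1) (t * y2).

Lemma arms_star del s : 0 < del -> del <= 1 / 4 -> 0 <= s -> star (arms del s).
Proof.
move=> d0 d1 s0 t y1 y2 /andP[t0 t1] Ey.
have sc y a : 0 < a -> - a < y -> - a < t * y.
  by move=> a0 ya; have [y0|y0] := lerP 0 y; [have := mulr_ge0 t0 y0; lra|nra].
have sc' y a : 0 < a -> y < a -> t * y < a.
  by move=> a0 ya; have [y0|y0] := lerP 0 y; [nra|nra].
case: Ey => [[/andP[h1 h2] /andP[h3 h4]]|[/andP[h1 h2] /andP[h3 h4]]|[h1 h2 h3]].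
- by constructor 1; rewrite !sc ?sc' //; lra.
- by constructor 2; rewrite !sc ?sc' //; lra.
- have [h4|h4] := lerP 0 (y1 + y2).
    constructor 3; split; [exact: sc|exact: sc|rewrite -mulrDr; nra].
  by constructor 1; rewrite !sc ?sc' //; lra.
Qed.

(** The segment from the centre to [a] has a parallel strip around it in the set: contract a
    neighbourhood of [a], and use a neighbourhood of the centre. *)
Lemma star_thick om a1 a2 b1 b2 : bopen om -> star om -> om 0 0 -> om a1 a2 ->
  exists2 del, 0 < del & forall y1 y2, - del < y2 < del -> - del < y1 < 1 ->
    om (y1 * a1 + y2 * b1) (y1 * a2 + y2 * b2).
Proof.
move=> oO sO O0 Oa; have [ra ra0 ha] := oO _ _ Oa; have [r0 r00 h0] := oO _ _ O0.
pose B := `|a1| + `|a2| + `|b1| + `|b2| + 1.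
have [n1 n2 n3 n4] : [/\ 0 <= `|a1|, 0 <= `|a2|, 0 <= `|b1| & 0 <= `|b2|] by split.
have [B1 B2 B3 B4] : [/\ `|a1| <= B, `|a2| <= B, `|b1| <= B & `|b2| <= B].
  by rewrite /B; split; lra.
have B0 : 0 < B by rewrite /B; lra.
pose eta := Num.min (1 / 2) (r0 / (2 * B)).
have eta0 : 0 < eta by rewrite lt_min !divr_gt0 ?mulr_gt0.
have etaB : eta * B <= r0 / 2.
  have : eta <= r0 / (2 * B) by rewrite ge_min lexx orbT.
  by rewrite ler_pdivlMr ?mulr_gt0 //; lra.
pose del := Num.min eta (eta * ra / B).
have del0 : 0 < del by rewrite lt_min eta0 divr_gt0 ?mulr_gt0.
have dele : del <= eta by rewrite ge_min lexx.
have delB : del * B <= eta * ra.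
  have : del <= eta * ra / B by rewrite ge_min lexx orbT.
  by rewrite ler_pdivlMr.
clearbody B eta del.
exists del => // y1 y2 hy2 hy1.
have y2n : `|y2| < del by rewrite ltr_norml.
(* Away from the centre divide by [y1]; near the centre use the ball of radius [r0]. *)
have [l|l] := lerP eta y1.
  have y10 : 0 < y1 by lra.
  have q : `|y2 / y1| * B < ra.
    rewrite normrM normfV (gtr0_norm y10) mulrAC ltr_pdivrMr //.
    have : `|y2| * B < del * B by rewrite ltr_pM2r.
    have : eta * ra <= y1 * ra by rewrite ler_wpM2r // ltW.
    by rewrite [ra * y1]mulrC; lra.
  have E b a : y1 * a + y2 * b = y1 * (a + y2 / y1 * b) by field; rewrite gt_eqF.
  rewrite !E; apply: sO; first lra.
  apply: ha; rewrite addrC addKr normrM; apply: le_lt_trans q; apply: ler_wpM2l => //.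
have sm a b : `|a| <= B -> `|b| <= B -> `|y1 * a + y2 * b| < r0.
  move=> ha' hb'; apply: le_lt_trans (ler_normD _ _) _; rewrite !normrM.
  have y1n : `|y1| <= eta by rewrite ler_norml; lra.
  have k1 : `|y1| * `|a| <= eta * B by apply: ler_pM.
  have k2 : `|y2| * `|b| <= `|y2| * B by apply: ler_wpM2l.
  have k3 : `|y2| * B < eta * B by rewrite ltr_pM2r //; lra.
  by lra.
by apply: h0; rewrite subr0; exact: sm.
Qed.

Lemma core_closed E M r : closed (core E M r).
Proof.
suff oC : open (~` core E M r) by rewrite -[core _ _ _]setCK; exact: open_closedC.
rewrite openE => v /= nv; apply/nbhs_vP.
have [l1|l1] := ltP M (md (c0 v)).
  exists (md (c0 v) - M); first lra.
  move=> u; rewrite vmd_lt !cE => /andP[h _] [k _].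
  by have := mdDB (c0 u) (c0 u - c0 v); rewrite (_ : c0 u - (c0 u - c0 v) = c0 v); [lra|ring].
have [l2|l2] := ltP M (md (c1 v)).
  exists (md (c1 v) - M); first lra.
  move=> u; rewrite vmd_lt !cE => /andP[_ h] [_ [k _]].
  by have := mdDB (c1 u) (c1 u - c1 v); rewrite (_ : c1 u - (c1 u - c1 v) = c1 v); [lra|ring].
have [y1 [y2 [h1 h2 nE]]] : exists y1 y2, [/\ `|y1 - im (c0 v)| < r, `|y2 - im (c1 v)| < r & ~ E y1 y2].
  apply: contrapT => H; apply: nv; split => //; split => // y1 y2 h1 h2.
  by apply: contrapT => nE; apply: H; exists y1, y2.
exists (Num.min (r - `|y1 - im (c0 v)|) (r - `|y2 - im (c1 v)|)).
  by rewrite lt_min; lra.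
move=> u; rewrite vmd_lt !cE !lt_min => /andP[/andP[k1 _] /andP[_ k2]] [_ [_ hE]].
have s1 := le_lt_trans (le_im_md _) k1; have s2 := le_lt_trans (le_im_md _) k2.
rewrite !reimE in s1 s2; apply: nE; apply: hE.
- have := ler_normB (y1 - im (c0 v)) (im (c0 u) - im (c0 v)).
  by rewrite (_ : y1 - im (c0 v) - (im (c0 u) - im (c0 v)) = y1 - im (c0 u)); [lra|ring].
- have := ler_normB (y2 - im (c1 v)) (im (c1 u) - im (c1 v)).
  by rewrite (_ : y2 - im (c1 v) - (im (c1 u) - im (c1 v)) = y2 - im (c1 u)); [lra|ring].
Qed.

Lemma compact_polydisc M : compact [set v : V | md (c0 v) <= M /\ md (c1 v) <= M].
Proof.
have := @rV_compact (Cx R) 2 (fun=> [set z : Cx R | md z <= M]) (fun=> @compact_md R M).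
congr compact; apply/seteqP; split => v /=; first by move=> h; split; exact: h.
by move=> [h1 h2]; apply: ord2P.
Qed.

Lemma core_compact E M r : compact (core E M r).
Proof.
apply: (@subclosed_compact V); [exact: core_closed|exact: (@compact_polydisc M)|].
by move=> v [h1 [h2 _]].
Qed.

(** [K] is locally dominated by [om]: near each point of the tube over [K],
    holomorphic functions are bounded by their bounds on a compact subset of the
    tube over [om]. *)
Definition loc_dominated om K := forall v, tube K v -> exists d L C, [/\ 0 < d, compact L,
  L `<=` tube om & forall F, holoV (tube K) F -> forall m, (forall u, L u -> md (F u) <= m) ->
    forall u, vmd (u - v) < d -> md (F u) <= C * m].

Lemma core_near E v : bopen E -> tube E v -> exists M r, 0 < r /\
  forall u, vmd (u - v) < r -> core E M r u.
Proof.
move=> oE Ev; have [d d0 hd] := oE _ _ Ev.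
exists (md (c0 v) + md (c1 v) + d), (d / 2); split; first by rewrite divr_gt0.
move=> u; rewrite vmd_lt !cE => /andP[h1 h2].
have g0 := md_ge0 (c0 v); have g1 := md_ge0 (c1 v).
have i1 := le_lt_trans (le_im_md _) h1; have i2 := le_lt_trans (le_im_md _) h2.
rewrite !reimE in i1 i2.
split; first by have := mdD (c0 u - c0 v) (c0 v); rewrite subrK; lra.
split; first by have := mdD (c1 u - c1 v) (c1 v); rewrite subrK; lra.
move=> y1 y2 k1 k2; apply: hd.
- have := ler_normD (y1 - im (c0 u)) (im (c0 u) - im (c0 v)); rewrite subrKA; lra.
- have := ler_normD (y2 - im (c1 u)) (im (c1 u) - im (c1 v)); rewrite subrKA; lra.
Qed.

(** The identity theorem along the segments from 0, where the functions agree near the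
    real plane. *)
Lemma star_identity W F G r : bopen W -> star W -> holoV (tube W) F -> holoV (tube W) G ->
  0 < r -> (forall v, `|im (c0 v)| < r -> `|im (c1 v)| < r -> F v = G v) ->
  forall v, tube W v -> F v = G v.
Proof.
move=> oW sW hF hG r0 FG v Wv; apply/eqP; rewrite -subr_eq0; apply/eqP.
apply: (@identity_line _ (fun u => F u - G u) 0 v).
- move=> t ht; rewrite subr0 add0r.
  have [|d d0 hd] := @tube_open _ W (rc t *: v) oW.
    by rewrite /tube /= !cE !reimE !mul0r !addr0; exact: sW.
  by exists d; [exact: d0|move=> w /hd hw; exact: (dSub (hF w hw) (hG w hw))].
- exists r => // w; rewrite subr0 vmd_lt => /andP[h1 h2].
  by rewrite FG ?subrr //; [exact: le_lt_trans (le_im_md _) h1|exact: le_lt_trans (le_im_md _) h2].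
Qed.

Section LinearChange.
Context (a1 a2 b1 b2 : R).
Hypothesis D0 : a1 * b2 - a2 * b1 != 0.
Local Notation D := (a1 * b2 - a2 * b1).

(** The complexified change of coordinates that sends the unit vectors to [a] and [b]. *)
Definition lin v : V := mk (rc a1 * c0 v + rc b1 * c1 v) (rc a2 * c0 v + rc b2 * c1 v).
Definition linv v : V :=
  mk (rc (b2 / D) * c0 v - rc (b1 / D) * c1 v) (rc (a1 / D) * c1 v - rc (a2 / D) * c0 v).
Definition bas E y1 y2 : Prop := E ((b2 * y1 - b1 * y2) / D) ((a1 * y2 - a2 * y1) / D).

Lemma linvK v : lin (linv v) = v.
Proof.
have Dc : rc a1 * rc b2 - rc a2 * rc b1 != 0.
  by rewrite -!rcM -rcB rc_eq0.
by apply: vP; rewrite /lin /linv !cE !rcM !rcV !rcB !rcM; field.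
Qed.

Lemma linK v : linv (lin v) = v.
Proof.
have Dc : rc a1 * rc b2 - rc a2 * rc b1 != 0.
  by rewrite -!rcM -rcB rc_eq0.
by apply: vP; rewrite /lin /linv !cE !rcM !rcV !rcB !rcM; field.
Qed.

Lemma diff_lin v : differentiable lin v.
Proof.
by apply: diff_mk; apply: dAdd; apply: dMul; try exact: dCst; try exact: diff_c0; exact: diff_c1.
Qed.

Lemma diff_linv v : differentiable linv v.
Proof.
by apply: diff_mk; apply: dSub; apply: dMul; try exact: dCst; try exact: diff_c0; exact: diff_c1.
Qed.

Lemma tube_linv E v : tube (bas E) v <-> tube E (linv v).
Proof.
rewrite /tube /= /bas /linv !cE !reimE !mul0r !addr0.
rewrite (_ : (b2 * im (c0 v) - b1 * im (c1 v)) / D = b2 / D * im (c0 v) - b1 / D * im (c1 v)); last by ring.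
by rewrite (_ : (a1 * im (c1 v) - a2 * im (c0 v)) / D = a1 / D * im (c1 v) - a2 / D * im (c0 v)); last by ring.
Qed.

Lemma tube_lin E v : tube (bas E) (lin v) <-> tube E v.
Proof. by rewrite tube_linv linK. Qed.

Lemma holo_lin E F : holoV (tube (bas E)) F -> holoV (tube E) (F \o lin).
Proof.
move=> hF v Ev; apply: (differentiable_comp (diff_lin v)).
by apply: hF; apply/tube_lin.
Qed.

Lemma holo_linv E F : holoV (tube E) F -> holoV (tube (bas E)) (F \o linv).
Proof.
move=> hF v Ev; apply: (differentiable_comp (diff_linv v)).
by apply: hF; apply/tube_linv.
Qed.

Lemma extends_bas E E' : extends E E' -> extends (bas E) (bas E').
Proof.
move=> ex f /holo_lin/ex[F [hF FE]]; exists (F \o linv); split; first exact: holo_linv.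
by move=> v /tube_linv Ev /=; rewrite FE //= linvK.
Qed.

Lemma dominated_bas E E' : bopen E' -> dominated E E' -> loc_dominated (bas E) (bas E').
Proof.
move=> oE dom v /tube_linv Ev.
have [M [r [r0 near]]] := core_near oE Ev.
have [M' [r' [C [r'0 H]]]] := dom M r r0.
have [d1 d10 h1] := cont_v (differentiable_comp (diff_linv v) (diff_c0 _)) r0.
have [d2 d20 h2] := cont_v (differentiable_comp (diff_linv v) (diff_c1 _)) r0.
exists (Num.min d1 d2), (lin @` core E M' r'), C; split.
- by rewrite lt_min d10.
- apply: continuous_compact (core_compact (E := E) (M := M') (r := r')).
  by apply: continuous_subspaceT => u; exact: differentiable_continuous (diff_lin u).
- move=> _ [u [_ [_ hu]] <-]; apply/tube_lin; apply: hu; by rewrite subrr normr0.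
- move=> F hF m hm u; rewrite lt_min => /andP[u1 u2].
  rewrite -[u]linvK; apply: (H (F \o lin)); first exact: holo_lin.
    by move=> w hw; apply: hm; exists w.
  by apply: near; rewrite vmd_lt c0D c0N c1D c1N; apply/andP; split; [exact: h1|exact: h2].
Qed.

Lemma bas_open E : bopen E -> bopen (bas E).
Proof.
move=> oE y1 y2 Ey.
set v0 := mk (ii * rc y1) (ii * rc y2).
have /tube_linv Ev : tube (bas E) v0.
  by rewrite /tube /= !cE !reimE !mul0r !add0r !mul1r.
have [d d0 hd] := tube_open oE Ev.
have [d1 d10 h1] := cont_v (differentiable_comp (diff_linv v0) (diff_c0 _)) d0.
have [d2 d20 h2] := cont_v (differentiable_comp (diff_linv v0) (diff_c1 _)) d0.
exists (Num.min d1 d2); first by rewrite lt_min d10.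
move=> z1 z2; rewrite !lt_min => /andP[k1 k2] /andP[k3 k4].
have C a b : ii * rc a - ii * rc b = ii * rc (a - b) :> Cx R by rewrite rcB mulrBr.
have close e : `|z1 - y1| < e -> `|z2 - y2| < e ->
    vmd (mk (ii * rc z1) (ii * rc z2) - v0) < e.
  by move=> *; rewrite vmd_lt !cE !C !mdM md_ii !mul1r !md_rc; apply/andP.
have : tube (bas E) (mk (ii * rc z1) (ii * rc z2)).
  apply/tube_linv; apply: hd; rewrite vmd_lt c0D c0N c1D c1N; apply/andP; split; [apply: h1|apply: h2]; exact: close.
by rewrite /tube /= !cE !reimE !mul0r !add0r !mul1r.
Qed.

Lemma bas_star E : star E -> star (bas E).
Proof.
move=> sE t y1 y2 ht Ey; rewrite /bas.
rewrite (_ : _ / D = t * ((b2 * y1 - b1 * y2) / D)); last by ring.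
rewrite (_ : (a1 * (t * y2) - a2 * (t * y1)) / D = t * ((a1 * y2 - a2 * y1) / D)); last by ring.
exact: sE.
Qed.

Lemma bas_comb E y1 y2 : bas E (y1 * a1 + y2 * b1) (y1 * a2 + y2 * b2) <-> E y1 y2.
Proof.
rewrite /bas; rewrite (_ : _ / D = y1); last by field.
by rewrite (_ : _ / D = y2); last by field.
Qed.

Lemma bas_elim E y1 y2 : bas E y1 y2 -> exists x1 x2,
  [/\ E x1 x2, y1 = x1 * a1 + x2 * b1 & y2 = x1 * a2 + x2 * b2].
Proof.
move=> Ey; exists ((b2 * y1 - b1 * y2) / D), ((a1 * y2 - a2 * y1) / D).
by split => //; field.
Qed.

End LinearChange.

(** The triangles with vertices 0, a, b, for a, b in the set, without the side from a to b. *)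
Definition in_triangle om y1 y2 := exists a1 a2 b1 b2 p q,
  [/\ om a1 a2, om b1 b2, a1 * b2 - a2 * b1 != 0 &
  [/\ 0 <= p, 0 <= q, p + q < 1, y1 = p * a1 + q * b1 & y2 = p * a2 + q * b2]].

(** In the coordinates given by [a] and [b] the set contains two thin arms along the
    axes, to which [triangle_extension] applies. *)
Lemma local_extension om y1 y2 : bopen om -> star om -> om 0 0 -> in_triangle om y1 y2 ->
  exists E W, [/\ bopen W, star W, W y1 y2,
    (forall z1 z2, E z1 z2 -> om z1 z2) /\
    (forall z1 z2, W z1 z2 -> om z1 z2 \/ in_triangle om z1 z2) & [/\
    (exists2 r, 0 < r & forall z1 z2, `|z1| < r -> `|z2| < r -> E z1 z2 /\ W z1 z2),
    extends E W & loc_dominated E W]].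
Proof.
move=> oO sO O0 [a1 [a2 [b1 [b2 [p [q [Oa Ob D0 [p0 q0 pq -> ->]]]]]]]].
have [e1 e10 h1] := star_thick b1 b2 oO sO O0 Oa.
have [e2 e20 h2] := star_thick a1 a2 oO sO O0 Ob.
pose del := Num.min (Num.min e1 e2) (Num.min (1 / 4) ((1 - (p + q)) / 4)).
have del0 : 0 < del by rewrite !lt_min e10 e20 !divr_gt0 //; lra.
have [k1 k2 k3 k4] : [/\ del <= e1, del <= e2, del <= 1 / 4 & del <= (1 - (p + q)) / 4].
  by rewrite /del !ge_min !lexx ?orbT.
clearbody del.
have [s [ts s0 s1 ex dom]] := @triangle_extension del (1 - 2 * del) del0 k3 ltac:(lra).
have oA t := @arms_open R del t.
have EA x1 x2 : - del < x2 < del -> - del < x1 < 1 ->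
  om (x1 * a1 + x2 * b1) (x1 * a2 + x2 * b2) by move=> *; apply: h1; lra.
have EB x1 x2 : - del < x1 < del -> - del < x2 < 1 ->
  om (x1 * a1 + x2 * b1) (x1 * a2 + x2 * b2).
  by move=> *; rewrite addrC [X in om _ X]addrC; apply: h2; lra.
exists (bas a1 a2 b1 b2 (arms del 0)), (bas a1 a2 b1 b2 (arms del s)); split.
- exact: bas_open.
- exact: bas_star (arms_star del0 k3 s0).
- by apply/(bas_comb D0); constructor 3; split; lra.
- split=> z1 z2 /(bas_elim D0)[x1 [x2 [Ex E1 E2]]].
    by rewrite E1 E2; case: Ex => [[? ?]|[? ?]|[? ? ?]]; [exact: EA|exact: EB|apply: EA; lra].
  case: Ex => [[? ?]|[? ?]|[? ? ?]]; [left; rewrite E1 E2; exact: EA|left; rewrite E1 E2; exact: EB|].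
  have [x10|x10] := lerP x1 0; first by left; rewrite E1 E2; apply: EB; lra.
  have [x20|x20] := lerP x2 0; first by left; rewrite E1 E2; apply: EA; lra.
  by right; exists a1, a2, b1, b2, x1, x2; split => //; split; lra.
- split; [|exact: extends_bas|exact: dominated_bas].
  have A0 t : 0 <= t -> bas a1 a2 b1 b2 (arms del t) 0 0.
    move=> t0; have /(bas_comb D0 (arms del t) 0 0) : arms del t 0 0 by constructor 1; lra.
    by rewrite !mul0r addr0.
  have [r1 r10 H1] := bas_open (oA 0) (A0 _ (lexx 0)).
  have [r2 r20 H2] := bas_open (oA s) (A0 _ s0).
  exists (Num.min r1 r2); first by rewrite lt_min r10.
  move=> z1 z2; rewrite !lt_min => /andP[? ?] /andP[? ?].
  by split; [apply: H1|apply: H2]; rewrite subr0.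
Qed.

(** Bochner's tube theorem for a star-shaped base: the local extensions over
    triangles with a vertex at the centre agree, because their bases are
    star-shaped about a common point. *)
Theorem star_tube om K : bopen om -> star om -> om 0 0 ->
  (forall y1 y2, om y1 y2 -> K y1 y2) -> (forall y1 y2, K y1 y2 <-> in_triangle om y1 y2) ->
  extends om K /\ loc_dominated om K.
Proof.
move=> oO sO O0 OK KT; split; last first.
  move=> v Kv; have /KT Tv := Kv.
  have [E [W [oW sW Wy [EO WK] [_ _ dom]]]] := local_extension oO sO O0 Tv.
  have [d [L [C [d0 cL LE H]]]] := dom v Wy.
  exists d, L, C; split => //; first by move=> u /LE; exact: EO.
  move=> F hF; apply: H => u Wu; apply: hF.
  by case: (WK _ _ Wu) => [/OK//|Tu]; apply/KT.
move=> f hf.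
have ex v : exists WF : (R -> R -> Prop) * (V -> Cx R), tube K v ->
    [/\ bopen WF.1, star WF.1, tube WF.1 v, holoV (tube WF.1) WF.2 &
    exists2 r, 0 < r & forall u, `|im (c0 u)| < r -> `|im (c1 u)| < r -> WF.2 u = f u].
  case: (pselect (tube K v)) => [Kv|nK]; last by exists ((fun _ _ => False), f).
  have /KT Tv := Kv.
  have [E [W [oW sW Wy [EO WK] [[r r0 hr] ex _]]]] := local_extension oO sO O0 Tv.
  have [F [hF FE]] : exists F, holoV (tube W) F /\ forall v, tube E v -> F v = f v.
    by apply: ex => u Eu; apply: hf; exact: EO.
  exists (W, F) => _; split => //; exists r => // u u1 u2; apply: FE.
  by have [] := hr _ _ u1 u2.
have [WF hWF] := choice ex.
have oI (A B : R -> R -> Prop) : bopen A -> bopen B -> bopen (fun x y => A x y /\ B x y).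
  move=> oA oB y1 y2 [/oA[d1 d10 H1] /oB[d2 d20 H2]].
  exists (Num.min d1 d2); first by rewrite lt_min d10.
  by move=> z1 z2; rewrite !lt_min => /andP[? ?] /andP[? ?]; split; [exact: H1|exact: H2].
have sI (A B : R -> R -> Prop) : star A -> star B -> star (fun x y => A x y /\ B x y).
  by move=> sA sB t y1 y2 ht [? ?]; split; [exact: sA|exact: sB].
exists (fun v => (WF v).2 v); split.
- move=> v Kv; have [oW sW Wv hF [r r0 hr]] := hWF v Kv.
  have [|d d0 hd] := @tube_open _ (fun x y => (WF v).1 x y /\ K x y) v _ (conj Wv Kv).
    apply: oI => // y1 y2 /KT T; have [E [W [oW' _ Wy [_ WK] _]]] := local_extension oO sO O0 T.
    have [d d0 hd] := oW' _ _ Wy; exists d => // z1 z2 ? ?.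
    by case: (WK z1 z2 (hd _ _ _ _)) => // [/OK//|?]; apply/KT.
  apply: eq_differentiable (hF v Wv); exists d => // u /hd [Wu Ku].
  have [oW2 sW2 Wv2 hF2 [r2 r20 hr2]] := hWF u Ku.
  have := @star_identity (fun x y => (WF u).1 x y /\ (WF v).1 x y) (WF u).2 (WF v).2 (Num.min r r2)
    (oI _ _ oW2 oW) (sI _ _ sW2 sW).
  apply => //.
  + by move=> w [? _]; exact: hF2.
  + by move=> w [_ ?]; exact: hF.
  + by rewrite lt_min r0.
  + by move=> w; rewrite !lt_min => /andP[? ?] /andP[? ?]; rewrite hr // hr2.
- move=> v Ov; have Kv : tube K v by exact: OK.
  have [oW sW Wv hF [r r0 hr]] := hWF v Kv.
  have := @star_identity (fun x y => (WF v).1 x y /\ om x y) (WF v).2 f r (oI _ _ oW oO) (sI _ _ sW sO).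
  by apply => // w [? ?]; [exact: hF|exact: hf].
Qed.

End StarTube.

(** * The complex exponential and a logarithm *)

Section ComplexExponential.
Context {R : realType}.
Local Notation V := 'rV[Cx R]_2.
Implicit Types (z w : Cx R) (x y e t : R).

Definition cexp z : Cx R := cx (expR (re z) * cos (im z)) (expR (re z) * sin (im z)).

Lemma cexpD z w : cexp (z + w) = cexp z * cexp w.
Proof. by apply: cxP; rewrite /cexp !reimE expRD ?cosD ?sinD; ring. Qed.

Lemma cexp0 : cexp 0 = 1.
Proof. by apply: cxP; rewrite /cexp !reimE expR0 ?cos0 ?sin0; ring. Qed.

Lemma md_cexp z : md (cexp z) = expR (re z).
Proof.
by rewrite /md /cexp !reimE !exprMn -mulrDr cos2Dsin2 mulr1 sqrtr_sqr ger0_norm // expR_ge0.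
Qed.

Lemma cexp_neq0 z : cexp z != 0.
Proof. by rewrite -md_gt0 md_cexp expR_gt0. Qed.

Lemma cexpN z : cexp (- z) = (cexp z)^-1.
Proof.
by apply: (mulfI (cexp_neq0 z)); rewrite -cexpD subrr cexp0 divff // cexp_neq0.
Qed.

Lemma real_derivative (f : R -> R) x (D : R) : is_derive x 1 f D ->
  forall e, 0 < e -> exists2 d, 0 < d & forall h, `|h| < d -> `|f (x + h) - f x - D * h| <= e * `|h|.
Proof.
move=> fD e e0; have df : differentiable f x by apply/derivable1_diffP; exact: ex_derive.
have /diff_locally /eqaddoP /(_ e e0) := df.
move=> /nbhs_ballP[d /= d0 hd]; exists d => // h hh.
have := hd h; rewrite /ball /= sub0r normrN => /(_ hh).
rewrite -[(_ - _) h]/(f (h + x) - (f x + 'd f x h)) diff1E // derive1E derive_val.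
by rewrite opprD addrA [h + x]addrC [h *: _]mulrC.
Qed.

(** From the derivatives at 0 of the real exponential, sine and cosine. *)
Lemma cexp_at0 e : 0 < e -> exists2 d, 0 < d & forall h, md h < d -> md (cexp h - 1 - h) <= e * md h.
Proof.
move=> e0; pose s := Num.min 1 (e / 10).
have s0 : 0 < s by rewrite lt_min ltr01 divr_gt0.
have [s1 s2] : s <= 1 /\ s <= e / 10 by rewrite /s !ge_min !lexx orbT.
clearbody s.
have [d1 d10 h1] := real_derivative (is_derive_expR (0 : R)) s0.
have [d2 d20 h2] := real_derivative (is_derive_cos (0 : R)) s0.
have [d3 d30 h3] := real_derivative (is_derive_sin (0 : R)) s0.
exists (Num.min (Num.min d1 d2) (Num.min d3 s)); first by rewrite !lt_min d10 d20 d30 s0.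
move=> h; rewrite !lt_min => /andP[/andP[k1 k2] /andP[k3 k4]].
have rh := le_re_md h; have ih := le_im_md h.
have := h1 (re h) (le_lt_trans rh k1); have := h2 (im h) (le_lt_trans ih k2).
have := h3 (im h) (le_lt_trans ih k3).
rewrite !add0r expR0 cos0 sin0 oppr0 !mul1r mul0r !subr0 ?addr0 => S Cs E.
set a := re h in rh E *; set b := im h in ih S Cs *.
have hE : re h = a by []. have hI : im h = b by [].
have m0 := md_ge0 h; set m := md h in rh ih k4 m0 *.
have B1 : `|expR a - 1 - a| <= s * m by apply: le_trans E _; rewrite ler_wpM2l // ltW.
have B2 : `|cos b - 1| <= s * m by apply: le_trans Cs _; rewrite ler_wpM2l // ltW.
have B3 : `|sin b - b| <= s * m by apply: le_trans S _; rewrite ler_wpM2l // ltW.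
have sm : s * m <= m by rewrite ler_piMl.
have c1 := cos_max b.
have B4 : `|expR a - 1| <= 2 * m.
  by have := ler_normD (expR a - 1 - a) a; rewrite subrK; lra.
have B5 : `|sin b| <= 2 * m.
  by have := ler_normD (sin b - b) b; rewrite subrK; lra.
have B6 : `|1 + a| <= 2.
  by have := ler_normD 1 a; rewrite normr1; lra.
apply: le_trans (md_le _) _; rewrite /cexp !reimE hE hI oppr0 addr0.
have -> : expR a * cos b - 1 - a = (expR a - 1 - a) * cos b + (1 + a) * (cos b - 1) by ring.
have -> : expR a * sin b - b = (expR a - 1) * sin b + (sin b - b) by ring.
have t1 : `|(expR a - 1 - a) * cos b + (1 + a) * (cos b - 1)| <= s * m * 1 + 2 * (s * m).
  apply: le_trans (ler_normD _ _) _; rewrite !normrM.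
  by apply: lerD; apply: ler_pM.
have t2 : `|(expR a - 1) * sin b + (sin b - b)| <= 2 * m * (2 * m) + s * m.
  apply: le_trans (ler_normD _ _) _; rewrite !normrM.
  by apply: lerD => //; apply: ler_pM.
have mm : m * m <= s * m by rewrite ler_wpM2r // ltW.
have : s * m <= e / 10 * m by rewrite ler_wpM2r.
have : 0 <= e * m by rewrite mulr_ge0 // ltW.
lra.
Qed.

Lemma cexp_diff_eps z e : 0 < e -> exists2 d, 0 < d & forall h, md h < d ->
  md (cexp (z + h) - cexp z - cexp z * h) <= e * md h.
Proof.
move=> e0; have c0 : 0 < md (cexp z) by rewrite md_gt0 cexp_neq0.
have [d d0 hd] := cexp_at0 (divr_gt0 e0 c0); exists d => // h /hd H.
rewrite cexpD (_ : _ - _ - _ = cexp z * (cexp h - 1 - h)); last by ring.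
rewrite mdM; apply: le_trans (ler_wpM2l (ltW c0) H) _.
by rewrite mulrA mulrCA divff ?mulr1 // gt_eqF.
Qed.

Lemma diff_cexp z : differentiable cexp z.
Proof. by apply: (@diff_c_intro _ _ _ (cexp z)) => e; exact: cexp_diff_eps. Qed.

(** The principal logarithm on the right half-plane. *)
Definition clog z : Cx R := cx (ln (md z)) (atan (im z / re z)).

Lemma clogK z : 0 < re z -> cexp (clog z) = z.
Proof.
move=> rz; have mz : 0 < md z by apply: lt_le_trans rz (le_trans (ler_norm _) (le_re_md _)).
have rz0 : re z != 0 by rewrite gt_eqF.
have mE : md z = re z * Num.sqrt (1 + (im z / re z) ^+ 2).
  rewrite /md -[X in X * _]ger0_norm ?(ltW rz) // -sqrtr_sqr -sqrtrM ?sqr_ge0 //.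
  by congr Num.sqrt; field.
have s0 : Num.sqrt (1 + (im z / re z) ^+ 2) != 0.
  by rewrite gt_eqF // sqrtr_gt0 ltr_pwDl // sqr_ge0.
have cE : md z * cos (atan (im z / re z)) = re z.
  by rewrite cos_atan mE mulfK.
have c0 : cos (atan (im z / re z)) != 0 by rewrite cos_atan invr_neq0.
rewrite /cexp /clog; apply: cxP; rewrite !reimE lnK ?posrE //.
have : tan (atan (im z / re z)) = im z / re z by rewrite atanK.
rewrite /tan => /(canRL (divfK c0)) ->.
by rewrite mulrCA cE divfK.
Qed.

Lemma cexpK w : - (pi / 2) < im w < pi / 2 -> clog (cexp w) = w.
Proof.
move=> hw; rewrite /clog; apply: cxP; rewrite !reimE.
  by rewrite md_cexp expRK.
rewrite -mulf_div divff ?gt_eqF ?expR_gt0 // mul1r.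
by rewrite -[_ / _]/(tan (im w)) tanK // in_itv /=.
Qed.

Lemma md_dist z w : `|md z - md w| <= md (z - w).
Proof.
rewrite ler_norml; have := mdD (z - w) w; have := mdD (w - z) z.
by rewrite !subrK (mdB w); lra.
Qed.

Lemma re_continuous : continuous (re : Cx R -> R).
Proof.
move=> z A /nbhs_ballP[e /= e0 hA]; apply/nbhs_cP; exists e => // w hw; apply: hA.
rewrite /ball /= distrC; apply: le_lt_trans hw.
by have := le_re_md (w - z); rewrite !reimE.
Qed.

Lemma im_continuous : continuous (im : Cx R -> R).
Proof.
move=> z A /nbhs_ballP[e /= e0 hA]; apply/nbhs_cP; exists e => // w hw; apply: hA.
rewrite /ball /= distrC; apply: le_lt_trans hw.
by have := le_im_md (w - z); rewrite !reimE.
Qed.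

Lemma md_continuous : continuous (md : Cx R -> R).
Proof.
move=> z A /nbhs_ballP[e /= e0 hA]; apply/nbhs_cP; exists e => // w hw; apply: hA.
by rewrite /ball /= distrC; apply: le_lt_trans hw; exact: md_dist.
Qed.

Lemma clog_continuous z : 0 < re z -> forall e, 0 < e ->
  exists2 d, 0 < d & forall w, md (w - z) < d -> md (clog w - clog z) < e.
Proof.
move=> rz e e0; have mz : 0 < md z by apply: lt_le_trans rz (le_trans (ler_norm _) (le_re_md _)).
have c1 := continuous_comp (@md_continuous z) (continuous_ln mz).
have c3 : {for z, continuous (fun w : Cx R => im w / re w)}.
  apply: (@continuousM _ _ (im : Cx R -> R) (fun w => (re w)^-1)); first exact: im_continuous.
  by apply: continuousV; [rewrite gt_eqF|exact: re_continuous].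
have c2 := continuous_comp c3 (@continuous_atan R _).
have e2 : 0 < e / 2 by rewrite divr_gt0.
have /nbhs_cP[d1 d10 h1] := c1 _ (nbhsx_ballx _ _ e2).
have /nbhs_cP[d2 d20 h2] := c2 _ (nbhsx_ballx _ _ e2).
exists (Num.min d1 d2); first by rewrite lt_min d10.
move=> w; rewrite lt_min => /andP[/h1 w1 /h2 w2].
apply: le_lt_trans (md_le _) _; rewrite /clog !reimE.
by move: w1 w2; rewrite /ball /= distrC [X in _ -> X < _ -> _]distrC; lra.
Qed.

(** The derivative of the inverse function, from the expansion of [cexp] at the image
    point and the continuity of [clog]. *)
Lemma diff_clog z : 0 < re z -> differentiable clog z.
Proof.
move=> rz; have zK := clogK rz.
have z0 : z != 0 by rewrite -zK cexp_neq0.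
have c0 : 0 < md z by rewrite md_gt0.
apply: (@diff_c_intro _ _ _ z^-1) => e e0.
pose s := Num.min (md z / 2) (e * md z * md z / 2).
have s0 : 0 < s by rewrite lt_min !divr_gt0 // !mulr_gt0.
have [s1 s2] : s <= md z / 2 /\ s <= e * md z * md z / 2 by rewrite /s !ge_min !lexx orbT.
clearbody s.
have [d1 d10 h1] := cexp_diff_eps (clog z) s0.
have [d2 d20 h2] := clog_continuous rz d10.
exists (Num.min d2 (re z)); first by rewrite lt_min d20.
move=> h; rewrite lt_min => /andP[k1 k2].
have rzh : 0 < re (z + h).
  by have := le_re_md h; rewrite ler_norml reD; lra.
have kd : md (clog (z + h) - clog z) < d1 by apply: h2; rewrite addrC addKr.
have kE : clog (z + h) = clog z + (clog (z + h) - clog z) by rewrite [RHS]addrC subrK.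
have zhK := clogK rzh.
move: (clog (z + h) - clog z) kd kE => k kd kE.
have := h1 k kd; rewrite -kE zK zhK [z + h]addrC addrK => H.
have hk : md z * md k <= 2 * md h.
  have := mdDB h (h - z * k); rewrite (_ : h - (h - z * k) = z * k); last by ring.
  rewrite mdM; have : s * md k <= md z / 2 * md k by rewrite ler_wpM2r ?md_ge0.
  by lra.
rewrite (_ : k - z^-1 * h = - (z^-1 * (h - z * k))); last by field.
rewrite mdN mdM mdV ler_pdivrMl //; apply: le_trans H _.
have : s * md k <= e * md z * md z / 2 * md k by rewrite ler_wpM2r ?md_ge0.
have : e * md z / 2 * (md z * md k) <= e * md z / 2 * (2 * md h).
  by rewrite ler_wpM2l // divr_ge0 // mulr_ge0 // ltW.
lra.
Qed.

Lemma cos_period (k : int) y : cos (y - k%:~R * (pi *+ 2)) = cos y.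
Proof.
have pos n x : cos (x + n%:R * (pi *+ 2)) = cos x.
  by elim: n x => [|n IH] x; rewrite ?mul0r ?addr0 // -natr1 mulrDl mul1r addrA cosD2pi IH.
case: k => n; first by rewrite -(pos n (y - _)) subrK.
by rewrite NegzE mulrNz mulNr opprK pos.
Qed.

Lemma cos_eq1 y : cos y = 1 -> exists k : int, y = k%:~R * (pi *+ 2).
Proof.
move=> cy; pose k := Num.floor (y / (pi *+ 2)); exists k.
have p0 : 0 < pi *+ 2 :> R by rewrite pmulrn_lgt0 // pi_gt0.
pose r := y - k%:~R * (pi *+ 2).
have cr : cos r = 1 by rewrite /r cos_period.
have r0 : 0 <= r by rewrite /r subr_ge0 -ler_pdivlMr // floor_le.
have r1 : r < pi *+ 2.
  by rewrite /r ltrBlDl -{2}[pi *+ 2]mul1r -mulrDl -ltr_pdivrMr // -intrD1 floorD1_gt.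
suff : r = 0 by move=> /eqP; rewrite subr_eq0 => /eqP.
have pp := @pi_gt0 R.
have [rp|rp] := leP r pi.
  by apply: cos_inj; rewrite ?in_itv /= ?r0 ?lexx ?(ltW pp) // cr cos0.
have r2 : r <= pi * 2 by rewrite mulr_natr ltW.
have : pi *+ 2 - r = 0.
  apply: cos_inj; rewrite ?in_itv /= ?lexx ?(ltW pp) //.
    by rewrite -mulr_natr; lra.
  by rewrite -cosN opprB cos0 -[_ - _]/(r - pi *+ 2) -[pi *+ 2]mul1r -[1]/(1%:~R) cos_period.
lra.
Qed.

Lemma cexp_eq z w : cexp z = cexp w -> re z = re w /\ exists k : int, im z - im w = k%:~R * (pi *+ 2).
Proof.
move=> e; have E : cexp (z - w) = 1.
  by rewrite cexpD cexpN e divff // cexp_neq0.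
have r0 : re (z - w) = 0.
  by apply: expR_inj; rewrite -md_cexp E md1 expR0.
split; first by move: r0; rewrite !reimE => /eqP; rewrite subr_eq0 => /eqP.
have [k] : exists k : int, im (z - w) = k%:~R * (pi *+ 2).
  by apply: cos_eq1; have := congr1 re E; rewrite /cexp re_cx r0 expR0 mul1r.
by rewrite imD imN => ->; exists k.
Qed.

End ComplexExponential.

(** * The covering by exponentials *)

Section Projection.
Context {R : realType}.
Local Notation V := 'rV[Cx R]_2.
Implicit Types (z w : Cx R) (v u : V) (x y e t d : R) (U : set V).

(** The exponential of [kappa] times z has period 15 i. *)
Definition kappa : R := pi *+ 2 / 15.

Lemma kappa_gt0 : 0 < kappa.
Proof. by rewrite /kappa divr_gt0 // pmulrn_lgt0 // pi_gt0. Qed.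

Lemma kappa_neq0 : rc kappa != 0 :> Cx R.
Proof. by rewrite rc_eq0 gt_eqF // kappa_gt0. Qed.

Definition proj v : V := mk (cexp (rc kappa * c0 v)) (cexp (rc kappa * c1 v)).

(** The points where the quotients by the coordinates of [proj v] have positive real
    part; there [branch v] is a holomorphic inverse of [proj]. *)
Definition slit v : set V := [set z | 0 < re (c0 z / cexp (rc kappa * c0 v)) /\
  0 < re (c1 z / cexp (rc kappa * c1 v))].

Definition branch v (z : V) : V := mk (c0 v + clog (c0 z / cexp (rc kappa * c0 v)) / rc kappa)
  (c1 v + clog (c1 z / cexp (rc kappa * c1 v)) / rc kappa).

(** The angle by which the exponentials turn is less than a right angle, as 15 / 4 is a
    quarter of the period. *)
Definition box v : set V :=
  [set u | `|im (c0 u) - im (c0 v)| < (15 / 4) /\ `|im (c1 u) - im (c1 v)| < (15 / 4)].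

Lemma diff_scale (g : V -> Cx R) (a : Cx R) v : differentiable g v -> differentiable (fun u => a * g u) v.
Proof. by apply: dMul; exact: dCst. Qed.

Lemma diff_proj v : differentiable proj v.
Proof.
apply: diff_mk.
- by apply: (differentiable_comp (diff_scale (rc kappa) (diff_c0 v))); exact: diff_cexp.
- by apply: (differentiable_comp (diff_scale (rc kappa) (diff_c1 v))); exact: diff_cexp.
Qed.

Lemma diff_quot (g : V -> Cx R) (a : Cx R) v : differentiable g v -> differentiable (fun u => g u / a) v.
Proof. by move=> dg; apply: dMul dg _; exact: dCst. Qed.

Lemma diff_branch v (z : V) : slit v z -> differentiable (branch v) z.
Proof.
move=> [h0 h1]; apply: diff_mk; apply: dAdd; try exact: dCst.
- apply: diff_quot; have dq := diff_quot (cexp (rc kappa * c0 v)) (diff_c0 z).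
  exact: (differentiable_comp dq (diff_clog h0)).
- apply: diff_quot; have dq := diff_quot (cexp (rc kappa * c1 v)) (diff_c1 z).
  exact: (differentiable_comp dq (diff_clog h1)).
Qed.

Lemma open_near U : (forall v, U v -> exists2 d, 0 < d & forall u, vmd (u - v) < d -> U u) -> open U.
Proof. by move=> H; rewrite openE => v /H h; apply/nbhs_vP. Qed.

Lemma near_open U v : open U -> U v -> exists2 d, 0 < d & forall u, vmd (u - v) < d -> U u.
Proof. by rewrite openE => oU /oU/nbhs_vP. Qed.

Lemma re_pos_near (g : V -> Cx R) v : differentiable g v -> 0 < re (g v) ->
  exists2 d, 0 < d & forall u, vmd (u - v) < d -> 0 < re (g u).
Proof.
move=> dg g0; have [|d d0 hd] := @near_re _ g v 0 (re (g v) + 1) dg; first by rewrite g0 ltrDl ltr01.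
by exists d => // u /hd /andP[].
Qed.

Lemma slit_open v : open (slit v).
Proof.
apply: open_near => z [h0 h1]; apply: near_and.
- have dq := diff_quot (cexp (rc kappa * c0 v)) (diff_c0 z).
  exact: (re_pos_near dq h0).
- have dq := diff_quot (cexp (rc kappa * c1 v)) (diff_c1 z).
  exact: (re_pos_near dq h1).
Qed.

Lemma box_open v : open (box v).
Proof.
apply: open_near => u [h0 h1]; move: h0 h1; rewrite !ltr_norml => h0 h1; apply: near_and.
- have [|d d0 hd] := @near_im _ c0 u (im (c0 v) - (15 / 4)) (im (c0 v) + (15 / 4)) (diff_c0 u); first lra.
  by exists d => // w /hd; rewrite ltr_norml; lra.
- have [|d d0 hd] := @near_im _ c1 u (im (c1 v) - (15 / 4)) (im (c1 v) + (15 / 4)) (diff_c1 u); first lra.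
  by exists d => // w /hd; rewrite ltr_norml; lra.
Qed.

Lemma box_self v : box v v.
Proof. by rewrite /box /= !subrr normr0; split. Qed.

Lemma cexp_quot z w : cexp (rc kappa * z) / cexp (rc kappa * w) = cexp (rc kappa * (z - w)).
Proof. by rewrite mulrBr cexpD cexpN. Qed.

Lemma kappa_angle y : `|y| < (15 / 4) -> - (pi / 2) < kappa * y < pi / 2.
Proof.
move=> hy; have p0 := @pi_gt0 R; rewrite -ltr_norml normrM gtr0_norm ?kappa_gt0 //.
rewrite (_ : pi / 2 = kappa * (15 / 4)); first by rewrite ltr_pM2l // kappa_gt0.
by rewrite /kappa; field.
Qed.

Lemma re_cexp_pos z : `|im z| < (15 / 4) -> 0 < re (cexp (rc kappa * z)).
Proof.
move=> hz; rewrite /cexp re_cx mulr_gt0 ?expR_gt0 // cos_gt0_pihalf //.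
by have := kappa_angle hz; rewrite !reimE mul0r addr0.
Qed.

Lemma clog_cexp z : `|im z| < (15 / 4) -> clog (cexp (rc kappa * z)) / rc kappa = z.
Proof.
move=> hz; rewrite cexpK; first by rewrite mulrC mulKf // kappa_neq0.
by have := kappa_angle hz; rewrite !reimE mul0r addr0.
Qed.

Lemma cexp_clog z w : 0 < re (z / cexp (rc kappa * w)) ->
  cexp (rc kappa * (w + clog (z / cexp (rc kappa * w)) / rc kappa)) = z.
Proof.
move=> h; rewrite mulrDr [_ / rc kappa]mulrC mulVKf ?kappa_neq0 // cexpD clogK //.
by rewrite mulrC divfK // cexp_neq0.
Qed.

Lemma branchK v (z : V) : slit v z -> proj (branch v z) = z.
Proof.
move=> [h0 h1]; apply: vP.
- by rewrite /proj c0_mk /branch c0_mk cexp_clog.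
- by rewrite /proj c1_mk /branch c1_mk cexp_clog.
Qed.

Lemma proj_slit v u : box v u -> slit v (proj u).
Proof.
by move=> [h0 h1]; rewrite /slit /= /proj c0_mk c1_mk !cexp_quot; split; apply: re_cexp_pos; rewrite imD imN.
Qed.

Lemma projK v u : box v u -> branch v (proj u) = u.
Proof.
move=> [h0 h1]; apply: vP; rewrite /branch /proj ?c0_mk ?c1_mk cexp_quot clog_cexp ?imD ?imN //.
- by rewrite addrC subrK.
- by rewrite addrC subrK.
Qed.

Lemma proj_open U : open U -> open (proj @` U).
Proof.
move=> oU; apply: open_near => _ [v Uv <-].
have sv := proj_slit (box_self v); have vK := projK (box_self v).
have [d1 d10 h1] := near_open (@slit_open v) sv.
have /differentiable_continuous cb := diff_branch sv.
have [|d2 d20 h2] := proj1 (nbhs_vP (proj v) (branch v @^-1` U)).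
  by apply: cb; rewrite vK; exact: open_nbhs_nbhs.
exists (Num.min d1 d2); first by rewrite lt_min d10.
move=> z; rewrite lt_min => /andP[/h1 sz /h2 bz].
by exists (branch v z) => //; exact: branchK.
Qed.

(** Translation by the lattice of periods. *)
Definition shift v (i j : int) : V :=
  v + mk (ii * rc (i%:~R * 15)) (ii * rc (j%:~R * 15)).

Lemma im_shift v i j :
  im (c0 (shift v i j)) = im (c0 v) + i%:~R * 15 /\ im (c1 (shift v i j)) = im (c1 v) + j%:~R * 15.
Proof. by rewrite /shift c0D c1D c0_mk c1_mk !reimE; split; ring. Qed.

Lemma shift0 v : shift v 0 0 = v.
Proof. by apply: vP; rewrite /shift ?c0D ?c1D ?c0_mk ?c1_mk !mul0r rc0 mulr0 addr0. Qed.

Lemma cexp_period (i : int) z : cexp (rc kappa * (z + ii * rc (i%:~R * 15))) = cexp (rc kappa * z).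
Proof.
rewrite mulrDr cexpD; set w := rc kappa * (ii * _).
have rw : re w = 0 by rewrite /w !reimE; ring.
have iw : im w = i%:~R * (pi *+ 2) by rewrite /w !reimE /kappa; field.
have c1 : cos (im w) = 1 by rewrite iw -(cos_period i) subrr cos0.
have s1 : sin (im w) = 0.
  by apply/eqP; rewrite -sqrf_eq0 sin2cos2 c1 expr1n subrr.
rewrite (_ : cexp w = 1) ?mulr1 //.
by apply: cxP; rewrite /cexp rw c1 s1 expR0 !reimE; ring.
Qed.

Lemma proj_shift v i j : proj (shift v i j) = proj v.
Proof. by rewrite /proj /shift c0D c1D c0_mk c1_mk !cexp_period. Qed.

Lemma cexp_kappa_eq z w : cexp (rc kappa * z) = cexp (rc kappa * w) ->
  exists i : int, z = w + ii * rc (i%:~R * 15).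
Proof.
move=> /cexp_eq; rewrite !reimE !mul0r !subr0 !addr0 => -[e1 [i e2]]; exists i.
have k0 := kappa_gt0; apply: cxP; rewrite !reimE.
- by rewrite mul0r mulr0 subrr addr0; apply: (mulfI (x := kappa)) e1; rewrite gt_eqF.
- have -> : im z = im w + i%:~R * 15; last by ring.
  apply: (mulfI (x := kappa)); first by rewrite gt_eqF.
  rewrite mulrDr (_ : kappa * (i%:~R * 15) = i%:~R * (pi *+ 2)); first by rewrite -e2 addrC subrK.
  by rewrite /kappa; field.
Qed.

Lemma proj_eq u v : proj u = proj v -> exists i j, u = shift v i j.
Proof.
move=> e; have [i ei] : exists i : int, c0 u = c0 v + ii * rc (i%:~R * 15).
  by apply: cexp_kappa_eq; have := congr1 c0 e; rewrite /proj !c0_mk.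
have [j ej] : exists j : int, c1 u = c1 v + ii * rc (j%:~R * 15).
  by apply: cexp_kappa_eq; have := congr1 c1 e; rewrite /proj !c1_mk.
by exists i, j; apply: vP; rewrite /shift ?c0D ?c1D ?c0_mk ?c1_mk.
Qed.

End Projection.

(** * The hexagon and the pinwheel *)

Section Hexagon.
Context {R : realType}.
Implicit Types (x y s t p q : R).

(** The convex hull, without its boundary, of the points (-11, 8), (-2, 13), (8, 3),
    (13, -11), (3, -11), (-11, -2), which form two orbits of the linear map
    (x, y) |-> (- x - y, x) of order three.  This map preserves the lattice. *)
Definition hexagon x y : Prop := [/\ -11 < x, -11 < y, x + y < 11 &
  [/\ 9 * y - 5 * x < 127, - (9 * x) - 14 * y < 127 & 14 * x + 5 * y < 127]].

(** The thin triangle with apex (-11, c) whose base is on the line x = 1 beyond the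
    origin; the vertices (-11, 8) and (-11, -2) occur in [fork], and the other four
    triangles of [pinwheel] are rotated copies. *)
Definition spike (c x y : R) : Prop := [/\ -11 < x, x < 1 & `|11 * y + c * x| < 11 + x].
Definition fork x y : Prop := spike 8 x y \/ spike (-2) x y.
Definition pinwheel x y : Prop := [\/ fork x y, fork y (- x - y) | fork (- x - y) x].

Lemma hexagon_rot x y : hexagon x y <-> hexagon y (- x - y).
Proof. by split => -[h1 h2 h3 [h4 h5 h6]]; (split; [lra|lra|lra|split; lra]). Qed.

Lemma pinwheel_rot x y : pinwheel x y <-> pinwheel y (- x - y).
Proof.
have -> : pinwheel y (- x - y) = [\/ fork y (- x - y), fork (- x - y) x | fork x y].
  rewrite /pinwheel; have -> : - y - (- x - y) = x by ring.
  by [].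
by split => -[h|h|h]; [constructor 3|constructor 1|constructor 2|constructor 2|constructor 3|constructor 1].
Qed.

Lemma fork_hexagon x y : fork x y -> hexagon x y.
Proof.
by move=> [] [h1 h2]; rewrite ltr_norml => h3; (split; [lra|lra|lra|split; lra]).
Qed.

Lemma pinwheel_hexagon x y : pinwheel x y -> hexagon x y.
Proof.
case=> /fork_hexagon // h; apply/hexagon_rot => //; apply/hexagon_rot.
by have -> : - y - (- x - y) = x by ring.
Qed.

Lemma spike_near c x y : `|c| <= 10 -> spike c x y ->
  exists2 d, 0 < d & forall x' y', `|x' - x| < d -> `|y' - y| < d -> spike c x' y'.
Proof.
move=> hc [h1 h2 h3].
pose e := 11 + x - `|11 * y + c * x|.
exists (Num.min (Num.min (x + 11) (1 - x)) (e / 60)).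
  by rewrite !lt_min divr_gt0 // /e; lra.
move=> x' y'; rewrite !lt_min !ltr_pdivlMr // => /andP[/andP[a1 a2] a3] /andP[_ b3].
have ac : `|c * (x' - x)| <= 10 * `|x' - x| by rewrite normrM ler_wpM2r.
have bc : `|11 * (y' - y)| = 11 * `|y' - y| by rewrite normrM ger0_norm.
have E : 11 * y' + c * x' = 11 * y + c * x + 11 * (y' - y) + c * (x' - x) by ring.
have n1 := ler_normD (11 * y + c * x + 11 * (y' - y)) (c * (x' - x)).
have n2 := ler_normD (11 * y + c * x) (11 * (y' - y)).
have lx := ler_norm (x' - x); have lx' := ler_norm (x - x'); rewrite distrC in lx'.
split; [lra|lra|rewrite E /e in a3 b3 *; lra].
Qed.

Lemma pinwheel_near x y : pinwheel x y ->
  exists2 d, 0 < d & forall x' y', `|x' - x| < d -> `|y' - y| < d -> pinwheel x' y'.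
Proof.
have c1 : `|8| <= 10 :> R by rewrite ger0_norm; lra.
have c2 : `|-2| <= 10 :> R by rewrite ler0_norm; lra.
have forkO a b : fork a b ->
    exists2 d, 0 < d & forall a' b', `|a' - a| < d -> `|b' - b| < d -> fork a' b'.
  move=> [] /spike_near => [/(_ c1)|/(_ c2)] [d d0 hd]; exists d => // a' b' ? ?; [left|right]; exact: hd.
case=> /forkO[d d0 hd]; exists (d / 2); rewrite ?divr_gt0 // => x' y'; rewrite !ltr_norml => hx hy.
- by constructor 1; apply: hd; rewrite ltr_norml; lra.
- by constructor 2; apply: hd; rewrite ltr_norml; lra.
- by constructor 3; apply: hd; rewrite ltr_norml; lra.
Qed.

Lemma fork_star t x y : 0 <= t <= 1 -> fork x y -> fork (t * x) (t * y).
Proof.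
move=> /andP[t0 t1] [] [h1 h2 h3]; [left|right].
all: split; [nra|nra|rewrite !(mulrCA _ t) -mulrDr normrM ger0_norm //].
all: have := ler_wpM2l t0 (ltW h3); have [->|tn0] := eqVneq t 0; first by rewrite !mul0r; lra.
all: have tp : 0 < t by rewrite lt_neqAle eq_sym tn0.
all: by rewrite -(ltr_pM2l tp) in h3; lra.
Qed.

Lemma pinwheel_star t x y : 0 <= t <= 1 -> pinwheel x y -> pinwheel (t * x) (t * y).
Proof.
move=> ht; have E : - (t * x) - t * y = t * (- x - y) by ring.
by rewrite /pinwheel E => -[] /(fork_star ht); [constructor 1|constructor 2|constructor 3].
Qed.

Lemma pinwheel0 : pinwheel 0 0.
Proof. by constructor 1; left; split; rewrite ?mulr0 ?addr0 ?normr0 //; lra. Qed.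

Lemma halfplane p q X Y c : 0 <= p -> 0 <= q -> p + q < 1 -> 0 < c -> X < c -> Y < c ->
  p * X + q * Y < c.
Proof.
move=> p0 q0 pq c0 Xc Yc; have := ler_wpM2l p0 (ltW Xc); have := ler_wpM2l q0 (ltW Yc).
have : (p + q) * c < 1 * c by rewrite ltr_pM2r.
lra.
Qed.

Lemma hexagon_convex p q a1 a2 b1 b2 : 0 <= p -> 0 <= q -> p + q < 1 ->
  hexagon a1 a2 -> hexagon b1 b2 -> hexagon (p * a1 + q * b1) (p * a2 + q * b2).
Proof.
move=> p0 q0 pq [h1 h2 h3 [h4 h5 h6]] [k1 k2 k3 [k4 k5 k6]].
have H X Y c := @halfplane p q X Y c p0 q0 pq.
have l1 : p * - a1 + q * - b1 < 11 by apply: H; [lra|clear -h1; lra|clear -k1; lra].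
have l2 : p * - a2 + q * - b2 < 11 by apply: H; [lra|clear -h2; lra|clear -k2; lra].
have l3 : p * (a1 + a2) + q * (b1 + b2) < 11 by apply: H; [lra|clear -h3; lra|clear -k3; lra].
have l4 : p * (9 * a2 - 5 * a1) + q * (9 * b2 - 5 * b1) < 127 by apply: H; [lra|clear -h4; lra|clear -k4; lra].
have l5 : p * (- (9 * a1) - 14 * a2) + q * (- (9 * b1) - 14 * b2) < 127 by apply: H; [lra|clear -h5; lra|clear -k5; lra].
have l6 : p * (14 * a1 + 5 * a2) + q * (14 * b1 + 5 * b2) < 127 by apply: H; [lra|clear -h6; lra|clear -k6; lra].
by split; [clear -l1; lra|clear -l2; lra|clear -l3; lra|split; [clear -l4; lra|clear -l5; lra|clear -l6; lra]].
Qed.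

Lemma spike_axis c t : 0 <= t -> t < 1 -> spike c (t * -11) (t * c).
Proof.
move=> t0 t1; split; [lra|lra|].
have -> : 11 * (t * c) + c * (t * -11) = 0 by ring.
by rewrite normr0; lra.
Qed.

Definition vertex x y := forall t, 0 <= t -> t < 1 -> pinwheel (t * x) (t * y).

Lemma vertex_rot x y : vertex y (- x - y) -> vertex x y.
Proof.
move=> h t t0 t1; apply/pinwheel_rot.
rewrite (_ : - (t * x) - t * y = t * (- x - y)); last by ring.
exact: h.
Qed.

Lemma vertex_fork c : c = 8 \/ c = -2 -> vertex (-11) c.
Proof.
by move=> hc t t0 t1; constructor 1; case: hc => ->; [left|right]; exact: spike_axis.
Qed.

(** A point of the hexagon in the cone over a side is a combination of the two end
    points with positive coefficients of sum less than 1.  The end points themselves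
    are not in the pinwheel, but they may be shrunk by the factor [s] below. *)
Lemma sector a1 a2 b1 b2 x y : vertex a1 a2 -> vertex b1 b2 -> a1 * b2 - a2 * b1 < 0 ->
  x * b2 - y * b1 <= 0 -> 0 <= x * a2 - y * a1 ->
  a1 * b2 - a2 * b1 < x * (b2 - a2) - y * (b1 - a1) -> in_triangle pinwheel x y.
Proof.
move=> va vb D0 h1 h2 h3; set D := a1 * b2 - a2 * b1 in D0 h3 *.
have Dn : D != 0 by rewrite lt_eqF.
pose al := (x * b2 - y * b1) / D; pose be := (y * a1 - x * a2) / D.
have al0 : 0 <= al by rewrite /al ler_ndivlMr // mul0r.
have be0 : 0 <= be by rewrite /be ler_ndivlMr // mul0r; lra.
have ab1 : al + be < 1.
  by rewrite /al /be -mulrDl ltr_ndivrMr // mul1r; apply: lt_le_trans h3 _; lra.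
(* Any factor strictly between [al + be] and 1 would do. *)
pose s := (1 + al + be) / 2.
have s0 : 0 < s by rewrite /s; lra.
have s1 : s < 1 by rewrite /s; lra.
have sn : s != 0 by rewrite gt_eqF.
exists (s * a1), (s * a2), (s * b1), (s * b2), (al / s), (be / s); split.
- by apply: va => //; exact: ltW.
- by apply: vb => //; exact: ltW.
- have -> : s * a1 * (s * b2) - s * a2 * (s * b1) = s * s * D by rewrite /D; ring.
  by rewrite mulf_neq0 // mulf_neq0.
- split; try exact: divr_ge0 _ (ltW s0).
  + by rewrite -mulrDl ltr_pdivrMr // mul1r /s; lra.
  + by rewrite /al /be /D; field; rewrite sn Dn.
  + by rewrite /al /be /D; field; rewrite sn Dn.
Qed.

(** The cross products with the six vertices, in cyclic order, cannot all have the same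
    sign; a change of sign locates the cone that contains the point. *)
Lemma hexagon_sector x y : hexagon x y -> in_triangle pinwheel x y.
Proof.
move=> [h1 h2 h3 [h4 h5 h6]].
have V1A : vertex (-11) 8 by apply: vertex_fork; left.
have V1B : vertex (-11) (-2) by apply: vertex_fork; right.
have V3A : vertex 8 3.
  by apply: vertex_rot; apply: vertex_rot; rewrite (_ : - 8 - 3 = -11) 1?(_ : - 3 - -11 = 8) //; lra.
have V3B : vertex (-2) 13.
  by apply: vertex_rot; apply: vertex_rot; rewrite (_ : - (-2) - 13 = -11) 1?(_ : - 13 - -11 = -2) //; lra.
have V2A : vertex 3 (-11).
  by apply: vertex_rot; rewrite (_ : - 3 - -11 = 8) //; lra.
have V2B : vertex 13 (-11).
  by apply: vertex_rot; rewrite (_ : - 13 - -11 = -2) //; lra.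
pose g a b := x * b - y * a.
have s1 : 0 <= g (-11) 8 -> g (-2) 13 <= 0 -> in_triangle pinwheel x y.
  by move=> i1 i2; apply: (sector V1A V3B) => //; lra.
have s2 : 0 <= g (-2) 13 -> g 8 3 <= 0 -> in_triangle pinwheel x y.
  by move=> i1 i2; apply: (sector V3B V3A) => //; lra.
have s3 : 0 <= g 8 3 -> g 13 (-11) <= 0 -> in_triangle pinwheel x y.
  by move=> i1 i2; apply: (sector V3A V2B) => //; lra.
have s4 : 0 <= g 13 (-11) -> g 3 (-11) <= 0 -> in_triangle pinwheel x y.
  by move=> i1 i2; apply: (sector V2B V2A) => //; lra.
have s5 : 0 <= g 3 (-11) -> g (-11) (-2) <= 0 -> in_triangle pinwheel x y.
  by move=> i1 i2; apply: (sector V2A V1B) => //; lra.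
have s6 : 0 <= g (-11) (-2) -> g (-11) 8 <= 0 -> in_triangle pinwheel x y.
  by move=> i1 i2; apply: (sector V1B V1A) => //; lra.
have [i1|i1] := lerP 0 (g (-11) 8).
  have [i2|i2] := lerP (g (-2) 13) 0; first exact: s1.
  have [i3|i3] := lerP (g 8 3) 0; first exact: s2 (ltW _) _.
  have [i4|i4] := lerP (g 13 (-11)) 0; first exact: s3 (ltW _) _.
  have [i5|i5] := lerP (g 3 (-11)) 0; first exact: s4 (ltW _) _.
  have [i6|i6] := lerP (g (-11) (-2)) 0; first exact: s5 (ltW _) _.
  by exfalso; rewrite /g in i1 i2 i3 i4 i5 i6; lra.
have [i2|i2] := lerP 0 (g (-11) (-2)); first exact: s6 _ (ltW _).
have [i3|i3] := lerP 0 (g 3 (-11)); first exact: s5 _ (ltW _).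
have [i4|i4] := lerP 0 (g 13 (-11)); first exact: s4 _ (ltW _).
have [i5|i5] := lerP 0 (g 8 3); first exact: s3 _ (ltW _).
have [i6|i6] := lerP 0 (g (-2) 13); first exact: s2 _ (ltW _).
by exfalso; rewrite /g in i1 i2 i3 i4 i5 i6; lra.
Qed.

Lemma hexagon_triangle x y : hexagon x y <-> in_triangle pinwheel x y.
Proof.
split; first exact: hexagon_sector.
move=> [a1 [a2 [b1 [b2 [p [q [Oa Ob _ [p0 q0 pq -> ->]]]]]]]].
by apply: hexagon_convex => //; exact: pinwheel_hexagon.
Qed.

Lemma int_small (i : int) : `|i%:~R| < 2 :> R -> (`|i| < 2).
Proof. by rewrite -intr_norm -[2]/(2%:~R) ltr_int. Qed.

Lemma int_small3 (i : int) : `|i| < 2 -> [\/ i = -1, i = 0 | i = 1].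
Proof.
case: i => [[|[|n]]|[|n]] //= _; [constructor 2|constructor 3|constructor 1]; by [].
Qed.

Definition neighbours : seq (int * int) :=
  [:: (0, 0); (1, 0); (0, 1); (-1, 0); (0, -1); (1, -1); (-1, 1)].

(** The hexagon has width less than 30 in the directions x, y and x + y, so that the
    coefficients of the lattice vector and their sum are at most 1 in absolute value. *)
Lemma hexagon_translate x y (i j : int) : hexagon x y -> hexagon (x + i%:~R * 15) (y + j%:~R * 15) ->
  (i, j) \in neighbours.
Proof.
move=> [h1 h2 h3 [h4 h5 h6]] [k1 k2 k3 [k4 k5 k6]].
have hi : `|i| < 2 by apply: int_small; rewrite ltr_norml; lra.
have hj : `|j| < 2 by apply: int_small; rewrite ltr_norml; lra.
have : `|i + j| < 2 by apply: int_small; rewrite ltr_norml intrD; lra.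
by case: (int_small3 hi) => ->; case: (int_small3 hj) => ->.
Qed.

Lemma hexagon_rot2 x y : hexagon x y <-> hexagon (- x - y) x.
Proof. by split => -[h1 h2 h3 [h4 h5 h6]]; (split; [lra|lra|lra|split; lra]). Qed.

Lemma pinwheel_rot2 x y : pinwheel x y <-> pinwheel (- x - y) x.
Proof.
split=> [/pinwheel_rot/pinwheel_rot|/pinwheel_rot].
- by rewrite (_ : - y - (- x - y) = x); last by ring.
- by rewrite (_ : - (- x - y) - x = y); last by ring.
Qed.

(** Of the six neighbours, only one translate of the hexagon meets the triangle. *)
Lemma spike_translateA x y (i j : int) : spike 8 x y -> hexagon (x + i%:~R * 15) (y + j%:~R * 15) ->
  (i, j) \in [:: (0, 0); (1, -1)] /\ (pinwheel (x + i%:~R * 15) (y + j%:~R * 15) -> (i, j) = (0, 0)).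
Proof.
move=> f k; have /hexagon_translate := fork_hexagon (or_introl f) => /(_ _ _ k).
move: f => [h1 h2]; rewrite ltr_norml => h3; move: k => [k1 k2 k3 [k4 k5 k6]].
rewrite !inE => /or4P[/eqP[i0 j0]|/eqP[i0 j0]|/eqP[i0 j0]|/or4P[/eqP[i0 j0]|/eqP[i0 j0]|/eqP[i0 j0]|/eqP[i0 j0]]].
all: rewrite i0 j0; split => //.
all: rewrite i0 j0 ?rmorphN1 ?rmorph1 ?rmorph0 in k1 k2 k3 k4 k5 k6 *; try (exfalso; lra).
all: by case=> [] [] [? ?]; rewrite ltr_norml => ?; exfalso; lra.
Qed.

Lemma spike_translateB x y (i j : int) : spike (-2) x y -> hexagon (x + i%:~R * 15) (y + j%:~R * 15) ->
  (i, j) \in [:: (0, 0); (1, 0)] /\ (pinwheel (x + i%:~R * 15) (y + j%:~R * 15) -> (i, j) = (0, 0)).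
Proof.
move=> f k; have /hexagon_translate := fork_hexagon (or_intror f) => /(_ _ _ k).
move: f => [h1 h2]; rewrite ltr_norml => h3; move: k => [k1 k2 k3 [k4 k5 k6]].
rewrite !inE => /or4P[/eqP[i0 j0]|/eqP[i0 j0]|/eqP[i0 j0]|/or4P[/eqP[i0 j0]|/eqP[i0 j0]|/eqP[i0 j0]|/eqP[i0 j0]]].
all: rewrite i0 j0; split => //.
all: rewrite i0 j0 ?rmorphN1 ?rmorph1 ?rmorph0 in k1 k2 k3 k4 k5 k6 *; try (exfalso; lra).
all: by case=> [] [] [? ?]; rewrite ltr_norml => ?; exfalso; lra.
Qed.

(** A point of an arm has a single further translate in the hexagon, and no
    further translate in the pinwheel. *)
Lemma fork_translate x y : fork x y -> exists l : int * int,
  forall i j : int, hexagon (x + i%:~R * 15) (y + j%:~R * 15) -> (i, j) \in [:: (0, 0); l] /\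
    (pinwheel (x + i%:~R * 15) (y + j%:~R * 15) -> (i, j) = (0, 0)).
Proof.
by move=> [] f; [exists (1, -1)|exists (1, 0)] => i j; [exact: spike_translateA|exact: spike_translateB].
Qed.

Lemma rot_shift x y (i j : int) : - (x + i%:~R * 15) - (y + j%:~R * 15) =
  (- x - y) + (- i - j)%:~R * 15.
Proof. by rewrite intrB mulrNz; ring. Qed.

Lemma pinwheel_translate x y : pinwheel x y -> exists l : int * int,
  forall i j : int, hexagon (x + i%:~R * 15) (y + j%:~R * 15) -> ((i, j) = (0, 0) \/ (i, j) = l) /\
    (pinwheel (x + i%:~R * 15) (y + j%:~R * 15) -> (i, j) = (0, 0)).
Proof.
have two (a b l : int * int) : a \in [:: b; l] -> a = b \/ a = l.
  by rewrite !inE => /orP[] /eqP; [left|right].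
case=> /fork_translate [l hl].
- by exists l => i j /hl [/two].
- exists (- l.1 - l.2, l.1) => i j /hexagon_rot; rewrite rot_shift => /hl [/two h1 h2]; split.
    case: h1 => [[j0 i0]|e]; [left; congr (_, _); lia|right].
    by rewrite -e /=; congr (_, _); lia.
  by move=> /pinwheel_rot; rewrite rot_shift => /h2 [j0 i0]; congr (_, _); lia.
- exists (l.2, - l.1 - l.2) => i j /hexagon_rot2; rewrite rot_shift => /hl [/two h1 h2]; split.
    case: h1 => [[j0 i0]|e]; [left; congr (_, _); lia|right].
    by rewrite -e /=; congr (_, _); lia.
  by move=> /pinwheel_rot2; rewrite rot_shift => /h2 [j0 i0]; congr (_, _); lia.
Qed.

End Hexagon.

(** * Open subsets of C^2 as manifolds *)

Section OpenSubset.
Context {R : realType}.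
Local Notation V := 'rV[Cx R]_2.
Context (U : set V) (oU : open U) (u0 : U).

Definition into (v : V) : U := insubd u0 v.

Lemma into_val (x : U) : into (val x) = x.
Proof. exact: valKd. Qed.

Lemma val_into v : U v -> val (into v) = v.
Proof. by move=> Uv; apply: insubdK; exact: mem_set. Qed.

Lemma val_in (x : U) : U (val x).
Proof. exact: set_valP. Qed.

Lemma nbhs_sub (x : U) (A : set U) :
  nbhs x A <-> exists2 d, 0 < d & forall y : U, vmd (val y - val x) < d -> A y.
Proof.
split.
- rewrite nbhsE => -[_ [[Q oQ <-] /= Qx] QA].
  have [d d0 hd] := near_open oQ Qx; exists d => // y /hd; exact: QA.
- move=> [d d0 hd]; have B : nbhs (val x) [set v | vmd (v - val x) < d].
    by apply/nbhs_vP; exists d.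
  have H : nbhs x (val @^-1` [set v | vmd (v - val x) < d]).
    exact: (@initial_continuous _ _ (set_val : U -> V) x _ B).
  by apply: filterS H => y; exact: hd.
Qed.

Lemma val_continuous : continuous (val : U -> V).
Proof.
move=> x A /nbhs_vP[d d0 hd]; apply/nbhs_sub; exists d => // y; exact: hd.
Qed.

Lemma into_continuous v : U v -> {for v, continuous into}.
Proof.
move=> Uv A /nbhs_sub[d d0 hd]; have [d2 d20 hd2] := near_open oU Uv.
apply/nbhs_vP; exists (Num.min d d2); first by rewrite lt_min d0.
move=> w; rewrite lt_min => /andP[h1 /hd2 Uw]; apply: hd.
by rewrite !val_into.
Qed.

Lemma into_within A : A `<=` U -> {within A, continuous into}.
Proof.
by move=> AU; apply: continuous_in_subspaceT => v /set_mem /AU; exact: into_continuous.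
Qed.

(** The inclusion is a global chart. *)
Definition open_manifold : charted V :=
  @Charted R V (set_type U) [set @Chart R V (set_type U) setT set_val into].

Lemma sub_hausdorff : hausdorff_space (set_type U).
Proof.
move=> p q pq; apply: val_inj; apply: (@norm_hausdorff _ V) => A B Ap Bq.
have [] := pq (val @^-1` A) (val @^-1` B).
- exact: val_continuous.
- exact: val_continuous.
- by move=> y [? ?]; exists (val y).
Qed.

Lemma rat_dense (z : Cx R) (e : R) : 0 < e -> exists a b : rat, md (cx (ratr a) (ratr b) - z) < e.
Proof.
move=> e0; have [a] := @rat_in_itvoo R (re z) (re z + e / 2) ltac:(by lra).
have [b] := @rat_in_itvoo R (im z) (im z + e / 2) ltac:(by lra).
rewrite !in_itv /= => hb ha; exists a, b; apply: le_lt_trans (md_le _) _; rewrite !reimE.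
by rewrite !ger0_norm; lra.
Qed.

(** A basis is given by the traces of the balls with rational centres and radii of the
    form 1 / (n + 1). *)
Lemma sub_second_countable : @second_countable (set_type U).
Proof.
pose W (t : (rat * rat) * (rat * rat) * nat) : set U :=
  [set x | vmd (val x - mk (cx (ratr t.1.1.1) (ratr t.1.1.2)) (cx (ratr t.1.2.1) (ratr t.1.2.2))) < t.2.+1%:R^-1].
exists (range W).
  exact: sub_countable (card_image_le _ _) (countableP _).
split.
- move=> _ [t _ <-]; exists [set v | vmd (v - mk (cx (ratr t.1.1.1) (ratr t.1.1.2)) (cx (ratr t.1.2.1) (ratr t.1.2.2))) < t.2.+1%:R^-1] => //.
  apply: open_near => v /=; set q := mk _ _; set e := _^-1 => h.
  exists (e - vmd (v - q)); first by rewrite subr_gt0.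
  move=> u hu; have := vmdD (u - v) (v - q); rewrite subrKA; lra.
- move=> x A /nbhs_sub[d d0 hd].
  have [n hn] : exists n : nat, n.+1%:R^-1 < d / 2.
    have d2 : 0 < d / 2 by rewrite divr_gt0.
    by exists (Num.truncn (d / 2)^-1); rewrite invf_plt ?posrE ?ltr0Sn // truncnS_gt.
  have n0 : 0 < n.+1%:R^-1 :> R by rewrite invr_gt0 ltr0Sn.
  have [a [b h1]] := rat_dense (c0 (val x)) n0.
  have [a' [b' h2]] := rat_dense (c1 (val x)) n0.
  pose q : V := mk (cx (ratr a) (ratr b)) (cx (ratr a') (ratr b')).
  have hq : vmd (q - val x) < n.+1%:R^-1.
    by rewrite vmd_lt !c0D !c1D !c0N !c1N c0_mk c1_mk h1 h2.
  exists (W ((a, b), (a', b'), n)); last first.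
    move=> y /= hy; apply: hd; have hy' : vmd (val y - q) < n.+1%:R^-1 := hy.
    have := vmdD (val y - q) (q - val x); rewrite addrA subrK.
    by move: hq hy' hn; move: (n.+1%:R^-1) => e; lra.
  split; first by exists ((a, b), (a', b'), n).
  by rewrite /W /= vmdB.
Qed.

Lemma eqV_differentiable (f g : V -> V) v :
  (exists2 d, 0 < d & forall u, vmd (u - v) < d -> f u = g u) ->
  differentiable g v -> differentiable f v.
Proof.
move=> [d d0 fg] dg.
have -> : f = fun u => mk (c0 (f u)) (c1 (f u)).
  by apply/funext => u; apply: vP; rewrite ?c0_mk ?c1_mk.
apply: diff_mk.
- apply: (@eq_differentiable _ _ (fun u => c0 (g u))); first by exists d => // u /fg ->.
  exact: (differentiable_comp dg (diff_c0 _)).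
- apply: (@eq_differentiable _ _ (fun u => c1 (g u))); first by exists d => // u /fg ->.
  exact: (differentiable_comp dg (diff_c1 _)).
Qed.

Lemma diff_val_into (g : V -> V) v : differentiable g v -> U (g v) ->
  differentiable (val \o into \o g) v.
Proof.
move=> dg Ug; apply: (eqV_differentiable (g := g)) => //.
have [d d0 hd] := near_open oU Ug.
have /nbhs_vP[d' d'0 hd'] : nbhs v (g @^-1` U).
  by apply: (differentiable_continuous dg); exact: open_nbhs_nbhs.
by exists d' => // u /hd' Uu; rewrite /= val_into.
Qed.

Lemma open_manifoldP : complex_manifold open_manifold.
Proof.
have vU : set_val @` [set: U] = U.
  by apply/seteqP; split=> [_ [x _ <-]|v Uv]; [exact: val_in|exists (into v); rewrite ?set_valE ?val_into].
split.
- exact: sub_hausdorff.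
- exact: sub_second_countable.
- move=> c ->; split => /=.
  + exact: openT.
  + by rewrite vU.
  + by move=> x _; exact: val_continuous.
  + by move=> _ [x _ <-]; apply: into_continuous; exact: val_in.
  + by move=> x _; exact: into_val.
- by move=> x; exists (@Chart R V (set_type U) setT set_val into).
- move=> c d -> -> x _ _ /=.
  apply: (@diff_val_into id (val x)); last exact: val_in.
  exact: (@ex_diff _ _ _ _ _ id).
Qed.

(** Holomorphy on [open_manifold] in the coordinates of [V]. *)
Lemma holo_funP (F : open_manifold -> Cline R) : holo_fun F <-> holoV U (F \o into).
Proof.
split.
- move=> hF v Uv; have [_ /(_ _ _ erefl erefl I I)] := hF (into v) I.
  by rewrite /= set_valE val_into.
- move=> hF x _; split.
    have -> : F = (F \o into) \o val by apply/funext => y; rewrite /= into_val.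
    apply: continuous_comp; first exact: val_continuous.
    by apply: differentiable_continuous; apply: hF; exact: val_in.
  by move=> c d -> -> _ _; apply: hF; exact: val_in.
Qed.

End OpenSubset.

(** * Tubes as Riemann domains *)

Section StarConnected.
Context {R : realType}.
Local Notation V := 'rV[Cx R]_2.

Lemma line_continuous (v : V) : continuous (fun t : R => rc t *: v).
Proof.
move=> t A /nbhs_vP[d d0 hd].
have k0 : 0 < vmd v + 1 by have := vmd_ge0 v; lra.
apply/nbhs_ballP; exists (d / (vmd v + 1)); first by rewrite /= divr_gt0.
move=> s; rewrite /ball /= distrC ltr_pdivlMr // => hs; apply: hd.
rewrite -scalerBl -rcB vmdZ md_rc; apply: le_lt_trans hs.
by rewrite ler_wpM2l // lerDl ler01.
Qed.

(** The tube is the union of the segments that join 0 to its points. *)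
Lemma star_tube_connected (E : R -> R -> Prop) : star E -> E 0 0 -> connected (tube E).
Proof.
move=> sE E0.
have -> : tube E = \bigcup_(v in tube E) ((fun t : R => rc t *: v) @` `[0, 1]).
  apply/seteqP; split=> [v Ev|_ [v Ev [t ht <-]]].
    by exists v => //; exists 1; rewrite ?rc1 ?scale1r //= in_itv /= lexx ler01.
  move: ht; rewrite /= in_itv /= => ht.
  by rewrite /tube /= !cE !reimE !mul0r !addr0; exact: sE.
apply: bigcup_connected.
  exists 0 => v Ev; exists 0; rewrite ?rc0 ?scale0r //= in_itv /= lexx ler01 //.
move=> v Ev; apply: connected_continuous_connected; first exact: segment_connected.
by apply: continuous_subspaceT; exact: line_continuous.
Qed.

End StarConnected.

Section TubeDomain.
Context {R : realType} (E : R -> R -> Prop).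
Hypotheses (oE : bopen E) (sE : star E) (E0 : E 0 0).
Local Notation V := 'rV[Cx R]_2.

Lemma tube_is_open : open (tube E).
Proof. by apply: open_near => v; exact: tube_open. Qed.

Lemma tube_zero : 0 \in tube E.
Proof. by apply: mem_set; rewrite /tube /= !cE !reimE. Qed.

Definition tube_origin : tube E := SigSub tube_zero.
Definition tube_space : charted V := open_manifold tube_origin.
Definition tube_proj (x : tube_space) : Cspace R 2 := proj (val x).
Local Notation into := (into tube_origin).

Lemma tube_space_connected : connected [set: tube_space].
Proof.
have -> : [set: tube_space] = into @` tube E.
  by apply/seteqP; split=> // x _; exists (val x); [exact: val_in|exact: into_val].
apply: connected_continuous_connected; first exact: star_tube_connected.
exact: (@into_within _ _ tube_is_open).
Qed.

(** On a box the inverse is [branch], by [projK] and [branchK]. *)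
Lemma proj_locally_biholomorphic : locally_biholomorphic tube_proj.
Proof.
move=> x; exists (val @^-1` box (val x)), (into \o branch (val x)).
have pI : tube_proj @` (val @^-1` box (val x)) = proj @` (box (val x) `&` tube E).
  apply/seteqP; split=> [_ [y hy <-]|_ [v [bv Ev] <-]].
    by exists (val y) => //; split => //; exact: val_in.
  by exists (into v); rewrite /tube_proj /= val_into.
have co : continuous (val : tube E -> V) := @val_continuous _ (tube E).
split.
- split; last exact: box_self.
  by apply: open_comp; [move=> y _; exact: co|exact: box_open].
- by rewrite pI; apply: proj_open; apply: openI; [exact: box_open|exact: tube_is_open].
- by move=> u bu; rewrite /tube_proj /= projK // into_val.
- move=> u bu; split.
    apply: continuous_comp; first exact: co.
    exact: differentiable_continuous (diff_proj _).
  move=> c d -> -> _ _ /=.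
  have [e e0 he] := near_open tube_is_open (val_in u).
  apply: (@eqV_differentiable _ _ proj); last exact: diff_proj.
  by exists e => // w /he Ew; rewrite /= /tube_proj val_into.
- move=> z; rewrite pI => -[v [bv Ev] <-].
  have sv := proj_slit bv; have db := diff_branch sv; have vK := projK bv.
  split.
    apply: continuous_comp; first exact: differentiable_continuous db.
    by rewrite vK; exact: into_continuous tube_is_open _ _ Ev.
  move=> c d -> -> _ _ /=.
  have := @diff_val_into _ _ tube_is_open tube_origin (branch (val x)) (proj v) db.
  by rewrite vK => /(_ Ev).
Qed.

Definition tube_domain : riemann_domain R 2 := RiemannDomain
  (open_manifoldP tube_is_open tube_origin) (ex_intro _ tube_origin I)
  tube_space_connected proj_locally_biholomorphic.

End TubeDomain.

(** * Tubes over convex polygons are Stein *)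

Section SteinTube.
Context {R : realType} (E : R -> R -> Prop) (sides : seq (R * R * R)).
Hypotheses (oE : bopen E) (sE : star E) (E0 : E 0 0).
Hypothesis E_sides : forall y1 y2, E y1 y2 <->
  forall l, l \in sides -> l.1.1 * y1 + l.1.2 * y2 < l.2.
Local Notation V := 'rV[Cx R]_2.
Local Notation X := (tube_domain oE sE E0).
Local Notation into := (into (tube_origin E0)).

Definition form (l : R * R * R) (v : V) : Cx R := rc l.1.1 * c0 v + rc l.1.2 * c1 v.

Lemma im_form l v : im (form l v) = l.1.1 * im (c0 v) + l.1.2 * im (c1 v).
Proof. by rewrite /form !reimE; ring. Qed.

Lemma diff_form l v : differentiable (form l) v.
Proof.
apply: dAdd; apply: dMul; try exact: dCst; [exact: diff_c0|exact: diff_c1].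
Qed.

Lemma im_form_continuous l : continuous (fun v => im (form l v)).
Proof.
move=> v; apply: continuous_comp; last exact: im_continuous.
exact: differentiable_continuous (diff_form l v).
Qed.

Lemma md_coord_continuous (c : V -> Cx R) : (forall v, differentiable c v) ->
  continuous (fun v => md (c v)).
Proof.
move=> dc v; apply: continuous_comp; last exact: md_continuous.
exact: differentiable_continuous (dc v).
Qed.

Lemma holo_val (g : V -> Cx R) : holoV (tube E) g -> @holo_fun R V X (fun x : X => g (val x)).
Proof.
move=> hg; apply/(@holo_funP R (tube E) (tube_origin E0)) => v Ev.
have [d d0 hd] := tube_open oE Ev.
apply: (eq_differentiable (g := g)); last exact: hg.
by exists d => // u /hd Eu; rewrite /= val_into.
Qed.

Lemma ge_rc (x : R) (M : Cx R) : rc x <= M -> M = rc (re M).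
Proof.
rewrite lecE => /andP[/eqP i _]; by apply: cxP; rewrite ?re_rc ?im_rc.
Qed.

Lemma hull_closed (L : set X) : L !=set0 -> closed (holo_hull L).
Proof.
move=> [y0 Ly0].
have -> : holo_hull L = \bigcap_(t in [set t : (X -> Cline R) * Cx R |
    holo_fun t.1 /\ forall y, L y -> `|t.1 y : Cx R| <= t.2]) [set x | `|t.1 x : Cx R| <= t.2].
  apply/seteqP; split=> [x hx [f M] [/= hf hM]|x hx f hf M hM]; first exact: hx.
  by have := hx (f, M); apply.
apply: closed_bigI => -[f M] [/= hf hM].
have := hM y0 Ly0; rewrite normE => /ge_rc ->.
rewrite (_ : [set x | _] = (fun x => md (f x : Cx R)) @^-1` [set t | t <= re M]); last first.
  by apply/seteqP; split=> x /=; rewrite normE rc_le.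
apply: preimage_closed; last exact: closed_le.
move=> x _; apply: continuous_comp; last exact: md_continuous.
by have [] := hf x I.
Qed.

Lemma hull_md (L : set X) (g : V -> Cx R) (M : R) : holoV (tube E) g ->
  (forall y, L y -> md (g (val y)) <= M) -> forall x, holo_hull L x -> md (g (val x)) <= M.
Proof.
move=> hg hM x hx; rewrite -rc_le -normE.
have := hx _ (holo_val hg) (rc M); apply => y Ly.
by rewrite normE rc_le; exact: hM.
Qed.

Lemma compact_max (L : set X) (h : V -> R) : L !=set0 -> compact L -> continuous h ->
  exists2 y, L y & forall y', L y' -> h (val y') <= h (val y).
Proof.
move=> L0 cL ch; have [|y /set_mem Ly hy] := @compact_EVT_max X R (fun x : X => h (val x)) L L0 cL.
  apply: continuous_subspaceT => x; apply: continuous_comp; last exact: ch.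
  exact: val_continuous.
by exists y => // y' Ly'; apply: hy; exact: mem_set.
Qed.

(** The modulus of the exponential of - i times a linear form with real coefficients is
    the exponential of the value of the form on imaginary parts.  Hence the hull
    satisfies the linear inequalities of the sides with the maxima over the given compact
    set as bounds, and these are strictly smaller than the bounds in [sides]. *)
Theorem tube_stein : stein X.
Proof.
split; last first.
  move=> x y xy; have [e0|n0] := eqVneq (c0 (val x)) (c0 (val y)).
    exists (fun z : X => c1 (val z)); first by apply: holo_val => v _; exact: diff_c1.
    by move=> e1; apply: xy; apply: val_inj; exact: vP.
  exists (fun z : X => c0 (val z)); first by apply: holo_val => v _; exact: diff_c0.
  exact/eqP.
move=> L cL; have [L0|/set0P L0] := eqVneq L set0.
  rewrite (_ : holo_hull L = set0); first exact: compact0.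
  apply/seteqP; split=> // x hx.
  have h0 : @holo_fun R V X (fun _ => 0) by apply: (@holo_val (fun _ => 0)) => v _; exact: dCst.
  have := hx _ h0 (-1); rewrite normr0 oppr_ge0 ler10 => H; suff : false by [].
  by apply: H => y; rewrite L0.
have [a0 La0 ha0] := compact_max L0 cL (md_coord_continuous (@diff_c0 R)).
have [a1 La1 ha1] := compact_max L0 cL (md_coord_continuous (@diff_c1 R)).
have /choice[m hm] : forall l, exists y, L y /\
    forall y', L y' -> im (form l (val y')) <= im (form l (val y)).
  by move=> l; have [y Ly hy] := compact_max L0 cL (@im_form_continuous l); exists y.
pose M := Num.max (md (c0 (val a0))) (md (c1 (val a1))).
pose C := [set v : V | md (c0 v) <= M /\ md (c1 v) <= M] `&`
  \bigcap_(l in [set` sides]) [set v | im (form l v) <= im (form l (val (m l)))].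
have CE : C `<=` tube E.
  move=> v [_ hv]; apply/E_sides => l ls; rewrite -im_form.
  apply: le_lt_trans (hv l ls) _; rewrite im_form.
  by have /E_sides/(_ l ls) := val_in (m l).
have cC : compact C.
  apply: compact_closedI; first exact: compact_polydisc.
  apply: closed_bigI => l _.
  apply: (@preimage_closed _ _ (fun v => im (form l v)) [set t | t <= _]); last exact: closed_le.
  by move=> v _; exact: im_form_continuous.
have cI : compact (into @` C).
  by apply: continuous_compact cC; apply: into_within => //; exact: tube_is_open.
apply: (subclosed_compact _ cI); first exact: hull_closed.
move=> x hx; exists (val x); last exact: into_val.
split.
  split.
  - apply: (@hull_md L) hx => [v _|y Ly]; first exact: diff_c0.
    by rewrite le_max ha0.
  - apply: (@hull_md L) hx => [v _|y Ly]; first exact: diff_c1.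
    by rewrite le_max ha1 ?orbT.
move=> l ls /=.
have mE v : md (cexp (- ii * form l v)) = expR (im (form l v)).
  by rewrite md_cexp; congr expR; rewrite !reimE; ring.
have dE v : differentiable (fun v => cexp (- ii * form l v)) v.
  apply: (differentiable_comp (diff_scale (- ii) (diff_form l v))); exact: diff_cexp.
rewrite -ler_expR -(mE (val x)).
apply: (@hull_md L (fun v => cexp (- ii * form l v))) hx => [v _|y Ly]; first exact: dE.
by rewrite mE ler_expR; have [_] := hm l; apply.
Qed.

End SteinTube.

(** * The envelope of holomorphy *)

Section Envelope.
Context {R : realType} (om K : R -> R -> Prop).
Local Notation V := 'rV[Cx R]_2.
Hypotheses (oO : bopen om) (sO : star om) (O0 : om 0 0).
Hypotheses (oK : bopen K) (sK : star K) (K0 : K 0 0).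
Hypothesis OK : forall y1 y2, om y1 y2 -> K y1 y2.
Hypothesis KT : forall y1 y2, K y1 y2 <-> in_triangle om y1 y2.
Hypothesis schlicht : forall u v, tube om u -> tube om v -> proj u = proj v -> u = v.

Local Notation X := (tube_domain oK sK K0).
Local Notation into := (into (tube_origin K0)).

Definition base : set (Cspace R 2) := proj @` tube om.

Lemma base_domain : is_domain base.
Proof.
split.
- by apply: proj_open; exact: tube_is_open.
- apply: connected_continuous_connected; first exact: star_tube_connected.
  by apply: continuous_subspaceT => v; exact: differentiable_continuous (diff_proj v).
- by exists (proj 0); exists 0 => //; rewrite /tube /= !cE !reimE.
Qed.

Lemma section_ex : exists s : V -> V, forall v, tube om v -> s (proj v) = v.
Proof.
have /choice[s hs] : forall z, exists w, forall v, tube om v -> proj v = z -> w = v.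
  move=> z; have [[v Ev vz]|n] := pselect (base z).
    by exists v => w Ew wz; apply: schlicht => //; rewrite vz.
  by exists 0 => v Ev vz; case: n; exists v.
by exists s => v Ev; apply: hs.
Qed.

(** The inverse of [proj] from the domain to the tube over [om], given by [branch] near
    each point. *)
Definition sec : V -> V := projT1 (cid section_ex).

Lemma secK v : tube om v -> sec (proj v) = v.
Proof. by rewrite /sec; case: cid => s /=; apply. Qed.

Lemma diff_sec v : tube om v -> differentiable sec (proj v).
Proof.
move=> Ov; have sv := proj_slit (box_self v); have vK := projK (box_self v).
have db := diff_branch sv; apply: eqV_differentiable (diff_branch sv).
have [d1 d10 h1] := near_open (@slit_open _ v) sv.
have [|d2 d20 h2] := proj1 (nbhs_vP (proj v) (branch v @^-1` tube om)).
  apply: (differentiable_continuous db); rewrite vK; apply: open_nbhs_nbhs; split => //.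
  exact: tube_is_open.
exists (Num.min d1 d2); first by rewrite lt_min d10.
move=> w; rewrite lt_min => /andP[/h1 sw /h2 bw].
by rewrite -{1}(branchK sw) secK.
Qed.

Definition embed (z : Cspace R 2) : X := into (sec z).

Lemma tubeOK v : tube om v -> tube K v. Proof. exact: OK. Qed.

Lemma val_embed v : tube om v -> val (embed (proj v)) = v.
Proof. by move=> Ov; rewrite /embed secK // val_into //; exact: tubeOK. Qed.

Lemma embed_extends : extends_all base embed.
Proof.
split.
- move=> _ [v Ov <-]; have ds := diff_sec Ov; split.
    apply: continuous_comp; first exact: differentiable_continuous ds.
    by rewrite secK //; apply: into_continuous (tubeOK Ov); exact: tube_is_open.
  move=> c d -> -> _ _ /=.
  apply: (@diff_val_into _ _ (tube_is_open oK) (tube_origin K0) sec) => //.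
  by rewrite secK //; exact: tubeOK.
- move=> _ [v Ov <-]; rewrite -[rd_proj _]/(proj (val (embed (proj v)))).
  by rewrite val_embed.
- move=> f hf; have [ext _] := star_tube oO sO O0 OK KT.
  have [v Ov|F [hF FE]] := ext (f \o proj).
    have [|_ /(_ _ _ erefl erefl I I) df] := hf (proj v); first by exists v.
    exact: (differentiable_comp (diff_proj v) df).
  exists (fun x : X => F (val x)); first exact: holo_val.
  by move=> _ [v Ov <-]; rewrite val_embed // FE.
Qed.

Section Minimality.
Context (Y : riemann_domain R 2) (b : Cspace R 2 -> Y).
Hypotheses (sY : stein Y) (bE : extends_all base b).

Definition hol_at (h : V -> Y) (v : V) : Prop := {for v, continuous h} /\
  forall d, atlas Y d -> chart_dom d (h v) -> differentiable (d \o h) v.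

Lemma hol_at_comp (h : V -> Y) (g : V -> V) v : differentiable g v -> hol_at h (g v) ->
  hol_at (h \o g) v.
Proof.
move=> dg [ch dh]; split.
  by apply: continuous_comp ch; exact: differentiable_continuous dg.
by move=> d ad dd; exact: (differentiable_comp dg (dh d ad dd)).
Qed.

(** The chain rule, in a chart of [Y] around the image point. *)
Lemma holo_comp (F : Y -> Cline R) (h : V -> Y) v : holo_fun F -> hol_at h v ->
  differentiable (F \o h : V -> Cx R) v.
Proof.
move=> hF [ch dh]; have [_ _ atl cov _] := rd_manifold Y.
have [c ac cv] := cov (h v); have [oc _ _ _ cK] := atl c ac.
have [_ /(_ _ _ ac erefl cv I) dF] := hF (h v) I.
have dch := dh c ac cv.
have /nbhs_vP[e e0 he] : nbhs v (h @^-1` chart_dom c).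
  by apply: ch; exact: open_nbhs_nbhs.
apply: (@eq_differentiable _ _ ((F \o chart_inv c) \o (c \o h))).
  by exists e => // u /he cu; rewrite /= cK.
exact: (differentiable_comp dch dF).
Qed.

Lemma holo_fun_exp (F : Y -> Cline R) k : holo_fun F -> @holo_fun R V Y (fun y => (F y : Cx R) ^+ k).
Proof.
move=> hF y _; have [cF dF] := hF y I.
have dX (z : Cx R) : differentiable (fun z : Cx R => z ^+ k) z.
  by apply: dExp; exact: (@ex_diff _ _ _ _ _ id).
split.
  exact: (continuous_comp cF (differentiable_continuous (dX (F y)))).
move=> c d ac -> cy _.
have D := dF c _ ac erefl cy I.
exact: (differentiable_comp D (dX _)).
Qed.

(** [F] and [G] extend the same function of the domain, to [Y] and to the tube. *)
Definition corr (F : Y -> Cline R) (G : V -> Cx R) : Prop :=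
  [/\ holo_fun F, holoV (tube K) G & forall v, tube om v -> G v = F (b (proj v))].

Lemma hol_at_b v : tube om v -> hol_at b (proj v).
Proof.
move=> Ov; have [hb _ _] := bE; have [|cb db] := hb (proj v); first by exists v.
by split=> // d ad dd; have := db _ d erefl ad I dd.
Qed.

Lemma hol_at_bproj v : tube om v -> hol_at (b \o proj) v.
Proof. by move=> Ov; apply: hol_at_comp (hol_at_b Ov); exact: diff_proj. Qed.

Lemma corr_ex F : holo_fun F -> exists G, corr F G.
Proof.
move=> hF; have [ext _] := star_tube oO sO O0 OK KT.
have [v Ov|G [hG GE]] := ext (F \o (b \o proj)).
  by apply: holo_comp => //; exact: hol_at_bproj.
by exists G; split.
Qed.

Lemma corr_ex_coord (G : V -> Cx R) : holoV (tube K) G -> exists F, corr F G.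
Proof.
move=> hG; have [_ _ ext] := bE.
have [|F hF FE] := ext (G \o sec : Cspace R 2 -> Cline R).
  move=> _ [v Ov <-]; have ds := diff_sec Ov.
  have dG : differentiable (G \o sec) (proj v).
    by apply: (differentiable_comp ds); apply: hG; rewrite secK //; exact: tubeOK.
  split; first exact: differentiable_continuous dG.
  by move=> c d -> -> _ _.
exists F; split => // v Ov; rewrite FE; last by exists v.
by rewrite /= secK.
Qed.

Lemma corr_exp F G k : corr F G -> corr (fun y => (F y : Cx R) ^+ k) (fun v => G v ^+ k).
Proof.
move=> [hF hG FG]; split; first exact: holo_fun_exp.
- by move=> v Kv; apply: dExp; exact: hG.
- by move=> v Ov; rewrite FG.
Qed.

Definition lies_over v y := forall F G, corr F G -> F y = G v.

Lemma lies_over_inj v y y' : lies_over v y -> lies_over v y' -> y = y'.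
Proof.
move=> h h'; apply: contrapT => /(proj2 sY) [F hF]; apply.
by have [G FG] := corr_ex hF; rewrite (h _ _ FG) (h' _ _ FG).
Qed.

Lemma lies_over_fun v v' y : tube K v -> tube K v' -> lies_over v y -> lies_over v' y -> v = v'.
Proof.
move=> Kv Kv' h h'; apply: vP.
- have [|F FG] := @corr_ex_coord c0; first by move=> u _; exact: diff_c0.
  by rewrite -(h _ _ FG) (h' _ _ FG).
- have [|F FG] := @corr_ex_coord c1; first by move=> u _; exact: diff_c1.
  by rewrite -(h _ _ FG) (h' _ _ FG).
Qed.

(** If m < x then the powers of x / m are unbounded. *)
Lemma power_bound (x m C : R) : 0 <= x -> 0 <= m -> (forall k, x ^+ k <= C * m ^+ k) -> x <= m.
Proof.
move=> x0 m0 H; rewrite leNgt; apply/negP => mx.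
have [m00|mn0] := eqVneq m 0.
  by have := H 1%N; rewrite m00 expr1 mulr0 leNgt; apply/negP; rewrite negbK -m00.
have mp : 0 < m by rewrite lt_neqAle eq_sym mn0.
pose t := x / m - 1.
have t0 : 0 < t by rewrite /t subr_gt0 ltr_pdivlMr // mul1r.
have B k : 1 + k%:R * t <= (x / m) ^+ k.
  elim: k => [|k IH]; first by rewrite mul0r addr0 expr0.
  have -> : x / m = 1 + t by rewrite /t; ring.
  rewrite (_ : x / m = 1 + t) in IH; last by rewrite /t; ring.
  have k0 : 0 <= k%:R * t by rewrite mulr_ge0 // ltW.
  have := ler_wpM2l (ltW t0) IH.
  have : 0 <= k%:R * t * t by rewrite mulr_ge0 // ltW.
  rewrite exprS -natr1; lra.
have U k : (x / m) ^+ k <= C.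
  by rewrite expr_div_n ler_pdivrMr ?exprn_gt0.
have := le_trans (B (Num.truncn (C / t)).+1) (U _).
have := truncnS_gt (C / t); rewrite ltr_pdivrMr // => h1 h2.
lra.
Qed.

(** The bound of [loc_dominated] applies to all powers of a function, which removes the
    constant from the estimate. *)
Lemma lies_over_hull v : tube K v -> exists2 d, 0 < d & exists2 L : set V, compact L /\ L `<=` tube om &
  forall u y, vmd (u - v) < d -> lies_over u y -> holo_hull (b @` (proj @` L)) y.
Proof.
move=> Kv; have [_ dom] := star_tube oO sO O0 OK KT.
have [d [L [C [d0 cL LO H]]]] := dom v Kv; exists d => //; exists L => // u y uv uy F hF M hM.
have [G FG] := corr_ex hF; rewrite (uy _ _ FG).
have P k m : (forall w, L w -> md (G w ^+ k) <= m) -> md (G u ^+ k) <= C * m.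
  move=> h; have [_ hGk _] := corr_exp k FG; exact: (H _ hGk m h u uv).
(* An empty [L] would bound the power of exponent 0 by 0. *)
have [w0 Lw0] : L !=set0.
  apply/set0P/eqP => L0; have : md (G u ^+ 0) <= C * 0 by apply: P => w; rewrite L0.
  by rewrite expr0 md1 mulr0 ler10.
have GM w : L w -> rc (md (G w)) <= M.
  move=> Lw; have [_ _ FG'] := FG; rewrite -normE FG'; last exact: LO.
  by apply: hM; exists (proj w) => //; exists w.
have ME := ge_rc (GM w0 Lw0); rewrite ME in GM *; rewrite normE rc_le.
have M0 : 0 <= re M by have := GM w0 Lw0; rewrite rc_le; exact: le_trans (md_ge0 _).
apply: (@power_bound _ _ C) => // [|k]; first exact: md_ge0.
rewrite -mdX; apply: P => w /GM; rewrite rc_le mdX => h.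
by rewrite lerXn2r ?nnegrE ?md_ge0.
Qed.

Definition lift_ball v d (psi : V -> Y) := forall u, vmd (u - v) < d ->
  [/\ tube K u, rd_proj (psi u) = proj u, hol_at psi u & lies_over u (psi u)].

(** The points near which the given map of the domain into [Y] continues to a holomorphic
    lift of [proj] that is compatible with all extended functions. *)
Definition lifted : set V := [set v | exists2 d, 0 < d & exists psi, lift_ball v d psi].

Lemma lifted_om v : tube om v -> lifted v.
Proof.
move=> Ov; have [d d0 hd] := tube_open oO Ov; exists d => //; exists (b \o proj) => u /hd Ou.
have [_ bS _] := bE; split; first exact: tubeOK.
- by rewrite /= bS //; exists u.
- exact: hol_at_bproj.
- by move=> F G [_ _ ->].
Qed.

Lemma lifted_open : open lifted.
Proof.
apply: open_near => v [d d0 [psi hpsi]]; exists (d / 2); first by rewrite divr_gt0.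
move=> u hu; exists (d / 2); first by rewrite divr_gt0.
exists psi => w hw; apply: hpsi; have := vmdD (w - u) (u - v); rewrite addrA subrK.
lra.
Qed.

Lemma lift_ex : exists phi : V -> Y, forall v, lifted v -> lies_over v (phi v).
Proof.
have /choice[phi hphi] : forall v, exists y, lifted v -> lies_over v y.
  move=> v; have [[d d0 [psi hpsi]]|n] := pselect (lifted v).
    by exists (psi v) => _; have [] := hpsi v; rewrite ?subrr ?vmd0.
  by exists (b 0).
by exists phi.
Qed.

Definition lift : V -> Y := projT1 (cid lift_ex).

Lemma liftP v : lifted v -> lies_over v (lift v).
Proof. by rewrite /lift; case: cid => phi /=; apply. Qed.

(** Lifts are unique pointwise, hence the chosen one agrees with the local ones. *)
Lemma lift_near v : lifted v -> exists2 d, 0 < d & lift_ball v d lift.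
Proof.
move=> [d d0 [psi hpsi]].
have E u : vmd (u - v) < d -> lift u = psi u.
  move=> hu; have [_ _ _ ou] := hpsi u hu; apply: (lies_over_inj (v := u)) => //.
  apply: liftP; exists (d - vmd (u - v)); first by rewrite subr_gt0.
  exists psi => w hw; apply: hpsi; have := vmdD (w - u) (u - v); rewrite addrA subrK; lra.
exists d => // u hu; have [Ku pu [cu du] ou] := hpsi u hu; rewrite E //; split => //.
have Eu : \forall w \near u, lift w = psi w.
  apply/nbhs_vP; exists (d - vmd (u - v)); first by rewrite subr_gt0.
  by move=> w hw; apply: E; have := vmdD (w - u) (u - v); rewrite addrA subrK; lra.
split.
  move=> A; rewrite E // => /cu /nbhs_vP[r r0 hr].
  move/nbhs_vP: Eu => [e e0 he]; apply/nbhs_vP; exists (Num.min e r); first by rewrite lt_min e0.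
  by move=> w; rewrite lt_min => /andP[/he /= hw /hr]; rewrite /= hw.
move=> c ac; rewrite E // => cc.
apply: (eqV_differentiable (g := c \o psi)); last exact: du.
by move/nbhs_vP: Eu => [e e0 he]; exists e => // w /he /= ->.
Qed.

(** A limit of lifted points is lifted: by domination the lifts stay in a
    compact hull, and near a cluster point the projection of [Y] has a local
    section, which agrees with the lift by the identity theorem. *)
Lemma lifted_closed v : tube K v -> closure lifted v -> lifted v.
Proof.
move=> Kv clv; have [d d0 [L [cL LO] hull]] := lies_over_hull Kv.
pose H := holo_hull (b @` (proj @` L)).
have cH : compact H.
  apply: (proj1 sY); rewrite image_comp; apply: continuous_compact cL.
  by apply: continuous_in_subspaceT => u /set_mem /LO Ou; have [] := hol_at_bproj Ou.
have pF : ProperFilter (within lifted (nbhs v)) by exact: within_nbhs_proper.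
pose F := lift @ within lifted (nbhs v).
have FH : F H.
  suff : nbhs v [set u | lifted u -> H (lift u)] by [].
  by apply/nbhs_vP; exists d => // u hu Tu; exact: hull hu (liftP Tu).
have [y [Hy cy]] := cH F _ FH.
(* [y] is a cluster point of the lifts. *)
have near_y (S : set Y) r : nbhs y S -> 0 < r ->
    exists u, [/\ lifted u, vmd (u - v) < r & S (lift u)].
  move=> yS r0; have [|_ [[u [Tu ur] <-] Su]] := cy (lift @` [set u | lifted u /\ vmd (u - v) < r]) S _ yS.
    suff : nbhs v [set u | lifted u -> (lift @` [set u | lifted u /\ vmd (u - v) < r]) (lift u)] by [].
    by apply/nbhs_vP; exists r => // u hu Tu; exists u.
  by exists u.
have [U [g [[oU Uy] oP gK hp hg]]] := rd_projP y.
have [cp _] := hp y Uy.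
have py : rd_proj y = proj v.
  apply: (@norm_hausdorff _ V) => A B Ay Bv.
  have /nbhs_vP[r r0 hr] := differentiable_continuous (diff_proj v) Bv.
  have [u [Tu ur Au]] := near_y _ _ (cp _ Ay) r0.
  exists (proj u); split; last exact: hr.
  have [e e0 he] := lift_near Tu; have [|_ <- _ _] := he u; first by rewrite subrr vmd0.
  exact: Au.
have [r1 r10 h1] := tube_open oK Kv.
pose PU : set V := (@rd_proj R 2 Y) @` U.
have [|r2 r20 h2] := proj1 (nbhs_vP v (proj @^-1` PU)).
  apply: (differentiable_continuous (diff_proj v)); apply: open_nbhs_nbhs; split => //.
  by exists y.
pose r := Num.min r1 r2; have r0 : 0 < r by rewrite lt_min r10.
have hr u : vmd (u - v) < r -> tube K u /\ PU (proj u).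
  by rewrite lt_min => /andP[/h1 ? /h2 ?].
have hgp u : vmd (u - v) < r -> hol_at (g \o proj) u.
  move=> /hr [_ Pu]; apply: hol_at_comp; first exact: diff_proj.
  have [cg dg] := hg _ Pu; split; first exact: cg.
  move=> c ac cc.
  exact: (dg _ c erefl ac I cc).
(* At a lifted point [u1] near [v] whose lift is in [U], the lift and the local section agree. *)
have [u1 [Tu1 ur1 Uu1]] := near_y U r (open_nbhs_nbhs (conj oU Uy)) r0.
have [e e0 he] := lift_near Tu1.
have [_ _ [cu1 _] _] : [/\ tube K u1, rd_proj (lift u1) = proj u1, hol_at lift u1 & lies_over u1 (lift u1)].
  by apply: he; rewrite subrr vmd0.
have [e2 e20 he2] := proj1 (nbhs_vP u1 (lift @^-1` U)) (cu1 _ (open_nbhs_nbhs (conj oU Uu1))).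
exists r => //; exists (g \o proj) => u ur; have [Ku [w Uw wu]] := hr u ur.
split; [exact: Ku|by rewrite /= -wu gK|exact: hgp|].
move=> f G fG; have [hf hG _] := fG; apply/eqP; rewrite -subr_eq0; apply/eqP.
apply: (@identity_line _ (fun u => f (g (proj u)) - G u : Cx R) u1 u).
- move=> t /andP[t0 t1].
  have tr : vmd (u1 + rc t *: (u - u1) - v) < r.
    have -> : u1 + rc t *: (u - u1) - v = rc (1 - t) *: (u1 - v) + rc t *: (u - v).
      by apply: vP; rewrite !cE rcB rc1; ring.
    apply: le_lt_trans (vmdD _ _) _; rewrite !vmdZ !md_rc !ger0_norm ?subr_ge0 //.
    have m1 : (1 - t) * vmd (u1 - v) <= (1 - t) * Num.max (vmd (u1 - v)) (vmd (u - v)).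
      by rewrite ler_wpM2l ?subr_ge0 // le_max lexx.
    have m2 : t * vmd (u - v) <= t * Num.max (vmd (u1 - v)) (vmd (u - v)).
      by rewrite ler_wpM2l // le_max lexx orbT.
    have : Num.max (vmd (u1 - v)) (vmd (u - v)) < r by rewrite gt_max ur1.
    by move: m1 m2; lra.
  set q := u1 + _ in tr *; exists (r - vmd (q - v)); first by rewrite subr_gt0.
  move=> q' hq; have qr : vmd (q' - v) < r.
    by have := vmdD (q' - q) (q - v); rewrite addrA subrK; lra.
  apply: dSub; first exact: (holo_comp hf (hgp q' qr)).
  by apply: hG; have [] := hr q' qr.
- exists (Num.min e e2); first by rewrite lt_min e0.
  move=> q; rewrite lt_min => /andP[/he [_ pq _ oq] /he2 Uq].
  by rewrite -pq gK // (oq _ _ fG) subrr.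
Qed.

Lemma lifted_all v : tube K v -> lifted v.
Proof.
move=> Kv; have cK := star_tube_connected sK K0.
suff KE : tube K `&` lifted = tube K.
  by have := Kv; rewrite -KE => -[].
apply: cK.
- exists 0; split; first by rewrite /tube /= !cE !reimE.
  by apply: lifted_om; rewrite /tube /= !cE !reimE.
- by exists lifted => //; exact: lifted_open.
- exists (closure lifted); first exact: closed_closure.
  apply/seteqP; split=> u [Ku Tu]; split => //; first exact: subset_closure.
  exact: lifted_closed.
Qed.

(** The lift is injective because the coordinates of the tube extend from the domain to
    functions on [Y]. *)
Lemma minimal : exists phi : X -> Y, [/\ holo_on [set: X] phi, injective phi,
  forall x, rd_proj (phi x) = rd_proj x & forall z, base z -> phi (embed z) = b z].
Proof.
have vK (x : X) : tube K (val x) by exact: val_in.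
have lP (x : X) : [/\ tube K (val x), rd_proj (lift (val x)) = proj (val x),
    hol_at lift (val x) & lies_over (val x) (lift (val x))].
  have [d d0 hd] := lift_near (lifted_all (vK x)); apply: hd; rewrite subrr vmd0 //.
exists (fun x : X => lift (val x)); split.
- move=> x _; have [_ _ [cl dl] _] := lP x; split.
    apply: continuous_comp cl; exact: val_continuous.
  move=> c d -> ad _ dd; have [r r0 hr] := tube_open oK (vK x).
  apply: (eqV_differentiable (g := d \o lift)); last exact: dl.
  by exists r => // w /hr Kw; rewrite /= val_into.
- move=> x x' e; apply: val_inj; have [_ _ _ h] := lP x; have [_ _ _ h'] := lP x'.
  by apply: (lies_over_fun (vK x) (vK x') h); rewrite e.
- by move=> x; have [_ -> _ _] := lP x.
- move=> _ [v Ov <-]; rewrite val_embed //.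
  apply: (@lies_over_inj v); first by apply: liftP; exact: lifted_om.
  by move=> F G [_ _ ->].
Qed.

End Minimality.

End Envelope.

Local Open Scope card_scope.

(** * Counting sheets *)

Section Sheets.
Context {R : realType}.
Local Notation V := 'rV[Cx R]_2.
Local Notation hexagon := (@hexagon R).
Local Notation pinwheel := (@pinwheel R).

Lemma hexagon_open : bopen hexagon.
Proof.
move=> y1 y2 /hexagon_triangle T.
have [E [W [oW _ Wy [_ WK] _]]] := local_extension pinwheel_near pinwheel_star pinwheel0 T.
have [d d0 hd] := oW _ _ Wy; exists d => // z1 z2 h1 h2.
by case: (WK _ _ (hd _ _ h1 h2)) => [/pinwheel_hexagon//|/hexagon_triangle].
Qed.

Lemma hexagon_star : star hexagon.
Proof.
move=> t y1 y2 /andP[t0 t1] h; have [->|tn1] := eqVneq t 1; first by rewrite !mul1r.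
have tl : t < 1 by rewrite lt_neqAle tn1.
have := @hexagon_convex _ t 0 y1 y2 y1 y2 t0 (lexx 0).
by rewrite addr0 !mul0r !addr0; apply.
Qed.

Lemma hexagon0 : hexagon 0 0.
Proof. exact: pinwheel_hexagon pinwheel0. Qed.

Definition hexagon_sides : seq (R * R * R) :=
  [:: (-1, 0, 11); (0, -1, 11); (1, 1, 11); (-5, 9, 127); (-9, -14, 127); (14, 5, 127)].

Lemma hexagon_sidesP y1 y2 : hexagon y1 y2 <->
  forall l, l \in hexagon_sides -> l.1.1 * y1 + l.1.2 * y2 < l.2.
Proof.
split=> [[h1 h2 h3 [h4 h5 h6]] l|h].
  by rewrite !inE => /or4P[/eqP->|/eqP->|/eqP->|/or3P[/eqP->|/eqP->|/eqP->]] /=; lra.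
have k1 := h (-1, 0, 11); have k2 := h (0, -1, 11); have k3 := h (1, 1, 11).
have k4 := h (-5, 9, 127); have k5 := h (-9, -14, 127); have k6 := h (14, 5, 127).
rewrite !inE !eqxx ?orbT /= in k1 k2 k3 k4 k5 k6.
move: (k1 isT) (k2 isT) (k3 isT) (k4 isT) (k5 isT) (k6 isT) => {}k1 {}k2 {}k3 {}k4 {}k5 {}k6.
by split; [lra|lra|lra|split; lra].
Qed.

Lemma pinwheel_schlicht (u v : V) : tube pinwheel u -> tube pinwheel v -> proj u = proj v -> u = v.
Proof.
move=> Ou Ov /proj_eq[i [j E]]; move: Ou; rewrite E /tube /=.
have [-> ->] := im_shift v i j; have [l hl] := pinwheel_translate Ov.
move=> h; have [_ /(_ h) [-> ->]] := hl i j (pinwheel_hexagon h).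
exact: shift0.
Qed.

Local Notation X := (tube_domain hexagon_open hexagon_star hexagon0).
Local Notation into := (into (tube_origin hexagon0)).

Lemma shift_shift (v : V) i j i' j' : shift (shift v i j) i' j' = shift v (i + i') (j + j').
Proof.
by apply: vP; rewrite /shift ?c0D ?c1D ?c0_mk ?c1_mk intrD mulrDl rcD; ring.
Qed.

Lemma card_le_coloring T (A : set T) m (c : T -> nat) : (forall x, A x -> (c x < m)%N) ->
  (forall x y, A x -> A y -> c x = c y -> x = y) -> A #<= `I_m.
Proof.
move=> hc inj; have e : c @` A #= A.
  by apply: inj_card_eq => x y /set_mem Ax /set_mem Ay; exact: inj.
rewrite -(card_le_eql e); apply: subset_card_le => _ [x Ax <-]; exact: hc.
Qed.

Lemma fibre_ge (v : V) (ls : seq (int * int)) : uniq ls ->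
  (forall l, l \in ls -> tube hexagon (shift v l.1 l.2)) -> `I_(size ls) #<= fibre X (proj v).
Proof.
move=> uls hls; pose t k : X := into (shift v (nth (0, 0) ls k).1 (nth (0, 0) ls k).2).
have tK k : (k < size ls)%N -> val (t k) = shift v (nth (0, 0) ls k).1 (nth (0, 0) ls k).2.
  by move=> hk; apply: val_into; apply: hls; exact: mem_nth.
have e : t @` `I_(size ls) #= `I_(size ls).
  apply: inj_card_eq => k k' /set_mem /= hk /set_mem /= hk' E.
  have := congr1 val E; rewrite tK // tK // => E'.
  have [a1 b1] := im_shift v (nth (0, 0) ls k).1 (nth (0, 0) ls k).2.
  have [a2 b2] := im_shift v (nth (0, 0) ls k').1 (nth (0, 0) ls k').2.
  have I1 : (nth (0, 0) ls k).1%:~R = (nth (0, 0) ls k').1%:~R :> R.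
    by move: a1; rewrite E' a2; lra.
  have I2 : (nth (0, 0) ls k).2%:~R = (nth (0, 0) ls k').2%:~R :> R.
    by move: b1; rewrite E' b2; lra.
  apply/eqP; rewrite -(nth_uniq (0, 0) hk hk' uls); apply/eqP.
  by rewrite [LHS]surjective_pairing [RHS]surjective_pairing (intr_inj I1) (intr_inj I2).
rewrite -(card_le_eql e); apply: subset_card_le => _ [k /= hk <-].
suff : proj (val (t k)) = proj v by [].
by rewrite tK // proj_shift.
Qed.

(** Two points of a fibre with the same colour differ by a neighbouring lattice vector
    (i, j) with i - j divisible by 3, which is 0. *)
Lemma fibre_le3 z : fibre X z #<= `I_3.
Proof.
have [[x0 hx0]|n] := pselect (fibre X z !=set0); last first.
  by apply: (@card_le_coloring _ _ _ (fun _ => 0%N)) => [x hx|x y hx]; case: n; exists x.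
have /choice[c hc] : forall x : X, exists l : int * int, fibre X z x ->
    val x = shift (val x0) l.1 l.2.
  move=> x; have [hx|n] := pselect (fibre X z x); last by exists (0, 0).
  have [|i [j E]] := @proj_eq _ (val x) (val x0); first by rewrite -[proj _]/(rd_proj x) hx -hx0.
  by exists (i, j).
apply: (@card_le_coloring _ _ _ (fun x => `|(((c x).1 - (c x).2) %% 3)%Z|%N)).
  by move=> x _; lia.
move=> x y /hc Ex /hc Ey; set i := (c x).1 in Ex *; set j := (c x).2 in Ex *.
set i' := (c y).1 in Ey *; set j' := (c y).2 in Ey * => e.
have E : val y = shift (val x) (i' - i) (j' - j).
  by rewrite Ex shift_shift Ey; congr shift; ring.
have Kx : tube hexagon (val x) by exact: val_in.
have Ky : tube hexagon (val y) by exact: val_in.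
have : (i' - i, j' - j) \in neighbours.
  apply: (hexagon_translate Kx); move: Ky; rewrite E /tube /=.
  by have [-> ->] := im_shift (val x) (i' - i) (j' - j).
have m3 : ((i - j) %% 3)%Z = ((i' - j') %% 3)%Z by lia.
move=> nb; have [i0 j0] : i' - i = 0 /\ j' - j = 0.
  move: nb; rewrite !inE => /or4P[/eqP[? ?]|/eqP[? ?]|/eqP[? ?]|/or4P[/eqP[? ?]|/eqP[? ?]|/eqP[? ?]|/eqP[? ?]]]; lia.
by apply: val_inj; rewrite E i0 j0 shift0.
Qed.

Lemma fibre_le2 z : base pinwheel z -> fibre X z #<= `I_2.
Proof.
move=> [v Ov <-]; have [l hl] := pinwheel_translate Ov.
have F (x : X) : fibre X (proj v) x -> val x = v \/ val x = shift v l.1 l.2.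
  move=> hx; have [|i [j E]] := @proj_eq _ (val x) v; first by rewrite -[proj _]/(rd_proj x) hx.
  have Kx : tube hexagon (val x) by exact: val_in.
  move: Kx; rewrite {1}E /tube /=; have [-> ->] := im_shift v i j => /hl [[[i0 j0]|ij] _].
    by left; rewrite E i0 j0 shift0.
  by right; rewrite E -ij.
apply: (@card_le_coloring _ _ _ (fun x => (val x != v) : nat)); first by move=> x _; case: (_ != _).
move=> x y /F hx /F hy; have [Ex|nx] := eqVneq (val x) v; have [Ey|ny] := eqVneq (val y) v => // _.
  by apply: val_inj; rewrite Ex Ey.
case: hx => [ex|ex]; first by rewrite ex eqxx in nx.
case: hy => [ey|ey]; first by rewrite ey eqxx in ny.
by apply: val_inj; rewrite ex ey.
Qed.

Definition over (y1 y2 : R) : V := mk (ii * rc y1) (ii * rc y2).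

Lemma tube_shift_over E y1 y2 i j :
  tube E (shift (over y1 y2) i j) = E (y1 + i%:~R * 15) (y2 + j%:~R * 15).
Proof.
rewrite /tube /=; have [-> ->] := im_shift (over y1 y2) i j.
by rewrite /over c0_mk c1_mk !reimE !mul0r !mul1r !add0r.
Qed.

Lemma tube_over E y1 y2 : tube E (over y1 y2) = E y1 y2.
Proof. by rewrite -[over y1 y2]shift0 tube_shift_over !mul0r !addr0. Qed.

Lemma sheets_C2 : sheets_over X [set: Cspace R 2] 3.
Proof.
split=> [|z _]; last exact: fibre_le3.
exists (proj (over (-10) 5)) => //; apply/card_eqPle; split; first exact: fibre_le3.
(* The points (-10, 5), (5, -10) and (5, 5). *)
apply: (@fibre_ge _ [:: (0, 0); (1, -1); (1, 0)]) => // l.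
rewrite !inE => /or3P[] /eqP -> /=; rewrite tube_shift_over ?rmorphN1 ?rmorph1 ?rmorph0.
all: by split; [lra|lra|lra|split; lra].
Qed.

(** The point at nine tenths of the way from 0 to the vertex (-11, 8), and its translate
    by (15, -15). *)
Lemma sheets_base : sheets_over X (base pinwheel) 2.
Proof.
have Ov : pinwheel (9 / 10 * -11) (9 / 10 * 8) by apply: vertex_fork; [left|lra|lra].
have Bz : base pinwheel (proj (over (9 / 10 * -11) (9 / 10 * 8))).
  by exists (over (9 / 10 * -11) (9 / 10 * 8)) => //; rewrite tube_over.
split=> [|z]; last exact: fibre_le2.
exists (proj (over (9 / 10 * -11) (9 / 10 * 8))) => //.
apply/card_eqPle; split; first exact: fibre_le2.
apply: (@fibre_ge _ [:: (0, 0); (1, -1)]) => // l.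
rewrite !inE => /orP[] /eqP -> /=; rewrite tube_shift_over ?rmorphN1 ?rmorph1 ?rmorph0.
all: by split; [lra|lra|lra|split; lra].
Qed.

End Sheets.

Local Close Scope card_scope.
Local Close Scope ring_scope.

Theorem mainTheorem2 (R : realType) :
  exists (Omega : set (Cspace R 2)) (X : riemann_domain R 2)
         (alpha : Cspace R 2 -> X),
    is_domain Omega /\
    is_envelope Omega alpha /\
    sheets_over X Omega 2 /\
    sheets_over X [set: Cspace R 2] 3.
Proof.
exists (base (@pinwheel R)), (tube_domain hexagon_open hexagon_star hexagon0).
exists (embed hexagon_open hexagon_star hexagon0 (@pinwheel_schlicht R)).
split; first exact: base_domain pinwheel_near pinwheel_star pinwheel0.
split; last by split; [exact: sheets_base|exact: sheets_C2].
split.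
- exact: (tube_stein hexagon_open hexagon_star hexagon0 (@hexagon_sidesP R)).
- exact: (embed_extends pinwheel_near pinwheel_star pinwheel0 _ _ _ (@pinwheel_hexagon R) (@hexagon_triangle R)).
- move=> Y b; exact: (minimal pinwheel_near pinwheel_star pinwheel0 _ _ _ (@pinwheel_hexagon R) (@hexagon_triangle R)).
Qed.
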